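(* Let $a\in\mathcal C_\Gamma$. The inverse $\psi_a=\varphi_a^{-1}:\mathbb H\to\Omega_a$ of the Böttcher map extends continuously to $0$ and $\infty\in\widehat{\mathbb R}=\partial\mathbb H$, sending both these points to the fixed point $Z=1$ of $\mathcal F_a$, in the sense that the geodesic $\psi_a(\mathcal I)$, where $\mathcal I=\{it:t>0\}$, lands at both ends: $\psi_a(it)\to 1$ (in the $Z$-coordinate) as $t\to\infty$ and as $t\to0^+$.
   Context: Let $C(Z)=Z^3-3Z$, and let $Cov$ be the $(2:2)$ correspondence $Z\to W$ on $\widehat{\mathbb C}$ given by $Z^2+ZW+W^2=3$ (the deleted covering correspondence of $C$). For $a\in\mathbb C\setminus\{1\}$ let $J_a(Z)=\frac{(a+1)Z-2a}{2Z-(a+1)}$, the involution with fixed points $1$ and $a$. Let $\mathcal F_a=J_a\circ Cov$, i.e. the correspondence $Z\to W$ given by $Z^2+ZJ_a(W)+J_a(W)^2=3$. The point $Z=1$ is fixed by a branch of $\mathcal F_a$ which is a parabolic germ of multiplier $1$. A fundamental domain for $Cov$ is a simply connected open set $\Delta_{Cov}$ bounded by a Jordan curve and maximal among open sets disjoint from their image under $Cov$; a fundamental domain $\Delta_J$ for $J_a$ is defined in the same way with $J_a$ in place of $Cov$. The Klein Combination Locus $\mathcal K$ is the set of $a$ for which there exist such domains with $\Delta_{Cov}\cup\Delta_J=\widehat{\mathbb C}\setminus\{1\}$; these are always chosen with boundaries smooth at $Z=1$ and transverse there to the attracting-repelling axis of the parabolic germ. For $a\in\mathcal K$: $\Lambda_{a,-}=\bigcap_{n\ge0}\mathcal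 F_a^{-n}(\widehat{\mathbb C}\setminus\Delta_{Cov})$, $\Lambda_{a,+}=J_a(\Lambda_{a,-})$ (these meet only at $Z=1$ and do not depend on the choice of domains), $\Lambda_a=\Lambda_{a,-}\cup\Lambda_{a,+}$, $\Omega_a=\widehat{\mathbb C}\setminus\Lambda_a$. The connectedness locus is $\mathcal C_\Gamma=\{a\in\mathcal K:\Lambda_{a,-}\text{ is connected}\}$. Let $\mathbb H$ be the upper half-plane, $\alpha(z)=z+1$, $\beta(z)=z/(z+1)$. For $a\in\mathcal C_\Gamma$ it is known that $\mathcal F_a|_{\Omega_a}$ consists of two single-valued homeomorphisms of $\Omega_a$ and that there is a unique conformal homeomorphism $\varphi_a:\Omega_a\to\mathbb H$ (the Böttcher map) conjugating these two branches to $\alpha$ and $\beta$ respectively. *)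

(* Defs.v *)
From HB Require Import structures.
From mathcomp Require Import all_boot all_order all_algebra.
From mathcomp Require Import all_classical all_reals all_analysis.
From mathcomp Require Import complex.

Set Implicit Arguments.
Unset Strict Implicit.
Unset Printing Implicit Defensive.

Import Order.TTheory GRing.Theory Num.Theory.
Import numFieldNormedType.Exports.

Local Open Scope classical_set_scope.
Local Open Scope ring_scope.
Local Open Scope complex_scope.

(* The library's topology and norm on the regular module R[i]^o, made available
   on R[i] itself; derivability on R[i] is thus complex derivability. *)
HB.instance Definition _ (R : realType) :=
  PseudoPointedMetric.copy R[i] R[i]^o.
HB.instance Definition _ (R : realType) := NormedModule.copy R[i] R[i]^o.

(** * Topology *)

Section topology.
Variables (R : realType) (S T : topologicalType).
Implicit Types (D : set T).

Definition topological_boundary D : set T := closure D `\` D°.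

Definition homeomorphism_between (A : set S) (B : set T)
    (f : S -> T) (g : T -> S) : Prop :=
  [/\ {homo f : x / A x >-> B x} /\ {within A, continuous f},
      {homo g : y / B y >-> A y} /\ {within B, continuous g},
      forall x, A x -> g (f x) = x &
      forall y, B y -> f (g y) = y].

Definition path_in D (p : R -> T) (x y : T) : Prop :=
  [/\ {within `[0, 1], continuous p}, p @` `[0, 1] `<=` D, p 0 = x & p 1 = y].

Definition null_homotopic_in D (p : R -> T) : Prop :=
  exists H : R * R -> T,
    [/\ {within `[0, 1] `*` `[0, 1], continuous H},
        H @` (`[0, 1] `*` `[0, 1]) `<=` D,
        forall t, t \in `[0, 1] -> H (0, t) = p t /\ H (1, t) = p 0 &
        forall s, s \in `[0, 1] -> H (s, 0) = p 0 /\ H (s, 1) = p 0].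

Definition simply_connected D : Prop :=
  (forall x y, D x -> D y -> exists p, path_in D p x y) /\
  (forall x p, path_in D p x x -> null_homotopic_in D p).

Definition jordan_parametrization (g : R -> T) (J : set T) : Prop :=
  [/\ {within `[0, 1], continuous g}, g 0 = g 1,
      {in `[0, 1[ &, injective g} & J = g @` `[0, 1]].

Definition jordan_curve (J : set T) : Prop :=
  exists g, jordan_parametrization g J.

End topology.

Arguments simply_connected R {T} D.
Arguments jordan_curve R {T} J.

(** * Correspondences, as relations [Z -> W] *)

Section correspondences.
Variable T : Type.

Definition correspondence := T -> T -> Prop.
Implicit Types (F : correspondence) (A : set T).

Definition corr_image F A : set T := [set w | exists2 z, A z & F z w].
Definition corr_preimage F A : set T := [set z | exists2 w, A w & F z w].

End correspondences.

(** * The Riemann sphere: [None] is the point at infinity *)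

Notation sphere R := (one_point_compactification R[i]).

Section sphere.
Variable R : realType.
Local Notation C := R[i].

Local Notation sphere := (sphere R).

Definition pt (z : C) : sphere := Some z.
Definition infty : sphere := None.

(* The chart w |-> 1/w around infinity. *)
Definition chart_infty (w : C) : sphere := if w == 0 then infty else pt w^-1.

Definition holomorphic_at (phi : sphere -> C) (Z : sphere) : Prop :=
  if Z is Some z then derivable (phi \o pt) z 1
  else derivable (phi \o chart_infty) 0 1.

Definition upper_half_plane : set C := [set z | 0 < complex.Im z].

(** * The family of correspondences *)

(* Closure in the product of two spheres of the affine curve
   z^2 + z w + w^2 = 3: the only point at infinity is (infty, infty). *)
Definition Cov : correspondence sphere := fun Z W =>
  match Z, W with
  | Some z, Some w => z ^+ 2 + z * w + w ^+ 2 = 3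
  | None, None => True
  | _, _ => False
  end.

Definition J (a : C) (Z : sphere) : sphere :=
  if Z is Some z then
    if 2 * z - (a + 1) == 0 then infty
    else pt (((a + 1) * z - 2 * a) / (2 * z - (a + 1)))
  else pt ((a + 1) / 2).

Definition graph_J (a : C) : correspondence sphere := fun Z W => W = J a Z.

Definition F (a : C) : correspondence sphere :=
  fun Z W => exists2 V, Cov Z V & W = J a V.

Definition fundamental_domain (G : correspondence sphere) (D : set sphere)
    : Prop :=
  [/\ open D, simply_connected R D, jordan_curve R (topological_boundary D),
      D `&` corr_image G D = set0 &
      forall U, open U -> U `&` corr_image G U = set0 -> D `<=` U -> U = D].

(** * The parabolic germ at 1 *)

Definition parabolic_branch (a : C) (f : C -> C) : Prop :=
  [/\ f 1 = 1, is_derive (1 : C) (1 : C) f 1,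
      \forall z \near (1 : C), derivable f z 1 &
      \forall z \near (1 : C), F a (pt z) (pt (f z))].

(* If f(1 + u) = 1 + u + c u^(n+1) + o(u^(n+1)) with c <> 0, the attracting
   (resp. repelling) directions v are those with c v^n < 0 (resp. c v^n > 0);
   for the order on R[i], c v^n < 0 says that c v^n is a negative real. One
   has n = 1 and c = (a - 7) / (3 (a - 1)) unless a = 7. *)
Definition axis_direction (a v : C) : Prop :=
  exists (f : C -> C) (n : nat) (c : C),
    [/\ parabolic_branch a f, (0 < n)%N, c != 0,
        (f (1 + u) - (1 + u)) / u ^+ n.+1 @[u --> (0 : C)^'] --> c &
        c * v ^+ n < 0 \/ 0 < c * v ^+ n].

(* Smooth means having a parametrization that is C^1 and regular at 1. *)
Definition smooth_transverse_at1 (a : C) (B : set sphere) : Prop :=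
  exists (g : R -> sphere) (x y : R -> R) (t0 : R),
    let tau := derive1 x t0 +i* derive1 y t0 in
    [/\ jordan_parametrization g B,
        0 < t0 < 1 /\ g t0 = pt 1,
        \forall t \near t0, [/\ g t = pt (x t +i* y t),
                                derivable x t 1 & derivable y t 1],
        {for t0, continuous (derive1 x)} /\ {for t0, continuous (derive1 y)} &
        tau != 0 /\
        forall v, axis_direction a v -> complex.Im (v / tau) != 0].

(** * Klein combination locus, limit sets, connectedness locus *)

Definition klein_pair (a : C) (DCov DJ : set sphere) : Prop :=
  [/\ fundamental_domain Cov DCov, fundamental_domain (graph_J a) DJ,
      DCov `|` DJ = ~` [set pt 1],
      smooth_transverse_at1 a (topological_boundary DCov) &
      smooth_transverse_at1 a (topological_boundary DJ)].

Definition klein_combination_locus : set C :=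
  [set a | a != 1 /\ exists DCov DJ, klein_pair a DCov DJ].

Definition limit_set_minus (a : C) (DCov : set sphere) : set sphere :=
  \bigcap_n iter n (corr_preimage (F a)) (~` DCov).

Definition limit_set_plus (a : C) (DCov : set sphere) : set sphere :=
  J a @` limit_set_minus a DCov.

Definition limit_set (a : C) (DCov : set sphere) : set sphere :=
  limit_set_minus a DCov `|` limit_set_plus a DCov.

Definition regular_set (a : C) (DCov : set sphere) : set sphere :=
  ~` limit_set a DCov.

Definition connectedness_locus : set C :=
  [set a | klein_combination_locus a /\
     exists DCov DJ, klein_pair a DCov DJ /\
       connected (limit_set_minus a DCov)].

(** * The Boettcher map *)

Definition alpha (z : C) : C := z + 1.
Definition beta (z : C) : C := z / (z + 1).

(* [psi] is the inverse of [phi]; holomorphy of [psi], and non-vanishing of the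
   derivative of [phi], follow from injectivity of [phi]. *)
Definition conformal_homeomorphism (Om : set sphere) (U : set C)
    (phi : sphere -> C) (psi : C -> sphere) : Prop :=
  homeomorphism_between Om U phi psi /\
  (forall Z, Om Z -> holomorphic_at phi Z).

Definition boettcher_map (a : C) (Om : set sphere)
    (phi : sphere -> C) (psi : C -> sphere) : Prop :=
  conformal_homeomorphism Om upper_half_plane phi psi /\
  exists fa fa' fb fb' : sphere -> sphere,
    [/\ homeomorphism_between Om Om fa fa',
        homeomorphism_between Om Om fb fb',
        forall Z W, Om Z -> (F a Z W <-> W = fa Z \/ W = fb Z),
        forall Z, Om Z -> phi (fa Z) = alpha (phi Z) &
        forall Z, Om Z -> phi (fb Z) = beta (phi Z)].

End sphere.

(* Main.v *)
Require Import Defs.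
From mathcomp Require Import all_boot all_order all_algebra.
From mathcomp Require Import all_classical all_reals all_analysis.
From mathcomp Require Import complex ring lra.

Set Implicit Arguments.
Unset Strict Implicit.
Unset Printing Implicit Defensive.

Import Order.TTheory GRing.Theory Num.Theory.
Import numFieldNormedType.Exports.

Local Open Scope classical_set_scope.
Local Open Scope ring_scope.
Local Open Scope complex_scope.

(** Towards each end of the geodesic, one of the two branches of the
    correspondence moves its points by a hyperbolic distance that tends to 0:
    [alpha] moves [it] by about [1/t], and [beta] is [alpha^-1] conjugated by
    [z |-> -1/z]. Suppose that [psi (it)] does not tend to 1 as [t --> +oo]. It
    then has a cluster point [P] other than 1, and [P] is not in the regular set,
    since [phi] is continuous there.

    In the coordinate [coord Z = 1 / (Z - 1)], let [x] be the coordinate of [P].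
    The function [u = coord \o psi - x] is holomorphic, injective and without
    zeros on the upper half-plane. For such a function [|u' / u| <= C / Im z]
    ([log_deriv_bound]): a branch of [log u] takes no two values that differ by
    [2 i pi], while by Bloch's theorem its image would contain large disks if its
    derivative were large. Hence [u (it + 1) / u (it)] tends to 1
    ([ratio_bound]). Thus along a sequence tending to [P] the correspondence
    relates points whose displacements from [P] have a ratio tending to 1, as for
    a branch of multiplier 1 in the snail lemma: [P] is a double root of the
    equation of fixed points of [F a] ([double_fixed_point]). The fixed points of
    [F a] other than 1 form a pair exchanged by [J a], and they are simple unless
    they coincide with the fixed point [a] of [J a]. But the latter is not in
    [DJ], so it lies in [DCov] and is in the regular set, a contradiction
    ([landing]). The other end of the geodesic is treated with [psi (-1/z)].

    The function theory is built from first principles: Goursat's theorem for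
    rectangles ([goursat], [goursat_punctured]), Cauchy's formula on squares
    ([cauchy_formula]), and from it Cauchy's estimate, removable singularities,
    the isolation of zeros and the holomorphy of [psi] ([holo_inverse]). *)

Local Notation Re := complex.Re.
Local Notation Im := complex.Im.

(** * Modulus, continuity and differentiation *)

(** The norm of [R[i]] takes its values in [R[i]]; estimates are carried out
    with this real-valued modulus, in terms of which continuity and complex
    differentiability are stated below. *)
Definition cabs (R : realType) (z : R[i]) : R := Normc.normc z.

Section disks.
Variable R : realType.
Local Notation C := R[i].
Implicit Types (z w l : C) (f g : C -> C).

Lemma lt_both (d d' : R) : 0 < d -> 0 < d' ->
  exists2 k, 0 < k & (k < d) && (k < d').
Proof.
move=> d0 d'0; exists (Num.min d d' / 2); first by rewrite divr_gt0// lt_min d0 d'0.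
by case: (leP d d') => h; apply/andP; split; lra.
Qed.

Lemma cabs_ge0 z : 0 <= cabs z.
Proof. by rewrite /cabs /Normc.normc; case: z => x y; exact: sqrtr_ge0. Qed.

Lemma cabs0 : cabs (0 : C) = 0.
Proof. exact: Normc.normc0. Qed.

Lemma cabs1 : cabs (1 : C) = 1.
Proof. exact: Normc.normc1. Qed.

Lemma cabsM z w : cabs (z * w) = cabs z * cabs w.
Proof. exact: Normc.normcM. Qed.

Lemma cabsV z : cabs z^-1 = (cabs z)^-1.
Proof. exact: Normc.normcV. Qed.

Lemma cabsD z w : cabs (z + w) <= cabs z + cabs w.
Proof. exact: le_normcD. Qed.

Lemma cabsN z : cabs (- z) = cabs z.
Proof. exact: normcN. Qed.

Lemma cabs_eq0 z : (cabs z == 0) = (z == 0).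
Proof. by apply/eqP/eqP => [/Normc.eq0_normc|->]; [|exact: cabs0]. Qed.

Lemma cabs_gt0 z : (0 < cabs z) = (z != 0).
Proof. by rewrite lt0r cabs_ge0 andbT cabs_eq0. Qed.

Lemma cabsC z w : cabs (z - w) = cabs (w - z).
Proof. by rewrite -cabsN opprB. Qed.

Lemma cabs_sqr z : cabs z ^+ 2 = Re z ^+ 2 + Im z ^+ 2.
Proof. by case: z => x y /=; rewrite sqr_sqrtr // addr_ge0 ?sqr_ge0. Qed.

Lemma cabs_Re z : `|Re z| <= cabs z.
Proof.
rewrite -(ler_pXn2r (n := 2)) ?nnegrE ?cabs_ge0// cabs_sqr -normrX ger0_norm ?sqr_ge0//.
by rewrite lerDl sqr_ge0.
Qed.

Lemma cabs_Im z : `|Im z| <= cabs z.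
Proof.
rewrite -(ler_pXn2r (n := 2)) ?nnegrE ?cabs_ge0// cabs_sqr -normrX ger0_norm ?sqr_ge0//.
by rewrite lerDr sqr_ge0.
Qed.

Lemma cabs_ReIm z : cabs z <= `|Re z| + `|Im z|.
Proof.
have h : 0 <= `|Re z| + `|Im z| by rewrite addr_ge0.
rewrite -(ler_pXn2r (n := 2)) ?nnegrE ?cabs_ge0// cabs_sqr -(real_normK (num_real (Re z))).
rewrite -(real_normK (num_real (Im z))) sqrrD lerD2r lerDl.
by rewrite mulrn_wge0// mulr_ge0.
Qed.

Lemma cabs_real (x : R) : cabs x%:C = `|x|.
Proof. by rewrite /cabs /= expr0n /= addr0 sqrtr_sqr. Qed.

Lemma cabs_i : cabs ('i%C : C) = 1.
Proof. by rewrite /cabs /= expr0n expr1n add0r sqrtr1. Qed.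

Lemma cabs_le_sub z w : cabs z <= cabs w + cabs (z - w).
Proof. by rewrite -{1}(subrK w z) addrC cabsD. Qed.

Lemma cabsX z n : cabs (z ^+ n) = cabs z ^+ n.
Proof. by elim: n => [|n IH]; rewrite ?expr0 ?cabs1// !exprS cabsM IH. Qed.

Lemma normr_cabs z : `|z| = (cabs z)%:C.
Proof. by case: z. Qed.

Lemma pos_complexP (e : C) : 0 < e <-> exists2 d : R, 0 < d & e = d%:C.
Proof.
split=> [|[d d0 ->]]; last by rewrite ltcR.
by case: e => x y; rewrite ltcE /= => /andP[/eqP -> x0]; exists x.
Qed.

Definition cont f z := forall e : R, 0 < e ->
  exists2 d : R, 0 < d & forall w, cabs (w - z) < d -> cabs (f w - f z) < e.

Definition deriv_at f z l := forall e : R, 0 < e ->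
  exists2 d : R, 0 < d &
    forall w, cabs (w - z) < d ->
      cabs (f w - f z - (w - z) * l) <= e * cabs (w - z).

Definition holo f z := exists l, deriv_at f z l.

Lemma cont_le f z : cont f z <-> forall e : R, 0 < e ->
  exists2 d : R, 0 < d & forall w, cabs (w - z) < d -> cabs (f w - f z) <= e.
Proof.
split=> H e e0.
  by have [d d0 h] := H e e0; exists d => // w /h/ltW.
have [d d0 h] := H (e / 2) ltac:(lra); exists d => // w /h ?; lra.
Qed.

Lemma cont_local f g z (r : R) : 0 < r ->
  (forall w, cabs (w - z) < r -> f w = g w) -> cont f z -> cont g z.
Proof.
move=> r0 fg cf e e0; have [d d0 h] := cf e e0.
exists (Num.min d r) => [|w]; first by rewrite lt_min d0 r0.
rewrite lt_min => /andP[wd wr]; rewrite -!fg//; first exact: h.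
by rewrite subrr cabs0.
Qed.

Lemma cont_cst l z : cont (fun=> l) z.
Proof. by move=> e e0; exists 1 => // w _; rewrite subrr cabs0. Qed.

Lemma cont_id z : cont id z.
Proof. by move=> e e0; exists e. Qed.

Lemma cont_add f g z : cont f z -> cont g z -> cont (fun w => f w + g w) z.
Proof.
move=> cf cg e e0; have [d d0 h] := cf (e / 2) ltac:(lra).
have [d' d'0 h'] := cg (e / 2) ltac:(lra).
exists (Num.min d d') => [|w]; first by rewrite lt_min d0 d'0.
rewrite lt_min => /andP[/h A /h' B].
have := cabsD (f w - f z) (g w - g z).
by rewrite (_ : _ + _ = f w + g w - (f z + g z)); [lra|ring].
Qed.

Lemma cont_bounded f z : cont f z ->
  exists2 d : R, 0 < d & forall w, cabs (w - z) < d -> cabs (f w) < cabs (f z) + 1.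
Proof.
move=> cf; have [d d0 h] := cf 1 ltr01; exists d => // w /h A.
have := cabs_le_sub (f w) (f z); lra.
Qed.

Lemma cont_mul f g z : cont f z -> cont g z -> cont (fun w => f w * g w) z.
Proof.
move=> cf cg; have [b b0 hb] := cont_bounded cf; move=> e e0.
have A0 := cabs_ge0 (f z); have B0 := cabs_ge0 (g z).
set K := cabs (f z) + cabs (g z) + 1; have K0 : 0 < K by rewrite /K; lra.
have e2 : 0 < e / 2 / K by rewrite !divr_gt0.
have [d d0 h] := cf _ e2; have [d' d'0 h'] := cg _ e2.
exists (Num.min b (Num.min d d')) => [|w]; first by rewrite !lt_min b0 d0 d'0.
rewrite !lt_min => /and3P[/hb P /h A /h' B].
have -> : f w * g w - f z * g z = f w * (g w - g z) + (f w - f z) * g z by ring.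
apply: le_lt_trans (cabsD _ _) _; rewrite !cabsM.
have C1 := cabs_ge0 (f w); have D1 := cabs_ge0 (g w - g z); have E1 := cabs_ge0 (f w - f z).
have : cabs (f w) * cabs (g w - g z) <= (cabs (f z) + 1) * (e / 2 / K).
  by apply: ler_pM => //; exact: ltW.
have : cabs (f w - f z) * cabs (g z) <= (e / 2 / K) * cabs (g z).
  by apply: ler_wpM2r => //; exact: ltW.
have : (e / 2 / K) * K = e / 2 by field; exact: lt0r_neq0.
rewrite {2}/K !(mulrDl, mulrDr) => *; lra.
Qed.

Lemma cont_neq0 f z : cont f z -> f z != 0 ->
  exists2 d : R, 0 < d & forall w, cabs (w - z) < d -> cabs (f z) / 2 < cabs (f w).
Proof.
move=> cf; rewrite -cabs_gt0 => f0; have [d d0 h] := cf (cabs (f z) / 2) ltac:(lra).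
exists d => // w /h; rewrite cabsC; have := cabs_le_sub (f z) (f w); lra.
Qed.

Lemma cont_inv f z : cont f z -> f z != 0 -> cont (fun w => (f w)^-1) z.
Proof.
move=> cf f0; have [b b0 hb] := cont_neq0 cf f0; move: (f0); rewrite -cabs_gt0 => F0.
move=> e e0; have e2 : 0 < e * (cabs (f z) / 2) * cabs (f z) by rewrite !mulr_gt0.
have [d d0 h] := cf _ e2.
exists (Num.min b d) => [|w]; first by rewrite !lt_min b0 d0.
rewrite !lt_min => /andP[/hb P /h A].
have W0 : 0 < cabs (f w) by lra.
have fw0 : f w != 0 by rewrite -cabs_gt0.
have -> : (f w)^-1 - (f z)^-1 = (f z - f w) / (f w * f z) by field; rewrite fw0 f0.
rewrite cabsM cabsV cabsM ltr_pdivrMr ?mulr_gt0// cabsC mulrA.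
apply: lt_le_trans A _; rewrite ler_pM2r// ler_pM2l//; lra.
Qed.

Lemma cont_comp f g z : cont f z -> cont g (f z) -> cont (fun w => g (f w)) z.
Proof. by move=> cf cg e /cg[d /cf[d' d'0 h] h']; exists d' => // w /h /h'. Qed.

(** Caratheodory's form of differentiability: the rules of calculus become
    algebraic identities between slope functions. *)
Lemma deriv_atP f z l :
  deriv_at f z l <-> exists2 g, cont g z /\ g z = l & forall w, f w = f z + (w - z) * g w.
Proof.
split=> [H|[g [cg <-] h] e e0]; last first.
  have [d d0 hd] := cg e e0; exists d => // w /hd wd; rewrite h.
  rewrite (_ : _ - _ = (w - z) * (g w - g z)); last by ring.
  by rewrite cabsM mulrC ler_wpM2r ?cabs_ge0// ltW.
exists (fun w => if w == z then l else (f w - f z) / (w - z)); last first.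
  move=> w; case: eqVneq => [->|wz]; first by rewrite subrr mul0r addr0.
  by field; rewrite subr_eq0.
rewrite eqxx; split => //; apply/cont_le => e e0; have [d d0 h] := H e e0; exists d => // w /h A.
rewrite eqxx; case: eqVneq A => [-> _|wz A]; first by rewrite subrr cabs0 ltW.
have wz0 : w - z != 0 by rewrite subr_eq0.
rewrite -(ler_pM2r (x := cabs (w - z))) ?cabs_gt0// -cabsM.
by rewrite (_ : _ * _ = f w - f z - (w - z) * l)//; field.
Qed.

Lemma deriv_at_cont f z l : deriv_at f z l -> cont f z.
Proof.
case/deriv_atP => g [cg _] h.
suff: cont (fun w => f z + (w - z) * g w) z.
  by apply: (@cont_local _ _ z 1).
apply: cont_add; first exact: cont_cst.
by apply: cont_mul => //; apply: cont_add; [exact: cont_id|exact: cont_cst].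
Qed.

Lemma holo_cont f z : holo f z -> cont f z.
Proof. by case=> l; exact: deriv_at_cont. Qed.

Lemma deriv_at_local f g z l (r : R) : 0 < r ->
  (forall w, cabs (w - z) < r -> f w = g w) -> deriv_at f z l -> deriv_at g z l.
Proof.
move=> r0 fg cf e e0; have [d d0 h] := cf e e0.
exists (Num.min d r) => [|w]; first by rewrite lt_min d0 r0.
rewrite lt_min => /andP[wd wr]; rewrite -!fg//; first exact: h.
by rewrite subrr cabs0.
Qed.

Lemma holo_local f g z (r : R) : 0 < r ->
  (forall w, cabs (w - z) < r -> f w = g w) -> holo f z -> holo g z.
Proof. by move=> r0 fg [l h]; exists l; exact: (deriv_at_local r0 fg h). Qed.

Lemma deriv_at_cst l z : deriv_at (fun=> l) z 0.
Proof.
apply/deriv_atP; exists (fun=> 0); last by move=> w; ring.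
by split => //; exact: cont_cst.
Qed.

Lemma deriv_at_id z : deriv_at id z 1.
Proof.
apply/deriv_atP; exists (fun=> 1); last by move=> w; rewrite mulr1 addrC subrK.
by split => //; exact: cont_cst.
Qed.

Lemma deriv_at_add f g z l m : deriv_at f z l -> deriv_at g z m ->
  deriv_at (fun w => f w + g w) z (l + m).
Proof.
case/deriv_atP => a [ca <-] ha /deriv_atP[b [cb <-] hb]; apply/deriv_atP.
exists (fun w => a w + b w); first by split => //; exact: cont_add.
by move=> w; rewrite ha hb; ring.
Qed.

Lemma deriv_at_mul f g z l m : deriv_at f z l -> deriv_at g z m ->
  deriv_at (fun w => f w * g w) z (l * g z + f z * m).
Proof.
move=> df dg; have cg := deriv_at_cont dg; move: df dg.
case/deriv_atP => a [ca <-] ha /deriv_atP[b [cb <-] hb]; apply/deriv_atP.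
exists (fun w => a w * g w + f z * b w).
  by split => //; apply: cont_add; apply: cont_mul => //; exact: cont_cst.
by move=> w; rewrite ha hb; ring.
Qed.

Lemma deriv_at_inv f z l : deriv_at f z l -> f z != 0 ->
  deriv_at (fun w => (f w)^-1) z (- l / f z ^+ 2).
Proof.
move=> df f0; have cf := deriv_at_cont df.
have [d d0 hd] := cont_neq0 cf f0; move: df.
case/deriv_atP => a [ca <-] ha.
apply: (@deriv_at_local (fun w => (f z)^-1 + (w - z) * (- a w / (f z * f w)))
  _ _ _ d d0) => [w /hd w0|].
  have fw0 : f w != 0 by rewrite -cabs_gt0; have := cabs_ge0 (f z); lra.
  have -> : (f z)^-1 + (w - z) * (- a w / (f z * f w)) =
    (f w - (w - z) * a w) / (f z * f w) by field; rewrite f0 fw0.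
  by rewrite {1}ha addrK; field; rewrite f0 fw0.
apply/deriv_atP; exists (fun w => - a w / (f z * f w)); last first.
  by move=> w; rewrite subrr mul0r addr0.
split; last by rewrite expr2.
apply: cont_mul.
  apply: (@cont_local (fun w => -1 * a w) _ z 1) => // [w _|]; first by rewrite mulN1r.
  by apply: cont_mul => //; exact: cont_cst.
apply: (cont_inv (f := fun w => f z * f w)); last by rewrite mulf_neq0.
by apply: cont_mul => //; exact: cont_cst.
Qed.

Lemma deriv_at_comp f g z l m : deriv_at f z l -> deriv_at g (f z) m ->
  deriv_at (fun w => g (f w)) z (l * m).
Proof.
move=> df dg; have cf := deriv_at_cont df; move: df dg.
case/deriv_atP => a [ca <-] ha /deriv_atP[b [cb <-] hb]; apply/deriv_atP.
exists (fun w => a w * b (f w)).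
  by split => //; apply: cont_mul => //; exact: cont_comp.
move=> w; rewrite hb (_ : f w - f z = (w - z) * a w); first by ring.
by rewrite ha; ring.
Qed.

Lemma holo_cst l z : holo (fun=> l) z.
Proof. by exists 0; exact: deriv_at_cst. Qed.

Lemma holo_id z : holo id z.
Proof. by exists 1; exact: deriv_at_id. Qed.

Lemma holo_add f g z : holo f z -> holo g z -> holo (fun w => f w + g w) z.
Proof. by move=> [l hl] [m hm]; exists (l + m); exact: deriv_at_add. Qed.

Lemma holo_mul f g z : holo f z -> holo g z -> holo (fun w => f w * g w) z.
Proof. by move=> [l hl] [m hm]; eexists; exact: (deriv_at_mul hl hm). Qed.

Lemma holo_inv f z : holo f z -> f z != 0 -> holo (fun w => (f w)^-1) z.
Proof. by move=> [l hl] f0; eexists; exact: (deriv_at_inv hl f0). Qed.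

Lemma holo_comp f g z : holo f z -> holo g (f z) -> holo (fun w => g (f w)) z.
Proof. by move=> [l hl] [m hm]; eexists; exact: (deriv_at_comp hl hm). Qed.

Lemma deriv_at_uniq f z l m : deriv_at f z l -> deriv_at f z m -> l = m.
Proof.
move=> dl dm; apply/eqP; rewrite -subr_eq0; apply/negPn/negP; rewrite -cabs_gt0 => h.
have [d d0 hd] := dl (cabs (l - m) / 3) ltac:(lra).
have [d' d'0 hd'] := dm (cabs (l - m) / 3) ltac:(lra).
have [k k0 /andP[kd kd']] := lt_both d0 d'0.
have kk : cabs (z + k%:C - z) = k by rewrite addrC addKr cabs_real gtr0_norm.
have := hd (z + k%:C); have := hd' (z + k%:C); rewrite kk => /(_ kd') A /(_ kd) B.
have := cabsD (f (z + k%:C) - f z - (z + k%:C - z) * m) (- (f (z + k%:C) - f z - (z + k%:C - z) * l)).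
rewrite cabsN (_ : _ - _ = k%:C * (l - m)); last by ring.
rewrite cabsM cabs_real gtr0_norm// => E.
have : k * cabs (l - m) <= k * (2 / 3 * cabs (l - m)) by nra.
rewrite ler_pM2l//; lra.
Qed.

End disks.

(** * Curves in the plane *)

Section curves.
Variable R : realType.
Local Notation C := R[i].
Implicit Types (f g : C -> C) (w : R -> C) (t : R) (z p : C).

Lemma is_derive_eps (F : R -> R) t (l : R) :
  (forall e : R, 0 < e -> exists2 d : R, 0 < d &
     forall h, `|h| < d -> `|F (t + h) - F t - h * l| <= e * `|h|) ->
  is_derive t (1 : R) F l.
Proof.
move=> H.
have cv : h^-1 *: (F (h *: (1 : R) + t) - F t) @[h --> (0 : R)^'] --> l.
  apply/cvgrPdist_le => e e0; have [d d0 hd] := H e e0.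
  near=> h; have h0 : h != 0 by near: h; exact: nbhs_dnbhs_neq.
  have hd' : `|h| < d by near: h; exact: dnbhs0_lt.
  have := hd h hd'; rewrite -ler_pdivrMr ?normr_gt0// -normfV -normrM distrC.
  congr (`|_| <= _); rewrite [h *: _]mulr1 (addrC t) [_ *: _]mulrC; field => //.
by apply: DeriveDef; [exact: cvgP cv|apply: cvg_lim].
Unshelve. all: by end_near. Qed.

Definition curve_deriv w t (l : C) : Prop :=
  is_derive t (1 : R) (fun s => Re (w s)) (Re l) /\
  is_derive t (1 : R) (fun s => Im (w s)) (Im l).

Lemma curve_deriv_line f (c d l : C) t : deriv_at f (c + t%:C * d) l ->
  curve_deriv (fun s => f (c + s%:C * d)) t (l * d).
Proof.
move=> df.
have H (e : R) : 0 < e -> exists2 r : R, 0 < r & forall h : R, `|h| < r ->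
    cabs (f (c + (t + h)%:C * d) - f (c + t%:C * d) - h%:C * (l * d)) <= e * `|h|.
  move=> e0; have D0 := cabs_ge0 d; have K0 : 0 < 1 + cabs d by lra.
  have [r r0 hr] := df (e / (1 + cabs d)) (divr_gt0 e0 K0).
  exists (r / (1 + cabs d)) => [|h]; first exact: divr_gt0.
  rewrite ltr_pdivlMr// => hh; have h0 := normr_ge0 h.
  have := hr (c + (t + h)%:C * d).
  have -> : c + (t + h)%:C * d - (c + t%:C * d) = h%:C * d.
    by rewrite rmorphD /=; ring.
  rewrite cabsM cabs_real -mulrA (mulrC d) => /(_ _)/le_trans; apply; first nra.
  have -> : e / (1 + cabs d) * (`|h| * cabs d) = e * `|h| * (cabs d / (1 + cabs d)).
    by field; exact: lt0r_neq0.
  rewrite ler_piMr ?mulr_ge0 ?(ltW e0)// ler_pdivrMr//; lra.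
have re (x y z : C) (h : R) : Re (x - y - h%:C * z) = Re x - Re y - h * Re z.
  by case: x y z => ? ? [? ?] [? ?] /=; rewrite mul0r subr0.
have im (x y z : C) (h : R) : Im (x - y - h%:C * z) = Im x - Im y - h * Im z.
  by case: x y z => ? ? [? ?] [? ?] /=; rewrite mul0r addr0.
split; apply: is_derive_eps => e e0; have [r r0 hr] := H e e0; exists r => // h hh.
  by rewrite -re; apply: le_trans (hr h hh); exact: cabs_Re.
by rewrite -im; apply: le_trans (hr h hh); exact: cabs_Im.
Qed.

Lemma curve_deriv_cont w t l : curve_deriv w t l ->
  {for t, continuous (fun s => cabs (w s))}.
Proof.
move=> [dr di].
have -> : (fun s => cabs (w s)) =
  (fun s => Num.sqrt (Re (w s) * Re (w s) + Im (w s) * Im (w s))).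
  by apply/funext => s; rewrite /cabs; case: (w s) => a b /=; rewrite !expr2.
have cr : {for t, continuous (fun s => Re (w s))}.
  by apply: differentiable_continuous; apply/derivable1_diffP; case: dr.
have ci : {for t, continuous (fun s => Im (w s))}.
  by apply: differentiable_continuous; apply/derivable1_diffP; case: di.
apply: (continuous_comp (f := fun s => Re (w s) * Re (w s) + Im (w s) * Im (w s))).
  by apply: cvgD; apply: cvgM.
exact: sqrt_continuous.
Qed.

(** The real mean value theorem, applied to the component of [w] in the direction
    of [w b - w a]. *)
Lemma mean_value w (l : R -> C) a b K : a <= b ->
  (forall t, a <= t <= b -> curve_deriv w t (l t)) ->
  (forall t, a <= t <= b -> cabs (l t) <= K) ->
  cabs (w b - w a) <= K * (b - a).
Proof.
rewrite le_eqVlt => /orP[/eqP <- _ _|ab dw lK].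
  by rewrite !subrr cabs0 mulr0.
set d := w b - w a.
have [->|d0] := eqVneq d 0.
  rewrite cabs0 mulr_ge0 ?subr_ge0 ?(ltW ab)//.
  by apply: le_trans (cabs_ge0 (l a)) _; apply: lK; rewrite lexx ltW.
set g := fun t => Re d * Re (w t) + Im d * Im (w t).
have dg t : a <= t <= b -> is_derive t (1 : R) g (Re d * Re (l t) + Im d * Im (l t)).
  by move=> /dw[dr di]; apply: is_deriveD.
have [t|t|c /[!in_itv]/= cab] := @MVT R g (fun t => Re d * Re (l t) + Im d * Im (l t)) a b ab.
- by rewrite in_itv /= => /andP[at' tb]; apply: dg; rewrite !ltW.
- apply: derivable_within_continuous => x; rewrite in_itv /= => xab; case: (dg x xab) => //.
have {}cab : a <= c <= b by case/andP: cab => ? ?; rewrite !ltW.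
have -> : g b - g a = cabs d ^+ 2.
  by rewrite cabs_sqr /g /d; case: (w a) (w b) => x1 y1 [x2 y2] /=; ring.
have ld : Re d * Re (l c) + Im d * Im (l c) <= cabs d * K.
  have := lK c cab; rewrite -(ler_pM2l (x := cabs d)) ?cabs_gt0// => /(le_trans _); apply.
  rewrite -cabsM -[leRHS]ger0_norm ?cabs_ge0//.
  have /(le_trans _) : `|Re ((Re d -i* Im d) * l c)| <= cabs ((Re d -i* Im d) * l c) by exact: cabs_Re.
  have -> : cabs ((Re d -i* Im d) * l c) = cabs (d * l c).
    by rewrite !cabsM; congr (_ * _); rewrite /cabs; case: (d) => x y /=; rewrite sqrrN.
  rewrite ger0_norm ?cabs_ge0//; apply; case: (d) (l c) => x y [x' y'] /=.
  by rewrite mulNr opprK ler_norm.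
move=> E; rewrite -(ler_pM2l (x := cabs d)) ?cabs_gt0// -expr2 E mulrA ler_wpM2r// subr_ge0; exact: ltW.
Qed.

Lemma mean_value_segment f (l : R -> C) p z K :
  (forall t, 0 <= t <= 1 -> deriv_at f (p + t%:C * (z - p)) (l t)) ->
  (forall t, 0 <= t <= 1 -> cabs (l t) <= K) ->
  cabs (f z - f p) <= K * cabs (z - p).
Proof.
move=> df lK; pose w t := f (p + t%:C * (z - p)).
have -> : f z = w 1 by rewrite /w rmorph1 mul1r addrC subrK.
have -> : f p = w 0 by rewrite /w rmorph0 mul0r addr0.
rewrite -[leRHS]mulr1 -[X in _ * X](subr0 1).
apply: (mean_value (l := fun t => l t * (z - p)) ler01) => t ht.
  by apply: curve_deriv_line; exact: df.
by rewrite cabsM ler_wpM2r ?cabs_ge0// lK.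
Qed.

Lemma in_disk_segment p z (r : R) t : 0 <= t <= 1 -> cabs (z - p) < r ->
  cabs (p + t%:C * (z - p) - p) < r.
Proof.
move=> /andP[t0 t1]; rewrite addrAC subrr add0r cabsM cabs_real ger0_norm//.
by apply: le_lt_trans; rewrite ler_piMl// cabs_ge0.
Qed.

Lemma deriv0_const f p (r : R) : (forall w : C, cabs (w - p) < r -> deriv_at f w 0) ->
  forall z, cabs (z - p) < r -> f z = f p.
Proof.
move=> df z hz; apply/eqP; rewrite -subr_eq0 -cabs_eq0 eq_le cabs_ge0 andbT.
rewrite -(mul0r (cabs (z - p))); apply: (mean_value_segment (l := fun=> 0)) => t ht.
  by apply: df; exact: in_disk_segment.
by rewrite cabs0.
Qed.

(** A crude form of Gronwall's inequality: if [A] is the maximum of [|w|], the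
    mean value inequality gives [|w t - w 0| <= k A], hence [A <= 2 |w 0|]. *)
Lemma gronwall w (l : R -> C) (k : R) : 0 <= k <= 1 / 2 ->
  (forall t, 0 <= t <= 1 -> curve_deriv w t (l t)) ->
  (forall t, 0 <= t <= 1 -> cabs (l t) <= k * cabs (w t)) ->
  forall t, 0 <= t <= 1 -> cabs (w t - w 0) <= 2 * k * cabs (w 0).
Proof.
move=> /andP[k0 k1] dw lk.
have [c /[!in_itv]/= cab maxc] : exists2 c : R, c \in `[0, 1] &
    forall t, t \in `[0, 1] -> cabs (w t) <= cabs (w c).
  apply: (@EVT_max R (fun t => cabs (w t)) 0 1 ler01).
  apply: continuous_in_subspaceT => t; rewrite inE /= in_itv /= => /dw.
  exact: curve_deriv_cont.
have H t : 0 <= t <= 1 -> cabs (w t - w 0) <= k * cabs (w c).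
  move=> /andP[t0 t1].
  have /le_trans -> // : cabs (w t - w 0) <= k * cabs (w c) * (t - 0).
    apply: (mean_value t0) => s /andP[s0 st]; first by apply: dw; rewrite s0 (le_trans st).
    have s1 : 0 <= s <= 1 by rewrite s0 (le_trans st).
    apply: le_trans (lk _ s1) _; rewrite ler_wpM2l// maxc// in_itv.
  by rewrite subr0 ler_piMr// mulr_ge0// cabs_ge0.
have Hc := H c cab; have := cabs_le_sub (w c) (w 0).
have C0 := cabs_ge0 (w c); have W0 := cabs_ge0 (w 0).
have kc : k * cabs (w c) <= 1 / 2 * cabs (w c) by rewrite ler_wpM2r.
move=> E t /H /le_trans; apply; rewrite mulrC mulrAC ler_wpM2r//; lra.
Qed.

End curves.

(** * Integrals along intervals *)

Section integrals.
Variable R : realType.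
Local Notation C := R[i].
Implicit Types (g h : R -> R) (v w : R -> C) (a b c : R).

Definition rcont g a b := forall x, a <= x <= b -> {for x, continuous g}.

Definition rint g a b : R := \int[lebesgue_measure]_(x in `[a, b]) g x.

Lemma rcont_integrable g a b : rcont g a b ->
  lebesgue_measure.-integrable `[a, b] (EFin \o g).
Proof.
move=> cg; apply: continuous_compact_integrable; first exact: segment_compact.
by apply: continuous_in_subspaceT => x; rewrite inE /= in_itv /=; exact: cg.
Qed.

Lemma rint_add g h a b : rcont g a b -> rcont h a b ->
  rint (fun x => g x + h x) a b = rint g a b + rint h a b.
Proof. by move=> cg ch; rewrite /rint RintegralD//; exact: rcont_integrable. Qed.

Lemma rint_scale k g a b : rcont g a b -> rint (fun x => k * g x) a b = k * rint g a b.
Proof. by move=> cg; rewrite /rint RintegralZl//; exact: rcont_integrable. Qed.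

Lemma rint_ext g h a b : (forall x, a <= x <= b -> g x = h x) -> rint g a b = rint h a b.
Proof. by move=> gh; apply: eq_Rintegral => x; rewrite inE /= in_itv /=; exact: gh. Qed.

Lemma rint_cst (k a b : R) : a <= b -> rint (fun=> k) a b = k * (b - a).
Proof.
move=> ab; rewrite /rint Rintegral_cst//= lebesgue_measure_itv/= lte_fin.
by case: ltP => // ba; rewrite (le_anti (introT andP (conj ab ba))) subrr.
Qed.

Lemma rint_cat g a b c : a <= b -> b <= c -> rcont g a c ->
  rint g a c = rint g a b + rint g b c.
Proof.
move=> ab bc /rcont_integrable ig; rewrite /rint.
have := Rintegral_itvB ig; move=> /(_ b); rewrite !bnd_simp => /(_ ab bc).
rewrite Rintegral_itv_obnd_cbnd; first by move=> <-; rewrite addrC subrK.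
apply: integrableS ig => //; apply: subset_itv; rewrite !bnd_simp//.
Qed.

Lemma rint_le g (M : R) a b : a <= b -> rcont g a b ->
  (forall x, a <= x <= b -> g x <= M) -> rint g a b <= M * (b - a).
Proof.
move=> ab cg gM; rewrite -rint_cst//; apply: le_Rintegral => //.
  exact: rcont_integrable.
by apply: rcont_integrable => x _; exact: cvg_cst.
Qed.

Lemma rcont_opp g a b : rcont g a b -> rcont (fun x => -1 * g x) a b.
Proof. by move=> cg x /cg cx; apply: cvgM => //; exact: cvg_cst. Qed.

Lemma rint_abs g (M : R) a b : a <= b -> rcont g a b ->
  (forall x, a <= x <= b -> `|g x| <= M) -> `|rint g a b| <= M * (b - a).
Proof.
move=> ab cg gM; rewrite ler_norml -mulNr; apply/andP; split.
  rewrite mulNr lerNl -mulN1r -rint_scale//; apply: rint_le => //; first exact: rcont_opp.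
  by move=> x /gM; rewrite ler_norml mulN1r => /andP[]; rewrite lerNl.
by apply: rint_le => // x /gM; rewrite ler_norml => /andP[].
Qed.

Lemma rint_FTC (G : R -> R) g a b : a <= b -> rcont g a b ->
  (forall x, a <= x <= b -> is_derive x (1 : R) G (g x)) -> rint g a b = G b - G a.
Proof.
rewrite le_eqVlt => /orP[/eqP <- cg dG|ab cg dG].
  by rewrite subrr /rint set_itv1 Rintegral_set1.
have cG : rcont G a b.
  move=> x /dG[dx _]; apply: differentiable_continuous; exact/derivable1_diffP.
rewrite /rint /Rintegral (@continuous_FTC2 R g G a b ab) //.
- by apply: continuous_in_subspaceT => x; rewrite inE /= in_itv /=; exact: cg.
- split.
  + by move=> x; rewrite in_itv /= => /andP[? ?]; have [] := dG x ltac:(by rewrite !ltW).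
  + by apply: cvg_at_right_filter; apply: cG; rewrite lexx ltW.
  + by apply: cvg_at_left_filter; apply: cG; rewrite lexx ltW.
- move=> x; rewrite in_itv /= => /andP[? ?]; rewrite derive1E.
  by have [] := dG x ltac:(by rewrite !ltW).
Qed.

Definition curve_cont w a b :=
  rcont (fun t => Re (w t)) a b /\ rcont (fun t => Im (w t)) a b.

Definition cint w a b : C :=
  rint (fun t => Re (w t)) a b +i* rint (fun t => Im (w t)) a b.

Lemma cint_ext v w a b : (forall x, a <= x <= b -> v x = w x) -> cint v a b = cint w a b.
Proof. by move=> vw; congr Complex; apply: rint_ext => x /vw ->. Qed.

Lemma cint_add v w a b : curve_cont v a b -> curve_cont w a b ->
  cint (fun x => v x + w x) a b = cint v a b + cint w a b.
Proof.
move=> [vr vi] [wr wi]; rewrite /cint.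
rewrite (_ : rint _ a b = rint (fun t => Re (v t) + Re (w t)) a b); last first.
  by apply: rint_ext => x _; case: (v x) (w x) => ? ? [].
rewrite (_ : rint (fun t => Im _) a b = rint (fun t => Im (v t) + Im (w t)) a b); last first.
  by apply: rint_ext => x _; case: (v x) (w x) => ? ? [].
by rewrite !rint_add.
Qed.

Lemma cint_scale (k : C) w a b : curve_cont w a b ->
  cint (fun x => k * w x) a b = k * cint w a b.
Proof.
move=> [wr wi]; rewrite /cint; case: k => k l.
rewrite (_ : rint _ a b = rint (fun t => k * Re (w t) + (- l) * Im (w t)) a b); last first.
  by apply: rint_ext => x _; case: (w x) => ? ? /=; rewrite mulNr.
rewrite (_ : rint (fun t => Im _) a b = rint (fun t => k * Im (w t) + l * Re (w t)) a b); last first.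
  by apply: rint_ext => x _; case: (w x) => ? ? /=.
have S (m : R) g : rcont g a b -> rcont (fun t => m * g t) a b.
  by move=> cg x /cg cx; apply: cvgM => //; exact: cvg_cst.
by rewrite !rint_add ?rint_scale//; try exact: S; apply/eqP; rewrite eq_complex /= mulNr !eqxx.
Qed.

Lemma cint_cat w a b c : a <= b -> b <= c -> curve_cont w a c ->
  cint w a c = cint w a b + cint w b c.
Proof.
by move=> ab bc [wr wi]; rewrite /cint (rint_cat ab bc wr) (rint_cat ab bc wi).
Qed.

Lemma cint_bound w (M : R) a b : a <= b -> curve_cont w a b ->
  (forall x, a <= x <= b -> cabs (w x) <= M) -> cabs (cint w a b) <= 2 * M * (b - a).
Proof.
move=> ab [wr wi] wM; apply: le_trans (cabs_ReIm _) _ => /=.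
rewrite -mulrA mulr_natl mulr2n lerD// rint_abs// => x /wM; apply: le_trans.
  exact: cabs_Re.
exact: cabs_Im.
Qed.

Lemma cint_FTC (W : R -> C) w a b : a <= b -> curve_cont w a b ->
  (forall x, a <= x <= b -> curve_deriv W x (w x)) -> cint w a b = W b - W a.
Proof.
move=> ab [wr wi] dW; rewrite /cint.
have hr : forall x, a <= x <= b -> is_derive x (1 : R) (fun s => Re (W s)) (Re (w x)).
  by move=> x /dW[].
have hi : forall x, a <= x <= b -> is_derive x (1 : R) (fun s => Im (W s)) (Im (w x)).
  by move=> x /dW[].
rewrite (rint_FTC ab wr hr) (rint_FTC ab wi hi).
by case: (W a) (W b) => ? ? [].
Qed.

End integrals.

(** * Integrals along boundaries of rectangles *)

Section rectangles.
Variable R : realType.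
Local Notation C := R[i].
Implicit Types (f g : C -> C) (a b c d : R) (z w : C).

Definition rect a b c d : set C := [set z | a <= Re z <= b /\ c <= Im z <= d].

Definition rect_bdry a b c d : set C :=
  [set z | rect a b c d z /\ [\/ Re z = a, Re z = b, Im z = c | Im z = d]].

(** The integral of [f dz], counterclockwise. *)
Definition rectint f a b c d : C :=
  cint (fun x => f (x +i* c)) a b - cint (fun x => f (x +i* d)) a b
  + 'i%C * (cint (fun y => f (b +i* y)) c d - cint (fun y => f (a +i* y)) c d).

Lemma cont_curve f (p : R -> C) t :
  (forall s, cabs (p s - p t) <= `|s - t|) -> cont f (p t) ->
  {for t, continuous (fun s => Re (f (p s)))} /\
  {for t, continuous (fun s => Im (f (p s)))}.
Proof.
move=> pl cf; split; apply/cvgrPdist_lt => e e0; have [r r0 hr] := cf e e0;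
  near=> s; rewrite distrC.
  have /hr : cabs (p s - p t) < r.
    apply: le_lt_trans (pl s) _; rewrite distrC; near: s; exact: cvgr_dist_lt.
  apply: le_lt_trans; apply: le_trans (cabs_Re _).
  by case: (f (p s)) (f (p t)) => ? ? [? ?].
have /hr : cabs (p s - p t) < r.
  apply: le_lt_trans (pl s) _; rewrite distrC; near: s; exact: cvgr_dist_lt.
apply: le_lt_trans; apply: le_trans (cabs_Im _).
by case: (f (p s)) (f (p t)) => ? ? [? ?].
Unshelve. all: by end_near. Qed.

Lemma cont_hor f a b c : (forall x, a <= x <= b -> cont f (x +i* c)) ->
  curve_cont (fun x => f (x +i* c)) a b.
Proof.
move=> cf; have L s t : cabs (s +i* c - t +i* c) <= `|s - t|.
  by rewrite /cabs /= subrr expr0n /= addr0 sqrtr_sqr.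
by split=> x xab; have [] := @cont_curve f (fun x => x +i* c) x (L^~ x) (cf x xab).
Qed.

Lemma cont_ver f a c d : (forall y, c <= y <= d -> cont f (a +i* y)) ->
  curve_cont (fun y => f (a +i* y)) c d.
Proof.
move=> cf; have L s t : cabs (a +i* s - a +i* t) <= `|s - t|.
  by rewrite /cabs /= subrr expr0n /= add0r sqrtr_sqr.
by split=> x xab; have [] := @cont_curve f (fun y => a +i* y) x (L^~ x) (cf x xab).
Qed.

Section fixed_rectangle.
Variables (a b c d : R) (ab : a <= b) (cd : c <= d).
Local Notation bdry := (rect_bdry a b c d).
Local Notation RI := (fun f => rectint f a b c d).

Lemma bdry_hor x : a <= x <= b -> bdry (x +i* c) /\ bdry (x +i* d).
Proof.
by move=> xab; split; split; rewrite /rect /= ?lexx ?cd//;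
  [constructor 3|constructor 4].
Qed.

Lemma bdry_ver y : c <= y <= d -> bdry (a +i* y) /\ bdry (b +i* y).
Proof.
by move=> xab; split; split; rewrite /rect /= ?lexx ?ab//;
  [constructor 1|constructor 2].
Qed.

Lemma bdry_cont f : (forall w, bdry w -> cont f w) ->
  [/\ curve_cont (fun x => f (x +i* c)) a b, curve_cont (fun x => f (x +i* d)) a b,
      curve_cont (fun y => f (a +i* y)) c d & curve_cont (fun y => f (b +i* y)) c d].
Proof.
by move=> cf; split; [apply: cont_hor|apply: cont_hor|apply: cont_ver|apply: cont_ver];
  move=> t ht; apply: cf; case: (bdry_hor ht)|| case: (bdry_ver ht).
Qed.

Lemma rectint_ext f g : (forall w, bdry w -> f w = g w) -> RI f = RI g.
Proof.
move=> fg; rewrite /rectint; congr (_ - _ + _ * (_ - _)); apply: cint_ext => t ht; apply: fg;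
  by case: (bdry_hor ht)|| case: (bdry_ver ht).
Qed.

Lemma rectint_add f g : (forall w, bdry w -> cont f w) -> (forall w, bdry w -> cont g w) ->
  RI (fun w => f w + g w) = RI f + RI g.
Proof.
move=> /bdry_cont[f1 f2 f3 f4] /bdry_cont[g1 g2 g3 g4].
by rewrite /rectint !cint_add//; ring.
Qed.

Lemma rectint_scale k f : (forall w, bdry w -> cont f w) ->
  RI (fun w => k * f w) = k * RI f.
Proof.
move=> /bdry_cont[f1 f2 f3 f4].
by rewrite /rectint !cint_scale//; ring.
Qed.

Lemma rectint_bound f (M : R) : (forall w, bdry w -> cont f w) ->
  (forall w, bdry w -> cabs (f w) <= M) ->
  cabs (RI f) <= 4 * M * ((b - a) + (d - c)).
Proof.
move=> /bdry_cont[f1 f2 f3 f4] fM; rewrite /rectint.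
have h1 : cabs (cint (fun x => f (x +i* c)) a b) <= 2 * M * (b - a).
  by apply: cint_bound => // t /bdry_hor[? ?]; apply: fM.
have h2 : cabs (cint (fun x => f (x +i* d)) a b) <= 2 * M * (b - a).
  by apply: cint_bound => // t /bdry_hor[? ?]; apply: fM.
have h3 : cabs (cint (fun x => f (a +i* x)) c d) <= 2 * M * (d - c).
  by apply: cint_bound => // t /bdry_ver[? ?]; apply: fM.
have h4 : cabs (cint (fun x => f (b +i* x)) c d) <= 2 * M * (d - c).
  by apply: cint_bound => // t /bdry_ver[? ?]; apply: fM.
apply: le_trans (cabsD _ _) _; rewrite cabsM cabs_i mul1r.
have := cabsD (cint (fun x => f (x +i* c)) a b) (- cint (fun x => f (x +i* d)) a b).
have := cabsD (cint (fun x => f (b +i* x)) c d) (- cint (fun x => f (a +i* x)) c d).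
rewrite !cabsN; lra.
Qed.

Lemma rectint_primitive (F : C -> C) f : (forall w, bdry w -> cont f w) ->
  (forall w, bdry w -> deriv_at F w (f w)) -> RI f = 0.
Proof.
move=> cf dF; have [f1 f2 f3 f4] := bdry_cont cf; rewrite /rectint.
have hor y x : deriv_at F (x +i* y) (f (x +i* y)) ->
    curve_deriv (fun s => F (s +i* y)) x (f (x +i* y)).
  have E s : s +i* y = (0 +i* y) + s%:C * 1.
    by apply/eqP; rewrite eq_complex /=; apply/andP; split; apply/eqP; ring.
  move=> dx; have -> : (fun s => F (s +i* y)) = fun s => F ((0 +i* y) + s%:C * 1).
    by apply/funext => s; rewrite E.
  by rewrite -[X in curve_deriv _ _ X]mulr1; apply: curve_deriv_line; rewrite -E.
have ver x y : deriv_at F (x +i* y) (f (x +i* y)) ->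
    curve_deriv (fun s => F (x +i* s)) y ('i%C * f (x +i* y)).
  have E s : x +i* s = (x +i* 0) + s%:C * 'i%C.
    by apply/eqP; rewrite eq_complex /=; apply/andP; split; apply/eqP; ring.
  move=> dx; have -> : (fun s => F (x +i* s)) = fun s => F ((x +i* 0) + s%:C * 'i%C).
    by apply/funext => s; rewrite E.
  by rewrite mulrC; apply: curve_deriv_line; rewrite -E.
have S (k : C) (w : R -> C) (s t : R) : curve_cont w s t -> curve_cont (fun x => k * w x) s t.
  move=> [wr wi]; case: k => k l; split=> x xst; have cr := wr x xst; have ci := wi x xst.
    have -> : (fun t => Re ((k +i* l) * w t)) = fun t => k * Re (w t) - l * Im (w t).
      by apply/funext => u; case: (w u).
    by apply: cvgB; apply: cvgM => //; exact: cvg_cst.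
  have -> : (fun t => Im ((k +i* l) * w t)) = fun t => k * Im (w t) + l * Re (w t).
    by apply/funext => u; case: (w u).
  by apply: cvgD; apply: cvgM => //; exact: cvg_cst.
rewrite (cint_FTC ab f1 (W := fun s => F (s +i* c))); last first.
  by move=> x /bdry_hor[? ?]; apply: hor; apply: dF.
rewrite (cint_FTC ab f2 (W := fun s => F (s +i* d))); last first.
  by move=> x /bdry_hor[? ?]; apply: hor; apply: dF.
rewrite mulrBr -!cint_scale//.
rewrite (cint_FTC cd (S _ _ _ _ f3) (W := fun s => F (a +i* s))); last first.
  by move=> x /bdry_ver[? ?]; apply: ver; apply: dF.
rewrite (cint_FTC cd (S _ _ _ _ f4) (W := fun s => F (b +i* s))); last first.
  by move=> x /bdry_ver[? ?]; apply: ver; apply: dF.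
ring.
Qed.

End fixed_rectangle.

Lemma rectint_cat_x f a m b c d : a <= m -> m <= b -> c <= d ->
  (forall w, rect a b c d w -> cont f w) ->
  rectint f a b c d = rectint f a m c d + rectint f m b c d.
Proof.
move=> am mb cd cf; rewrite /rectint.
rewrite (@cint_cat _ _ a m b am mb); last first.
  by apply: cont_hor => x xab; apply: cf; rewrite /rect /= xab lexx cd.
rewrite (@cint_cat _ (fun x => f (x +i* d)) a m b am mb); last first.
  by apply: cont_hor => x xab; apply: cf; rewrite /rect /= xab lexx cd.
ring.
Qed.

Lemma rectint_cat_y f a b c n d : a <= b -> c <= n -> n <= d ->
  (forall w, rect a b c d w -> cont f w) ->
  rectint f a b c d = rectint f a b c n + rectint f a b n d.
Proof.
move=> ab cn nd cf; rewrite /rectint.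
rewrite (@cint_cat _ (fun y => f (b +i* y)) c n d cn nd); last first.
  by apply: cont_ver => x xab; apply: cf; rewrite /rect /= xab lexx ab.
rewrite (@cint_cat _ (fun y => f (a +i* y)) c n d cn nd); last first.
  by apply: cont_ver => x xab; apply: cf; rewrite /rect /= xab lexx ab.
ring.
Qed.

Lemma sub_rect a b c d a' b' c' d' : a <= a' -> b' <= b -> c <= c' -> d' <= d ->
  rect a' b' c' d' `<=` rect a b c d.
Proof.
move=> ? ? ? ? z [/andP[? ?] /andP[? ?]].
by split; apply/andP; split; apply: le_trans; eassumption.
Qed.

End rectangles.

(** * Goursat's theorem *)

Section goursat.
Variable R : realType.
Local Notation C := R[i].
Implicit Types (f g : C -> C) (a b c d : R) (z w : C).

Lemma le_mid (x y : R) : x <= y -> x <= (x + y) / 2 <= y.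
Proof. by move=> xy; lra. Qed.

Lemma small_dyadic (A r : R) : 0 < r -> exists n : nat, A / 2%:R ^+ n < r.
Proof.
move=> r0; exists (Num.bound `|A / r|).
have h : A / r < 2%:R ^+ Num.bound `|A / r|.
  apply: le_lt_trans (ler_norm _) _; apply: lt_trans (archi_boundP (normr_ge0 _)) _.
  rewrite -natrX ltr_nat. exact: ltn_expl.
by rewrite ltr_pdivrMr ?exprn_gt0// mulrC -ltr_pdivrMr.
Qed.

(** Otherwise one of the four quarters of each bad rectangle would be bad, and
    the nested bad rectangles would shrink to a point, against the local
    hypothesis. *)
Lemma rect_bisection (P : R -> R -> R -> R -> Prop) a b c d : a <= b -> c <= d ->
  (forall x X y Y, a <= x -> x <= X -> X <= b -> c <= y -> y <= Y -> Y <= d ->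
     let m := (x + X) / 2 in let n := (y + Y) / 2 in
     P x m y n -> P m X y n -> P x m n Y -> P m X n Y -> P x X y Y) ->
  (forall u v, a <= u <= b -> c <= v <= d -> exists2 r : R, 0 < r &
     forall x X y Y, a <= x -> x <= u <= X -> X <= b -> c <= y -> y <= v <= Y -> Y <= d ->
     X - x < r -> Y - y < r -> P x X y Y) ->
  P a b c d.
Proof.
move=> ab cd Hq Hl; apply: contrapT => nP.
pose T := (R * R * R * R)%type.
pose mx (q : T) := (q.1.1.1 + q.1.1.2) / 2.
pose my (q : T) := (q.1.2 + q.2) / 2.
pose ok (q : T) := P q.1.1.1 q.1.1.2 q.1.2 q.2.
pose q1 (q : T) : T := (q.1.1.1, mx q, q.1.2, my q).
pose q2 (q : T) : T := (mx q, q.1.1.2, q.1.2, my q).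
pose q3 (q : T) : T := (q.1.1.1, mx q, my q, q.2).
pose q4 (q : T) : T := (mx q, q.1.1.2, my q, q.2).
pose nxt q := if ~~ `[< ok (q1 q) >] then q1 q else
  if ~~ `[< ok (q2 q) >] then q2 q else if ~~ `[< ok (q3 q) >] then q3 q else q4 q.
pose s n := iter n nxt (a, b, c, d).
pose A n := (s n).1.1.1; pose B n := (s n).1.1.2; pose G n := (s n).1.2; pose D n := (s n).2.
have inv n : [/\ [/\ a <= A n, A n <= B n & B n <= b],
   [/\ c <= G n, G n <= D n & D n <= d] & ~ ok (s n)].
  elim: n => [|n [[h1 h2 h3] [h4 h5 h6] nok]]; first by rewrite /A /B /G /D /= !lexx.
  rewrite /A /B /G /D /s iterS -/(s n) /nxt.
  have /andP[m1 m2] : A n <= mx (s n) <= B n by exact: le_mid.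
  have /andP[m3 m4] : G n <= my (s n) <= D n by exact: le_mid.
  case: asboolP => [k1|k1]; last first.
    by split => //; split => //=; [exact: le_trans m2 h3|exact: le_trans m4 h6].
  case: asboolP => [k2|k2]; last first.
    by split => //; split => //; [exact: le_trans h1 m1|exact: le_trans m4 h6].
  case: asboolP => [k3|k3]; last first.
    by split => //; split => //; [exact: le_trans m2 h3|exact: le_trans h4 m3].
  split; [split => //; exact: le_trans h1 m1|split => //; exact: le_trans h4 m3|].
  by move=> k4; apply: nok; apply: Hq => //.
have step n : [/\ A n <= A n.+1, B n.+1 <= B n, G n <= G n.+1 & D n.+1 <= D n] /\
   (B n.+1 - A n.+1 = (B n - A n) / 2 /\ D n.+1 - G n.+1 = (D n - G n) / 2).
  have [[h1 h2 h3] [h4 h5 h6] _] := inv n.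
  have -> : A n.+1 = (nxt (s n)).1.1.1 by [].
  have -> : B n.+1 = (nxt (s n)).1.1.2 by [].
  have -> : G n.+1 = (nxt (s n)).1.2 by [].
  have -> : D n.+1 = (nxt (s n)).2 by [].
  have [E1 E2] : A n <= mx (s n) <= B n /\ G n <= my (s n) <= D n.
    by split; exact: le_mid.
  have E3 : mx (s n) = (A n + B n) / 2 by [].
  have E4 : my (s n) = (G n + D n) / 2 by [].
  rewrite /nxt; case: ifP => _; [|case: ifP => _; [|case: ifP => _]];
    rewrite /= -/(A n) -/(B n) -/(G n) -/(D n); split; split;
    case/andP: E1 => // ? ?; case/andP: E2 => // ? ?; rewrite ?E3 ?E4; by [|field].
have len n : B n - A n = (b - a) / 2 ^+ n /\ D n - G n = (d - c) / 2 ^+ n.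
  elim: n => [|n [e1 e2]]; first by rewrite /A /B /G /D /= expr0 !divr1.
  have [_ [-> ->]] := step n; rewrite e1 e2 exprS; split; field;
    by rewrite expf_neq0// pnatr_eq0.
have mono (F : nat -> R) : (forall n, F n <= F n.+1) -> forall n m, (n <= m)%N -> F n <= F m.
  move=> h n m; elim: m => [|m IH]; first by rewrite leqn0 => /eqP ->.
  by rewrite leq_eqVlt => /orP[/eqP -> //|/IH/le_trans]; apply.
have cross (F H : nat -> R) : (forall n, F n <= F n.+1) -> (forall n, H n.+1 <= H n) ->
    (forall n, F n <= H n) -> exists u, forall n, F n <= u <= H n.
  move=> f1 h1 fh.
  have FH n m : F n <= H m.
    apply: le_trans (mono F f1 _ _ (leq_maxl n m)) _; apply: le_trans (fh _) _.
    rewrite -lerN2; apply: (mono (fun k => - H k)) (leq_maxr n m) => k; exact: ltac:(rewrite lerN2).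
  have hs : has_sup (range F).
    split; first by exists (F 0%N); exists 0%N.
    by exists (H 0%N) => _ [n _ <-].
  exists (sup (range F)) => n; apply/andP; split.
    by apply: ub_le_sup; [case: hs|exists n].
  by apply: ge_sup => [|_ [m _ <-] //]; case: hs.
have [u hu] : exists u, forall n, A n <= u <= B n.
  by apply: cross => n; [case: (step n) => -[]|case: (step n) => -[]|case: (inv n) => -[]].
have [v hv] : exists v, forall n, G n <= v <= D n.
  by apply: cross => n; [case: (step n) => -[]|case: (step n) => -[]|case: (inv n) => _ []].
have [r r0 hr] := Hl u v (hu 0%N) (hv 0%N).
have [n1 hn1] := small_dyadic (b - a) r0; have [n2 hn2] := small_dyadic (d - c) r0.
pose n := maxn n1 n2.
have dec (K : R) k : 0 <= K -> (k <= n)%N -> K / 2 ^+ n <= K / 2 ^+ k.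
  move=> K0 kn; rewrite ler_wpM2l// lef_pV2 ?posrE ?exprn_gt0//.
  by apply: ler_weXn2l => //; rewrite ler1n.
have [[h1 h2 h3] [h4 h5 h6] nok] := inv n; have [e1 e2] := len n.
have r1 : B n - A n < r.
  by rewrite e1; apply: le_lt_trans hn1; apply: dec; rewrite ?subr_ge0 ?leq_maxl.
have r2 : D n - G n < r.
  by rewrite e2; apply: le_lt_trans hn2; apply: dec; rewrite ?subr_ge0 ?leq_maxr.
by apply: nok; exact: (hr _ _ _ _ h1 (hu n) h3 h4 (hv n) h6 r1 r2).
Qed.

Lemma rectint_affine (k l z0 : C) a b c d : a <= b -> c <= d ->
  rectint (fun w => k + (w - z0) * l) a b c d = 0.
Proof.
move=> ab cd.
apply: (rectint_primitive ab cd (F := fun w => k * w + (w - z0) * (w - z0) * (l / 2))) => w _.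
  apply: cont_add; first exact: cont_cst.
  apply: cont_mul; last exact: cont_cst.
  by apply: cont_add; [exact: cont_id|exact: cont_cst].
have dw := deriv_at_add (deriv_at_id w) (deriv_at_cst (- z0) w).
have := deriv_at_add (deriv_at_mul (deriv_at_cst k w) (deriv_at_id w))
  (deriv_at_mul (deriv_at_mul dw dw) (deriv_at_cst (l / 2) w)).
by congr deriv_at; field.
Qed.

Lemma cabs_rect a b c d z w : rect a b c d z -> rect a b c d w ->
  cabs (w - z) <= (b - a) + (d - c).
Proof.
move=> hz hw; apply: le_trans (cabs_ReIm _) _; move: hz hw.
case: z w => [x y] [x' y'] [/= /andP[? ?] /andP[? ?]] [/= /andP[? ?] /andP[? ?]].
by rewrite lerD// ler_norml; lra.
Qed.

(** The bound [e * (half-perimeter)^2] passes from the quarters of a rectangle to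
    the rectangle, and it holds locally because [f] is affine up to an error
    [o(|w - z|)] and an affine function has a primitive. *)
Lemma goursat f a b c d : a <= b -> c <= d ->
  (forall w, rect a b c d w -> holo f w) -> rectint f a b c d = 0.
Proof.
move=> ab cd hf.
have K e : 0 < e -> cabs (rectint f a b c d) <= e * ((b - a) + (d - c)) ^+ 2.
  move=> e0; pose P x X y Y : Prop := cabs (rectint f x X y Y) <= e * ((X - x) + (Y - y)) ^+ 2.
  apply: (@rect_bisection P a b c d ab cd) => [|u v uab vcd].
    move=> x X y Y ax xX Xb cy yY Yd m n p1 p2 p3 p4; move: p1 p2 p3 p4; rewrite /P => p1 p2 p3 p4.
    have /andP[xm mX] : x <= m <= X by exact: le_mid.
    have /andP[yn nY] : y <= n <= Y by exact: le_mid.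
    have cf x' X' y' Y' : x <= x' -> X' <= X -> y <= y' -> Y' <= Y ->
        forall w, rect x' X' y' Y' w -> cont f w.
      move=> ? ? ? ? w /(sub_rect _ _ _ _)h; apply: holo_cont; apply: hf; apply: h => //.
      - by apply: le_trans ax _.
      - by apply: le_trans Xb.
      - by apply: le_trans cy _.
      - by apply: le_trans Yd.
    rewrite (rectint_cat_x xm mX yY (cf _ _ _ _ _ _ _ _))//.
    rewrite (rectint_cat_y xm yn nY (cf _ _ _ _ _ _ _ _))//.
    rewrite (rectint_cat_y mX yn nY (cf _ _ _ _ _ _ _ _))//.
    have h1 := cabsD (rectint f x m y n + rectint f x m n Y) (rectint f m X y n + rectint f m X n Y).
    have h2 := cabsD (rectint f x m y n) (rectint f x m n Y).
    have h3 := cabsD (rectint f m X y n) (rectint f m X n Y).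
    apply: (le_trans h1); apply: (le_trans (lerD h2 h3)).
    apply: (le_trans (lerD (lerD p1 p3) (lerD p2 p4))).
    by rewrite le_eqVlt; apply/orP; left; apply/eqP; rewrite /m /n; field.
  have [l dl] := hf (u +i* v) (conj uab vcd).
  have [r r0 hr] := dl (e / 4) ltac:(lra).
  exists (r / 2) => [|x X y Y ax xu Xb cy yv Yd Xx Yy]; first lra.
  rewrite /P.
  have xX : x <= X by case/andP: xu; exact: le_trans.
  have yY : y <= Y by case/andP: yv; exact: le_trans.
  have uv : rect x X y Y (u +i* v) by split.
  have cf w : rect x X y Y w -> cont f w.
    by move=> hw; apply: holo_cont; apply: hf; apply: sub_rect hw.
  pose g w := f w + -1 * (f (u +i* v) + (w - (u +i* v)) * l).
  have ca w : cont (fun w => f (u +i* v) + (w - (u +i* v)) * l) w.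
    apply: cont_add; first exact: cont_cst.
    apply: cont_mul; last exact: cont_cst.
    by apply: cont_add; [exact: cont_id|exact: cont_cst].
  have cb w : cont (fun w => -1 * (f (u +i* v) + (w - (u +i* v)) * l)) w.
    by apply: cont_mul; [exact: cont_cst|exact: ca].
  have -> : rectint f x X y Y = rectint g x X y Y.
    rewrite /g rectint_add// ?rectint_scale// ?rectint_affine// ?mulr0 ?addr0//.
    by move=> w [hw _]; exact: cf.
  have S0 : 0 <= (X - x) + (Y - y) by lra.
  apply: (@le_trans _ _ (4 * (e / 4 * ((X - x) + (Y - y))) * ((X - x) + (Y - y)))).
    apply: rectint_bound => // w [hw _].
      by apply: cont_add; [exact: cf|exact: cb].
    have hwu := cabs_rect uv hw.
    have /hr : cabs (w - (u +i* v)) < r by lra.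
    rewrite /g mulN1r opprD addrA => /le_trans; apply.
    by rewrite ler_wpM2l//; lra.
  by rewrite le_eqVlt; apply/orP; left; apply/eqP; field.
apply/eqP; rewrite -cabs_eq0; apply/negPn/negP => ne.
have n0 : 0 < cabs (rectint f a b c d) by rewrite lt0r ne cabs_ge0.
set S := ((b - a) + (d - c)) ^+ 2; have S0 : 0 <= S by exact: sqr_ge0.
have e0 : 0 < cabs (rectint f a b c d) / (2 * (S + 1)) by rewrite divr_gt0//; lra.
have := K _ e0; rewrite -/S => h.
have : cabs (rectint f a b c d) / (2 * (S + 1)) * S =
  cabs (rectint f a b c d) * (S / (2 * (S + 1))) by field; lra.
have : S / (2 * (S + 1)) <= 1 / 2 by rewrite ler_pdivrMr; lra.
nra.
Qed.

(** Only a small square around [p] contributes, and its contribution is at most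
    a constant times its side. *)
Lemma goursat_punctured f a b c d p : a < Re p < b -> c < Im p < d ->
  (forall w, rect a b c d w -> cont f w) ->
  (forall w, rect a b c d w -> w != p -> holo f w) -> rectint f a b c d = 0.
Proof.
case: p => u v /= /andP[au ub] /andP[cv vd] cf hf.
have [r r0 hr] := cont_bounded (cf (u +i* v) ltac:(by split; rewrite /= !ltW)).
set M := cabs (f (u +i* v)) + 1 in hr.
have M0 : 0 < M by rewrite /M; have := cabs_ge0 (f (u +i* v)); lra.
have H t : 0 < t -> a <= u - t -> u + t <= b -> c <= v - t -> v + t <= d -> 4 * t < r ->
    cabs (rectint f a b c d) <= 16 * M * t.
  move=> t0 h1 h2 h3 h4 h5.
  have cf' x X y Y : a <= x -> X <= b -> c <= y -> Y <= d ->
      forall w, rect x X y Y w -> cont f w.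
    by move=> ? ? ? ? w hw; apply: cf; apply: sub_rect hw.
  have off x X y Y : a <= x -> x <= X -> X <= b -> c <= y -> y <= Y -> Y <= d ->
      [\/ u < x, X < u, v < y | Y < v] -> rectint f x X y Y = 0.
    move=> ? ? ? ? ? ? o; apply: goursat => // w hw; apply: hf; first by apply: sub_rect hw.
    apply/negP => /eqP E; move: hw; rewrite E => -[/= /andP[? ?] /andP[? ?]]; case: o; lra.
  have L1 : a <= u + t by lra. have L2 : u - t <= u + t by lra.
  have L3 : u - t <= b by lra. have L4 : c <= v + t by lra.
  have L5 : v - t <= v + t by lra. have L6 : v - t <= d by lra.
  have L7 : c <= d by lra. have L8 : a <= b by lra.
  rewrite (rectint_cat_x h1 L3 L7 (cf' _ _ _ _ _ _ _ _))//.
  rewrite (rectint_cat_x L2 h2 L7 (cf' _ _ _ _ _ _ _ _))//.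
  rewrite (rectint_cat_y L2 h3 L6 (cf' _ _ _ _ _ _ _ _))//.
  rewrite (rectint_cat_y L2 L5 h4 (cf' _ _ _ _ _ _ _ _))//.
  rewrite (off a (u - t) c d)//; last by constructor 2; lra.
  rewrite (off (u - t) (u + t) c (v - t))//; last by constructor 4; lra.
  rewrite (off (u - t) (u + t) (v + t) d)//; last by constructor 3; lra.
  rewrite (off (u + t) b c d)//; last by constructor 1; lra.
  rewrite !add0r !addr0.
  have -> : 16 * M * t = 4 * M * ((u + t - (u - t)) + (v + t - (v - t))) by ring.
  apply: rectint_bound => // w [hw _]; first exact: (cf' _ _ _ _ _ _ _ _ w hw).
  apply/ltW/hr; apply: le_lt_trans (_ : _ <= (u + t - (u - t)) + (v + t - (v - t))) _; last lra.
  by apply: cabs_rect hw; split=> /=; lra.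
apply/eqP; rewrite -cabs_eq0; apply/negPn/negP => ne.
have n0 : 0 < cabs (rectint f a b c d) by rewrite lt0r ne cabs_ge0.
have e0 : 0 < cabs (rectint f a b c d) / (16 * M) by rewrite divr_gt0//; lra.
pose m := Num.min (u - a) (Num.min (b - u) (Num.min (v - c) (Num.min (d - v) (r / 4)))).
have m0 : 0 < m by rewrite !lt_min; apply/and5P; split; lra.
have [t t0 /andP[]] := lt_both m0 e0; rewrite !lt_min => /and5P[t1 t2 t3 t4 t5] t6.
have := H t t0 ltac:(lra) ltac:(lra) ltac:(lra) ltac:(lra) ltac:(lra).
move: t6; rewrite ltr_pdivlMr; [lra|lra].
Qed.

End goursat.

(** * Cauchy's formula on a square *)

Section square.
Variable R : realType.
Local Notation C := R[i].
Variables (c : C) (s : R).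
Hypothesis s0 : 0 < s.
Implicit Types (f g : C -> C) (z w : C).

Definition square_bdry : set C := rect_bdry (Re c - s) (Re c + s) (Im c - s) (Im c + s).
Definition in_square : set C := rect (Re c - s) (Re c + s) (Im c - s) (Im c + s).
Definition square_int f : C := rectint f (Re c - s) (Re c + s) (Im c - s) (Im c + s).

Local Notation bdry := square_bdry.
Local Notation SI := square_int.

Let le1 : Re c - s <= Re c + s. Proof. by move: s0 => h; lra. Qed.
Let le2 : Im c - s <= Im c + s. Proof. by move: s0 => h; lra. Qed.

Lemma bdry_square w : bdry w -> in_square w. Proof. by case. Qed.

Let ReB z w : Re (z - w) = Re z - Re w. Proof. by case: z w => ? ? []. Qed.
Let ImB z w : Im (z - w) = Im z - Im w. Proof. by case: z w => ? ? []. Qed.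

Lemma square_le w : in_square w -> cabs (w - c) <= 2 * s.
Proof.
case=> /andP[h1 h2] /andP[h3 h4].
apply: le_trans (cabs_ReIm _) _; rewrite mulrDl !mul1r lerD// ler_norml ?ReB ?ImB; lra.
Qed.

Lemma bdry_ge w : bdry w -> s <= cabs (w - c).
Proof.
have s_abs (x y : R) : x = y - s \/ x = y + s -> s = `|x - y|.
  by case=> ->; rewrite addrAC subrr add0r ?normrN gtr0_norm.
move=> [_ [h|h|h|h]].
- by apply: le_trans (cabs_Re _); rewrite ReB -s_abs//; left.
- by apply: le_trans (cabs_Re _); rewrite ReB -s_abs//; right.
- by apply: le_trans (cabs_Im _); rewrite ImB -s_abs//; left.
- by apply: le_trans (cabs_Im _); rewrite ImB -s_abs//; right.
Qed.

Lemma bdry_far w z : bdry w -> cabs (z - c) < s / 2 -> s / 2 <= cabs (w - z).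
Proof.
move=> /bdry_ge h1 h2; have := cabs_le_sub (w - c) (z - c).
by rewrite opprB addrA subrK; lra.
Qed.

Lemma bdry_neq w z : bdry w -> cabs (z - c) < s / 2 -> w - z != 0.
Proof. by move: s0 => hs /bdry_far h /h; rewrite -cabs_gt0 => h1; lra. Qed.

Lemma center_near : cabs (c - c) < s / 2.
Proof. by rewrite subrr cabs0 divr_gt0. Qed.

Lemma cont_sub z w : cont (fun w => w - z) w.
Proof. by apply: cont_add; [exact: cont_id|exact: cont_cst]. Qed.

Lemma cont_kernel z n w : bdry w -> cabs (z - c) < s / 2 -> cont (fun w => ((w - z) ^+ n)^-1) w.
Proof.
move=> bw hz; apply: cont_inv; last by rewrite expf_neq0// bdry_neq.
elim: n => [|n IH]; first by exact: cont_cst.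
have -> : (fun x => (x - z) ^+ n.+1) = (fun x => (x - z) * (x - z) ^+ n).
  by apply/funext => x; rewrite exprS.
by apply: cont_mul => //; exact: cont_sub.
Qed.

Lemma square_int_bound f (M : R) : (forall w, bdry w -> cont f w) ->
  (forall w, bdry w -> cabs (f w) <= M) -> cabs (SI f) <= 16 * s * M.
Proof.
move=> cf fM; apply: le_trans (rectint_bound le1 le2 cf fM) _.
by rewrite le_eqVlt; apply/orP; left; apply/eqP; ring.
Qed.

Section kernels.
Variables (f : C -> C) (M : R).
Hypothesis cf : forall w, bdry w -> cont f w.
Hypothesis fM : forall w, bdry w -> cabs (f w) <= M.

Definition cauchy_int n z : C := SI (fun w => f w * ((w - z) ^+ n)^-1).

Let cfk n z w : bdry w -> cabs (z - c) < s / 2 -> cont (fun w => f w * ((w - z) ^+ n)^-1) w.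
Proof. by move=> bw hz; apply: cont_mul; [exact: cf|exact: cont_kernel]. Qed.

Let M0 : 0 <= M.
Proof.
apply: le_trans (cabs_ge0 (f ((Re c - s) +i* (Im c - s)))) _; apply: fM.
by move: s0 => hs; split; [split; rewrite /= lexx; lra|constructor 1].
Qed.

Lemma kernel_bound z w n : bdry w -> cabs (z - c) < s / 2 ->
  cabs ((w - z) ^+ n)^-1 <= (2 / s) ^+ n.
Proof.
move=> bw hz; rewrite cabsV cabsX -exprVn; apply: lerXn2r; rewrite ?nnegrE.
- by rewrite invr_ge0 cabs_ge0.
- by rewrite divr_ge0// ltW.
have h := bdry_far bw hz; rewrite -(invf_div s 2) lef_pV2 ?posrE ?divr_gt0//.
by apply: lt_le_trans h; rewrite divr_gt0.
Qed.

Lemma cauchy_int_bound z n : cabs (z - c) < s / 2 ->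
  cabs (cauchy_int n z) <= 16 * s * (M * (2 / s) ^+ n).
Proof.
move=> hz; apply: square_int_bound => w bw; first exact: cfk.
by rewrite cabsM ler_pM// ?cabs_ge0 ?fM// kernel_bound.
Qed.

(** Differentiation under the integral sign, for kernels with a uniform quadratic
    remainder. *)
Lemma deriv_square_int (k : C -> C -> C) (k1 : C -> C) (e0 L : R) z : 0 < e0 -> 0 <= L ->
  (forall h w, cabs h < e0 -> bdry w -> cont (fun w => k (z + h) w) w) ->
  (forall w, bdry w -> cont k1 w) ->
  (forall h w, cabs h < e0 -> bdry w ->
     cabs (k (z + h) w - k z w - h * k1 w) <= L * (cabs h * cabs h)) ->
  deriv_at (fun z => SI (fun w => f w * k z w)) z (SI (fun w => f w * k1 w)).
Proof.
move=> e00 L0 ck ck1 kL.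
have ckz w : bdry w -> cont (k z) w.
  by move=> bw; have := ck 0 w; rewrite addr0 cabs0; exact.
pose K := 16 * s * (M * L).
have K0 : 0 <= K by rewrite /K !mulr_ge0// ltW.
have fk g w : bdry w -> cont g w -> cont (fun w => f w * g w) w.
  by move=> bw cg; apply: cont_mul => //; exact: cf.
suff H h : cabs h < e0 ->
    cabs (SI (fun w => f w * k (z + h) w) - SI (fun w => f w * k z w) - h * SI (fun w => f w * k1 w))
    <= K * (cabs h * cabs h).
  move=> e e_gt0; have eK : 0 < e / (K + 1) by rewrite divr_gt0//; lra.
  exists (Num.min e0 (e / (K + 1))) => [|w]; first by rewrite !lt_min e00 eK.
  rewrite !lt_min => /andP[h1 h2]; have := H (w - z) h1.
  rewrite (addrC z) subrK => /le_trans; apply; rewrite mulrA ler_wpM2r ?cabs_ge0//.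
  move: h2; rewrite ltr_pdivlMr; last lra.
  by have := cabs_ge0 (w - z); nra.
move=> hh.
have cr w : bdry w -> cont (fun w => (k (z + h) w + -1 * k z w) + - h * k1 w) w.
  move=> bw; apply: cont_add; last by apply: cont_mul; [exact: cont_cst|exact: ck1].
  by apply: cont_add; [exact: ck|apply: cont_mul; [exact: cont_cst|exact: ckz]].
have -> : SI (fun w => f w * k (z + h) w) - SI (fun w => f w * k z w) - h * SI (fun w => f w * k1 w) =
    SI (fun w => f w * ((k (z + h) w + -1 * k z w) + - h * k1 w)).
  rewrite (_ : _ - _ - _ = SI (fun w => f w * k (z + h) w) + -1 * SI (fun w => f w * k z w)
    + - h * SI (fun w => f w * k1 w)); last by ring.
  have c1 w : bdry w -> cont (fun w => f w * k (z + h) w) w by move=> bw; apply: fk => //; exact: ck.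
  have c2 w : bdry w -> cont (fun w => f w * k z w) w by move=> bw; apply: fk => //; exact: ckz.
  have c3 w : bdry w -> cont (fun w => f w * k1 w) w by move=> bw; apply: fk => //; exact: ck1.
  have sc (l : C) g w : cont g w -> cont (fun w => l * g w) w.
    by move=> cg; apply: cont_mul => //; exact: cont_cst.
  rewrite /square_int -!rectint_scale// -!rectint_add//.
  - by apply: rectint_ext => // w bw; ring.
  - by move=> w bw; apply: cont_add; [exact: c1|apply: sc; exact: c2].
  - by move=> w bw; apply: sc; exact: c3.
  - by move=> w bw; apply: sc; exact: c2.
rewrite /K -!mulrA; apply: le_trans (square_int_bound (M := M * (L * (cabs h * cabs h))) _ _) _.
- by move=> w bw; apply: fk => //; exact: cr.
- move=> w bw; rewrite cabsM ler_pM ?cabs_ge0 ?fM// mulN1r mulNr; exact: kL.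
- by rewrite -!mulrA.
Qed.

Lemma cauchy_int_deriv1 z : cabs (z - c) < s / 2 ->
  deriv_at (cauchy_int 1) z (cauchy_int 2 z).
Proof.
move=> hz; have s20 : 0 <= 2 / s by rewrite divr_ge0// ltW.
apply: (@deriv_square_int (fun z w => ((w - z) ^+ 1)^-1) (fun w => ((w - z) ^+ 2)^-1)
  (s / 2 - cabs (z - c)) ((2 / s) ^+ 3)); rewrite ?subr_gt0 ?exprn_ge0//.
- move=> h w hh bw; apply: cont_kernel => //.
  by rewrite addrAC; apply: le_lt_trans (cabsD _ _) _; lra.
- by move=> w bw; exact: cont_kernel.
move=> h w hh bw; have hz' : cabs (z + h - c) < s / 2.
  by rewrite addrAC; apply: le_lt_trans (cabsD _ _) _; lra.
have w1 := bdry_neq bw hz; have w2 := bdry_neq bw hz'.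
rewrite (_ : _ - _ - _ = (h * h) * (((w - z) ^+ 2)^-1 * ((w - (z + h)) ^+ 1)^-1)); last first.
  by rewrite expr1; field; rewrite w1 w2.
rewrite 2!cabsM mulrC ler_wpM2r ?mulr_ge0 ?cabs_ge0// (exprD _ 2 1) cabsM.
by apply: ler_pM; rewrite ?cabs_ge0//; exact: kernel_bound.
Qed.

Lemma cauchy_int_deriv2 z : cabs (z - c) < s / 2 ->
  deriv_at (cauchy_int 2) z (2 * cauchy_int 3 z).
Proof.
move=> hz; have s20 : 0 <= 2 / s by rewrite divr_ge0// ltW.
have -> : 2 * cauchy_int 3 z = SI (fun w => f w * (2 * ((w - z) ^+ 3)^-1)).
  rewrite /cauchy_int /square_int -rectint_scale//.
    by apply: rectint_ext => // w bw; ring.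
  by move=> w bw; exact: cfk.
apply: (@deriv_square_int (fun z w => ((w - z) ^+ 2)^-1) (fun w => 2 * ((w - z) ^+ 3)^-1)
  (s / 2 - cabs (z - c)) (3 * (2 / s) ^+ 4)).
- by rewrite subr_gt0.
- by rewrite mulr_ge0// exprn_ge0.
- move=> h w hh bw; apply: cont_kernel => //.
  by rewrite addrAC; apply: le_lt_trans (cabsD _ _) _; lra.
- by move=> w bw; apply: cont_mul; [exact: cont_cst|exact: cont_kernel].
move=> h w hh bw; have hz' : cabs (z + h - c) < s / 2.
  by rewrite addrAC; apply: le_lt_trans (cabsD _ _) _; lra.
have w1 := bdry_neq bw hz; have w2 := bdry_neq bw hz'.
rewrite (_ : _ - _ - _ = (h * h) * (((w - z) ^+ 2)^-1 * ((w - (z + h)) ^+ 2)^-1 +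
   (((w - z) ^+ 3)^-1 * ((w - (z + h)) ^+ 1)^-1 + ((w - z) ^+ 3)^-1 * ((w - (z + h)) ^+ 1)^-1))); last first.
  by rewrite expr1; field; rewrite w1 w2.
rewrite 2!cabsM mulrC ler_wpM2r ?mulr_ge0 ?cabs_ge0//.
have p22 : cabs (((w - z) ^+ 2)^-1 * ((w - (z + h)) ^+ 2)^-1) <= (2 / s) ^+ 4.
  by rewrite cabsM (exprD _ 2 2); apply: ler_pM; rewrite ?cabs_ge0//; exact: kernel_bound.
have p31 : cabs (((w - z) ^+ 3)^-1 * ((w - (z + h)) ^+ 1)^-1) <= (2 / s) ^+ 4.
  by rewrite cabsM (exprD _ 3 1); apply: ler_pM; rewrite ?cabs_ge0//; exact: kernel_bound.
apply: le_trans (cabsD _ _) _; apply: le_trans (lerD p22 (cabsD _ _)) _; lra.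
Qed.

End kernels.

(** This is [2 i pi]. *)
Definition square_const : C := cauchy_int (fun=> 1) 1 c.

(** The derivative in [z] vanishes, since [(w - z)^-2] has a primitive in [w]. *)
Lemma cauchy_int1 z : cabs (z - c) < s / 2 -> cauchy_int (fun=> 1) 1 z = square_const.
Proof.
move=> hz; apply: (deriv0_const _ hz) => p h.
have c1 w : square_bdry w -> cont (fun=> 1) w by move=> _; exact: cont_cst.
have b1 w : square_bdry w -> cabs (1 : C) <= 1 by rewrite cabs1.
have := cauchy_int_deriv1 c1 b1 h; congr deriv_at.
apply: (rectint_primitive le1 le2 (F := fun w => - 1 * (w - p)^-1)) => w bw.
  by apply: cont_mul; [exact: cont_cst|exact: cont_kernel].
have wp := bdry_neq bw h.
have := deriv_at_mul (deriv_at_cst (-1) w) (deriv_at_inv (deriv_at_add (deriv_at_id w) (deriv_at_cst (- p) w)) wp).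
by congr deriv_at; field.
Qed.

Lemma rint_ge (g : R -> R) (m a b : R) : a <= b -> rcont g a b ->
  (forall x, a <= x <= b -> m <= g x) -> m * (b - a) <= rint g a b.
Proof.
move=> ab cg mg; rewrite -lerN2 -mulNr -[- rint _ _ _]mulN1r -rint_scale//.
apply: rint_le => //; first exact: rcont_opp.
by move=> x /mg; rewrite mulN1r lerN2.
Qed.

(** Each of the four sides contributes at least 1 to the imaginary part. *)
Lemma square_const_ge : 4 <= cabs square_const.
Proof.
have hs := s0; pose k (w : C) : C := 1 * ((w - c) ^+ 1)^-1.
have kc w : square_bdry w -> cont k w.
  by move=> bw; apply: cont_mul; [exact: cont_cst|exact: (cont_kernel 1 bw center_near)].
have [[c1 c1'] [c2 c2'] [c3 c3'] [c4 c4']] := bdry_cont le1 le2 kc.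
apply: le_trans (cabs_Im _); apply: le_trans (ler_norm _).
have inv (x y : R) : x ^+ 2 + y ^+ 2 != 0 ->
    (x +i* y)^-1 = (x / (x ^+ 2 + y ^+ 2)) -i* (y / (x ^+ 2 + y ^+ 2)) by [].
have kE x y : k (x +i* y) = ((x - Re c) +i* (y - Im c))^-1.
  by rewrite /k mul1r expr1; congr (_^-1); case: (c) => ? ?.
have bnd (x : R) : - s <= x <= s -> 1 / (2 * s) <= s / (s ^+ 2 + x ^+ 2).
  move=> /andP[x1 x2]; have x2s : x ^+ 2 <= s ^+ 2.
    by rewrite -subr_ge0 subr_sqr mulr_ge0; lra.
  have s2 : 0 < s ^+ 2 by rewrite exprn_gt0.
  have x20 := sqr_ge0 x.
  rewrite ler_pdivrMr ?mulr_gt0// mulrAC ler_pdivlMr; last lra.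
  by rewrite mul1r; move: s2 x2s; rewrite !expr2; lra.
have I1 : 1 / (2 * s) * (Re c + s - (Re c - s)) <= rint (fun x => Im (k (x +i* (Im c - s)))) (Re c - s) (Re c + s).
  apply: rint_ge => // x /andP[x1 x2]; rewrite kE inv /=.
    rewrite (_ : Im c - s - Im c = - s); last by ring.
    by rewrite sqrrN mulNr opprK addrC; apply: bnd; lra.
  by rewrite (_ : Im c - s - Im c = - s); [rewrite sqrrN; have := sqr_ge0 (x - Re c); have : 0 < s ^+ 2 by rewrite exprn_gt0|ring]; lra.
have I2 : 1 / (2 * s) * (Re c + s - (Re c - s)) <= - rint (fun x => Im (k (x +i* (Im c + s)))) (Re c - s) (Re c + s).
  rewrite -[leRHS]mulN1r -rint_scale//.
  apply: rint_ge => //; first exact: rcont_opp.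
  move=> x /andP[x1 x2]; rewrite kE inv /=.
    rewrite (_ : Im c + s - Im c = s); last by ring.
    by rewrite mulN1r opprK addrC; apply: bnd; lra.
  by rewrite (_ : Im c + s - Im c = s); [have := sqr_ge0 (x - Re c); have : 0 < s ^+ 2 by rewrite exprn_gt0|ring]; lra.
have I3 : 1 / (2 * s) * (Im c + s - (Im c - s)) <= rint (fun y => Re (k ((Re c + s) +i* y))) (Im c - s) (Im c + s).
  apply: rint_ge => // y /andP[x1 x2]; rewrite kE inv /=.
    rewrite (_ : Re c + s - Re c = s); last by ring.
    by apply: bnd; lra.
  by rewrite (_ : Re c + s - Re c = s); [have := sqr_ge0 (y - Im c); have : 0 < s ^+ 2 by rewrite exprn_gt0|ring]; lra.
have I4 : 1 / (2 * s) * (Im c + s - (Im c - s)) <= - rint (fun y => Re (k ((Re c - s) +i* y))) (Im c - s) (Im c + s).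
  rewrite -[leRHS]mulN1r -rint_scale//.
  apply: rint_ge => //; first exact: rcont_opp.
  move=> y /andP[x1 x2]; rewrite kE inv /=.
    rewrite (_ : Re c - s - Re c = - s); last by ring.
    by rewrite mulN1r mulNr opprK sqrrN; apply: bnd; lra.
  by rewrite (_ : Re c - s - Re c = - s); [rewrite sqrrN; have := sqr_ge0 (y - Im c); have : 0 < s ^+ 2 by rewrite exprn_gt0|ring]; lra.
have J (x : R) : 1 / (2 * s) * (x + s - (x - s)) = 1 by field; lra.
rewrite !J in I1 I2 I3 I4.
have -> : Im square_const =
    rint (fun x => Im (k (x +i* (Im c - s)))) (Re c - s) (Re c + s)
    - rint (fun x => Im (k (x +i* (Im c + s)))) (Re c - s) (Re c + s)
    + (rint (fun y => Re (k ((Re c + s) +i* y))) (Im c - s) (Im c + s)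
    - rint (fun y => Re (k ((Re c - s) +i* y))) (Im c - s) (Im c + s)).
  by rewrite /square_const /cauchy_int /square_int /rectint /cint /= mul0r mul1r add0r.
lra.
Qed.

(** The slope [(f w - f z) / (w - z)], continued by [f' z], is holomorphic except
    at [z], where it is continuous; hence its integral vanishes. *)
Lemma cauchy_formula f z : (forall w, in_square w -> holo f w) -> cabs (z - c) < s / 2 ->
  square_const * f z = cauchy_int f 1 z.
Proof.
move=> hf hz; have hs := s0.
have zin : Re c - s < Re z < Re c + s /\ Im c - s < Im z < Im c + s.
  have := cabs_Re (z - c); have := cabs_Im (z - c); rewrite ReB ImB !ler_norml.
  by move=> /andP[? ?] /andP[? ?]; split; lra.
have [l dl] : holo f z by apply: hf; case: zin => /andP[? ?] /andP[? ?]; split; rewrite !ltW.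
have [g [cg gl] fg] : exists2 g, cont g z /\ g z = l & forall w, f w = f z + (w - z) * g w.
  exact/deriv_atP.
have gE w : w != z -> g w = (f w - f z) * (w - z)^-1.
  by move=> wz; rewrite fg; field; rewrite subr_eq0.
have hg w : in_square w -> w != z -> holo g w.
  move=> hw wz; have wz0 : w - z != 0 by rewrite subr_eq0.
  apply: (@holo_local _ (fun w => (f w - f z) * (w - z)^-1) g w (cabs (w - z))).
  - by rewrite cabs_gt0.
  - move=> v hv; rewrite gE//; apply/negP => /eqP E.
    by move: hv; rewrite E cabsC ltxx.
  - apply: holo_mul; first by apply: holo_add; [exact: hf|exact: holo_cst].
    by apply: holo_inv => //; apply: holo_add; [exact: holo_id|exact: holo_cst].
have cg' w : in_square w -> cont g w.
  by move=> hw; have [->//|wz] := eqVneq w z; apply: holo_cont; apply: hg.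
have [hx hy] := zin; have := goursat_punctured hx hy cg' hg.
rewrite (rectint_ext le1 le2 (g := fun w => f w * ((w - z) ^+ 1)^-1 + (- f z) * (1 * ((w - z) ^+ 1)^-1))); last first.
  move=> w bw; have := bdry_neq bw hz; rewrite subr_eq0 => wz.
  by rewrite gE// !expr1; ring.
have k1 w : square_bdry w -> cont (fun w => 1 * ((w - z) ^+ 1)^-1) w.
  by move=> bw; apply: cont_mul; [exact: cont_cst|exact: cont_kernel].
rewrite rectint_add//; last 2 first.
- by move=> w bw; apply: cont_mul; [apply/holo_cont/hf/bdry_square|exact: cont_kernel].
- by move=> w bw; apply: cont_mul; [exact: cont_cst|exact: k1].
rewrite rectint_scale// -/(square_int _) -/(square_int _) -/(cauchy_int f 1 z).
rewrite -/(cauchy_int (fun=> 1) 1 z) cauchy_int1// mulNr => /eqP; rewrite subr_eq0 => /eqP ->.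
by rewrite mulrC.
Qed.

Lemma cauchy_sup f z (M : R) : (forall w, in_square w -> holo f w) ->
  (forall w, square_bdry w -> cabs (f w) <= M) -> cabs (z - c) < s / 2 ->
  cabs (f z) <= 8 * M.
Proof.
move=> hf fM hz; have hs := s0.
have cf w : square_bdry w -> cont f w by move=> /bdry_square/hf/holo_cont.
have := cauchy_int_bound cf fM 1 hz; rewrite -cauchy_formula// cabsM expr1 => h.
have E : 16 * s * (M * (2 / s)) = 4 * (8 * M) by field; lra.
rewrite E in h; rewrite -(ler_pM2l (x := 4))//; apply: le_trans h.
by rewrite ler_wpM2r ?cabs_ge0// square_const_ge.
Qed.

End square.

(** * Local properties of holomorphic functions *)

Section local.
Variable R : realType.
Local Notation C := R[i].
Implicit Types (f g : C -> C) (z w p : C) (r : R).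

Definition holo_disk f p r := forall w, cabs (w - p) < r -> holo f w.

Definition deriv f z : C := xget 0 [set l | deriv_at f z l].

Lemma derivE f z l : deriv_at f z l -> deriv f z = l.
Proof. by move=> h; apply: xget_unique => // m hm; exact: deriv_at_uniq hm h. Qed.

Lemma holo_deriv_at f z : holo f z -> deriv_at f z (deriv f z).
Proof. by case=> l h; rewrite (derivE h). Qed.

Lemma cont_unique f g p : cont f p -> cont g p -> (exists2 d : R, 0 < d &
  forall w, w != p -> cabs (w - p) < d -> f w = g w) -> f p = g p.
Proof.
move=> cf cg [d d0 fg]; apply/eqP; rewrite -subr_eq0 -cabs_eq0; apply/negPn/negP => ne.
have e0 : 0 < cabs (f p - g p) / 2 by rewrite divr_gt0// lt0r ne cabs_ge0.
have [d1 d10 h1] := cf _ e0; have [d2 d20 h2] := cg _ e0.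
have m0 : 0 < Num.min d1 d2 by rewrite lt_min d10 d20.
have [t t0 /andP[td]] := lt_both d0 m0; rewrite lt_min => /andP[td1 td2].
have tt : cabs (p + t%:C - p) = t by rewrite addrC addKr cabs_real gtr0_norm.
have := fg (p + t%:C); rewrite tt => /(_ _ td) E.
have := h1 (p + t%:C); rewrite tt => /(_ td1); rewrite E; last first.
  by rewrite -subr_eq0 -cabs_eq0 tt gt_eqF.
have := h2 (p + t%:C); rewrite tt => /(_ td2).
have := cabsD (f p - g (p + t%:C)) (g (p + t%:C) - g p).
rewrite addrA subrK [cabs (g _ - f p)]cabsC; lra.
Qed.

Lemma square_in_disk p r : 0 < r -> forall w, in_square p (r / 4) w -> cabs (w - p) < r.
Proof. by move=> r0 w /square_le h; apply: le_lt_trans h _; lra. Qed.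

Section disk.
Variables (f : C -> C) (p : C) (r M : R).
Hypothesis (r0 : 0 < r) (hf : holo_disk f p r).
Hypothesis (fM : forall w, cabs (w - p) < r -> cabs (f w) <= M).
Local Notation s := (r / 4).

Let s0 : 0 < s. Proof. by rewrite divr_gt0. Qed.
Let bsq w : square_bdry p s w -> cabs (w - p) < r.
Proof. by move=> /bdry_square; exact: square_in_disk. Qed.
Let hsq w : in_square p s w -> holo f w.
Proof. by move=> /(square_in_disk r0); exact: hf. Qed.
Let cb w : square_bdry p s w -> cont f w.
Proof. by move=> /bsq h; apply/holo_cont/hf. Qed.
Let fMb w : square_bdry p s w -> cabs (f w) <= M.
Proof. by move=> /bsq; exact: fM. Qed.

Let const_neq0 : square_const p s != 0.
Proof. by rewrite -cabs_gt0; apply: lt_le_trans (square_const_ge p s0). Qed.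

Lemma cauchy_formulaV z : cabs (z - p) < s / 2 ->
  f z = (square_const p s)^-1 * cauchy_int p s f 1 z.
Proof. by move=> hz; rewrite -(cauchy_formula s0 hsq hz) mulKf. Qed.

Lemma cauchy_deriv z : cabs (z - p) < s / 2 ->
  deriv_at f z ((square_const p s)^-1 * cauchy_int p s f 2 z).
Proof.
move=> hz; have rr : 0 < s / 2 - cabs (z - p) by rewrite subr_gt0.
apply: (deriv_at_local (f := fun z => (square_const p s)^-1 * cauchy_int p s f 1 z) rr).
  move=> w hw; rewrite -cauchy_formulaV//.
  have := cabsD (w - z) (z - p); rewrite addrA subrK; lra.
have := deriv_at_mul (deriv_at_cst (square_const p s)^-1 z) (cauchy_int_deriv1 s0 cb fMb hz).
by rewrite mul0r add0r.
Qed.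

Lemma holo_deriv_bounded : holo (deriv f) p.
Proof.
have hp : cabs (p - p) < s / 2 by rewrite subrr cabs0 divr_gt0.
apply: (holo_local (f := fun z => (square_const p s)^-1 * cauchy_int p s f 2 z) (r := s / 2)).
- by rewrite divr_gt0.
- by move=> w hw; rewrite (derivE (cauchy_deriv hw)).
- apply: holo_mul; first exact: holo_cst.
  by eexists; exact: (cauchy_int_deriv2 s0 cb fMb hp).
Qed.

(** Cauchy's estimate, from the difference of two Cauchy kernels. *)
Lemma cauchy_lipschitz z : cabs (z - p) < s / 2 ->
  cabs (f z - f p) <= 32 * M / r * cabs (z - p).
Proof.
move=> hz; have hp := center_near p s0.
have hr := r0.
have K : cabs (cauchy_int p s f 1 z - cauchy_int p s f 1 p) <= 128 * M / r * cabs (z - p).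
  pose k w := ((w - z) ^+ 1)^-1 * ((w - p) ^+ 1)^-1.
  have ck w : square_bdry p s w -> cont k w.
    by move=> bw; apply: cont_mul; [exact: (cont_kernel s0 1 bw hz)|exact: (cont_kernel s0 1 bw hp)].
  have -> : cauchy_int p s f 1 z - cauchy_int p s f 1 p =
      (z - p) * square_int p s (fun w => f w * k w).
    have c1 w : square_bdry p s w -> cont (fun w => f w * ((w - p) ^+ 1)^-1) w.
      by move=> bw; apply: cont_mul; [exact: cb|exact: (cont_kernel s0 1 bw hp)].
    have L1 : Re p - s <= Re p + s by lra.
    have L2 : Im p - s <= Im p + s by lra.
    rewrite -[- cauchy_int _ _ _ _ _]mulN1r /cauchy_int /square_int.
    rewrite -(rectint_scale L1 L2) -?(rectint_scale L1 L2) -?(rectint_add L1 L2)//.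
    - apply: (rectint_ext L1 L2) => w bw.
      have w1 := bdry_neq s0 bw hz; have w2 := bdry_neq s0 bw hp.
      by rewrite /k !expr1; field; rewrite w1 w2.
    - by move=> w bw; apply: cont_mul; [exact: cb|exact: (cont_kernel s0 1 bw hz)].
    - by move=> w bw; apply: cont_mul; [exact: cont_cst|exact: c1].
    - by move=> w bw; apply: cont_mul; [exact: cb|exact: ck].
  rewrite cabsM mulrC ler_wpM2r ?cabs_ge0//.
  apply: le_trans (square_int_bound s0 (M := M * (8 / r * (4 / r))) _ _) _.
  - by move=> w bw; apply: cont_mul; [exact: cb|exact: ck].
  - move=> w bw; rewrite cabsM ler_pM ?cabs_ge0 ?fMb// cabsM ler_pM ?cabs_ge0//.
      have := kernel_bound s0 1 bw hz; rewrite expr1 => /le_trans; apply.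
      by rewrite le_eqVlt; apply/orP; left; apply/eqP; field; lra.
    rewrite expr1 cabsV -(invf_div r 4) lef_pV2 ?posrE// ?divr_gt0//.
      exact: (bdry_ge s0).
    by apply: lt_le_trans (bdry_ge s0 bw).
  - by rewrite le_eqVlt; apply/orP; left; apply/eqP; field; lra.
rewrite -(ler_pM2l (x := 4))//; apply: le_trans (_ : _ <= cabs (square_const p s) * cabs (f z - f p)) _.
  by rewrite ler_wpM2r ?cabs_ge0// square_const_ge.
rewrite -cabsM mulrBr !cauchy_formula//; apply: le_trans K _.
by rewrite le_eqVlt; apply/orP; left; apply/eqP; field; lra.
Qed.

End disk.

(** [(w - p) f w] is holomorphic at [p] too, and vanishes there. Cauchy's formula
    for it, divided by [z - p], represents [f z] for [z <> p] as a Cauchy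
    integral of [f] itself, which is holomorphic at [p]. *)
Lemma removable f p r : 0 < r -> (forall w, cabs (w - p) < r -> cont f w) ->
  (forall w, cabs (w - p) < r -> w != p -> holo f w) -> holo f p.
Proof.
move=> r0 cf hf; have cfp : cont f p by apply: cf; rewrite subrr cabs0.
have [d d0 hd] := cont_bounded cfp; set M := cabs (f p) + 1 in hd.
set r' := Num.min r d; have r'0 : 0 < r' by rewrite lt_min r0 d0.
have r'r w : cabs (w - p) < r' -> cabs (w - p) < r by rewrite lt_min => /andP[].
have r'd w : cabs (w - p) < r' -> cabs (w - p) < d by rewrite lt_min => /andP[].
pose s := r' / 4; have s0 : 0 < s by rewrite divr_gt0.
pose h w := (w - p) * f w.
have hsq w : in_square p s w -> holo h w.
  move=> /(square_in_disk r'0) wr; have [->|wp] := eqVneq w p.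
    by exists (f p); apply/deriv_atP; exists f => // v; rewrite /h subrr mul0r add0r.
  apply: holo_mul; first by apply: holo_add; [exact: holo_id|exact: holo_cst].
  by apply: hf => //; exact: r'r.
have bd w : square_bdry p s w -> cabs (w - p) < r'.
  by move=> /bdry_square; exact: square_in_disk.
have cb w : square_bdry p s w -> cont f w by move=> /bd/r'r; exact: cf.
have fM w : square_bdry p s w -> cabs (f w) <= M by move=> /bd/r'd/hd/ltW.
have hp := center_near p s0.
have K0 : square_const p s != 0.
  by rewrite -cabs_gt0; apply: lt_le_trans (square_const_ge p s0).
pose G z := (square_const p s)^-1 * cauchy_int p s f 1 z.
have hG z : cabs (z - p) < s / 2 -> holo G z.
  move=> hz; apply: holo_mul; first exact: holo_cst.
  by eexists; exact: (cauchy_int_deriv1 s0 cb fM hz).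
have EG z : z != p -> cabs (z - p) < s / 2 -> f z = G z.
  move=> zp hz; have zp0 : z - p != 0 by rewrite subr_eq0.
  apply: (mulfI zp0); rewrite -/(h z) /G mulrCA; apply: (mulfI K0); rewrite mulVKf//.
  rewrite (cauchy_formula s0 hsq hz).
  have E0 : cauchy_int p s h 1 p = 0.
    by rewrite -(cauchy_formula s0 hsq hp) /h subrr mul0r mulr0.
  rewrite -[LHS]subr0 -{1}E0.
  have L1 : Re p - s <= Re p + s by lra.
  have L2 : Im p - s <= Im p + s by lra.
  have ch w : square_bdry p s w -> cont h w by move=> /bdry_square/hsq/holo_cont.
  rewrite -[- cauchy_int _ _ _ _ _]mulN1r /cauchy_int /square_int.
  rewrite -(rectint_scale L1 L2) -?(rectint_scale L1 L2) -?(rectint_add L1 L2)//.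
  - apply: (rectint_ext L1 L2) => w bw; rewrite /h.
    have w1 := bdry_neq s0 bw hz; have w2 := bdry_neq s0 bw hp.
    by rewrite !expr1; field; rewrite w1 w2.
  - by move=> w bw; apply: cont_mul; [exact: ch|exact: (cont_kernel s0 1 bw hz)].
  - move=> w bw; apply: cont_mul; first exact: cont_cst.
    by apply: cont_mul; [exact: ch|exact: (cont_kernel s0 1 bw hp)].
  - by move=> w bw; apply: cont_mul; [exact: cb|exact: (cont_kernel s0 1 bw hz)].
  - by move=> w bw; apply: cont_mul; [exact: ch|exact: (cont_kernel s0 1 bw hp)].
have s20 : 0 < s / 2 by rewrite divr_gt0.
apply: (holo_local (f := G) s20); last exact: hG.
move=> w hw; have [->|wp] := eqVneq w p; last by rewrite EG.
apply/esym; apply: cont_unique => //; first exact/holo_cont/hG.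
by exists (s / 2).
Qed.

(** If zeros accumulate at [p], the function can be divided by [w - p] any number
    of times, and the bound [cauchy_sup] on the quotients forces [f = 0]. *)
Lemma zero_isolated f p r : 0 < r -> holo_disk f p r -> f p = 0 ->
  (exists2 d : R, 0 < d & forall w, cabs (w - p) < d -> f w = 0) \/
  (exists2 d : R, 0 < d & forall w, w != p -> cabs (w - p) < d -> f w != 0).
Proof.
move=> r0 hf fp0; have [|nz] := pselect (exists2 d : R, 0 < d &
  forall w, w != p -> cabs (w - p) < d -> f w != 0); first by right.
left; have [b b0 hb] := cont_bounded (holo_cont (hf p ltac:(by rewrite subrr cabs0))).
rewrite fp0 cabs0 add0r in hb.
set q := Num.min r b; have q0 : 0 < q by rewrite lt_min r0 b0.
have qr w : cabs (w - p) < q -> cabs (w - p) < r by rewrite lt_min => /andP[].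
have qb w : cabs (w - p) < q -> cabs (w - p) < b by rewrite lt_min => /andP[].
have D n : exists2 g, holo_disk g p q & forall w, f w = (w - p) ^+ n * g w.
  elim: n => [|n [g hg fg]].
    by exists f => [w /qr|w]; [exact: hf|rewrite expr0 mul1r].
  have hgp : holo g p by apply: hg; rewrite subrr cabs0.
  have gp : g p = 0.
    apply/eqP/negPn/negP => gp0; apply: nz.
    have [d d0 hd] := cont_neq0 (holo_cont hgp) gp0; exists d => // w wp /hd h.
    rewrite fg mulf_neq0 ?expf_neq0 ?subr_eq0// -cabs_gt0.
    by apply: le_lt_trans h; rewrite divr_ge0 ?cabs_ge0.
  have [l dl] := hgp; have [k [ck kl] gk] : exists2 k, cont k p /\ k p = l &
      forall w, g w = g p + (w - p) * k w by exact/deriv_atP.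
  rewrite gp in gk.
  exists k; last by move=> w; rewrite fg gk add0r exprSr mulrA.
  have hk w : cabs (w - p) < q -> w != p -> holo k w.
    move=> wq wp; have wp0 : w - p != 0 by rewrite subr_eq0.
    apply: (holo_local (f := fun w => g w * (w - p)^-1) (r := cabs (w - p))).
    - by rewrite cabs_gt0.
    - move=> v hv; rewrite gk add0r mulrC mulKf// subr_eq0.
      by apply/negP => /eqP E; move: hv; rewrite E cabsC ltxx.
    - apply: holo_mul; first exact: hg.
      by apply: holo_inv => //; apply: holo_add; [exact: holo_id|exact: holo_cst].
  move=> w wq; have [->|wp] := eqVneq w p; last exact: hk.
  apply: (removable q0) => // v vq.
  by have [->//|vp] := eqVneq v p; exact/holo_cont/hk.
pose s := q / 4; have s0 : 0 < s by rewrite divr_gt0.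
exists (s / 2) => [|w hw]; first by rewrite divr_gt0.
apply/eqP; rewrite -cabs_eq0; apply/negPn/negP => ne.
have fw : 0 < cabs (f w) by rewrite lt0r ne cabs_ge0.
have [n hn] := small_dyadic 8 fw; have [g hg fg] := D n.
suff: cabs (f w) <= 8 / 2 ^+ n by lra.
have gM v : square_bdry p s v -> cabs (g v) <= (s ^+ n)^-1.
  move=> bv; have vs := bdry_ge s0 bv.
  have vq : cabs (v - p) < q by apply: square_in_disk => //; exact: bdry_square.
  have := hb v (qb v vq); rewrite fg cabsM cabsX => h1.
  rewrite -[leRHS]mul1r ler_pdivlMr ?exprn_gt0// mulrC; apply: le_trans (ltW h1).
  by rewrite ler_wpM2r ?cabs_ge0// lerXn2r// nnegrE ?cabs_ge0// ltW.
have gw : cabs (g w) <= 8 * (s ^+ n)^-1.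
  by apply: (cauchy_sup s0 _ gM hw) => v /(square_in_disk q0); exact: hg.
rewrite fg cabsM cabsX.
apply: (@le_trans _ _ ((s / 2) ^+ n * (8 * (s ^+ n)^-1))).
  rewrite ler_pM ?exprn_ge0 ?cabs_ge0// lerXn2r// ?nnegrE ?cabs_ge0 ?divr_ge0 ?ltW//.
have sn : s ^+ n != 0 by rewrite expf_neq0// gt_eqF.
rewrite expr_div_n le_eqVlt; apply/orP; left; apply/eqP; field.
by rewrite sn expf_neq0// pnatr_eq0.
Qed.

Lemma holo_deriv f p r : 0 < r -> holo_disk f p r -> holo (deriv f) p.
Proof.
move=> r0 hf; have [b b0 hb] := cont_bounded (holo_cont (hf p ltac:(by rewrite subrr cabs0))).
apply: (@holo_deriv_bounded f p (Num.min r b) (cabs (f p) + 1)).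
- by rewrite lt_min r0 b0.
- by move=> w; rewrite lt_min => /andP[/hf].
- by move=> w; rewrite lt_min => /andP[_ /hb/ltW].
Qed.

(** Where [f'] does not vanish this is the derivative of an inverse function. The
    zeros of [f'] are isolated because [f] is not locally constant, so at such a
    point the continuous function [g] has a removable singularity. In particular
    [f'] has in fact no zeros. *)
Lemma holo_inverse f g p r (e : R) : 0 < r -> holo_disk f (g p) r ->
  (forall x y, cabs (x - g p) < r -> cabs (y - g p) < r -> f x = f y -> x = y) ->
  0 < e -> (forall w, cabs (w - p) < e -> cont g w /\ f (g w) = w) ->
  holo g p.
Proof.
move=> r0 hf finj e0 hg.
have [cgp fgp] := hg p ltac:(by rewrite subrr cabs0).
have [d0 d00 hd0] := cgp r r0.
set d := Num.min d0 e; have d_gt0 : 0 < d by rewrite lt_min d00 e0.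
have dr w : cabs (w - p) < d -> cabs (g w - g p) < r by rewrite lt_min => /andP[/hd0].
have de w : cabs (w - p) < d -> cont g w /\ f (g w) = w.
  by rewrite lt_min => /andP[_ /hg].
have nonzero w : cabs (w - p) < d -> deriv f (g w) != 0 -> holo g w.
  move=> wd; have [cgw fgw] := de w wd.
  have dfw := holo_deriv_at (hf _ (dr w wd)); set l := deriv f (g w) in dfw * => l0.
  have [k [ck kl] fk] : exists2 k, cont k (g w) /\ k (g w) = l &
      forall x, f x = f (g w) + (x - g w) * k x by exact/deriv_atP.
  have ckg : cont (fun v => k (g v)) w by exact: cont_comp.
  have kgw : k (g w) != 0 by rewrite kl.
  have [t t0 ht] := cont_neq0 ckg kgw.
  have wt0 : 0 < Num.min t (d - cabs (w - p)) by rewrite lt_min t0 subr_gt0.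
  apply: (holo_local (f := fun v => g w + (v - w) * (k (g v))^-1) wt0) => [v|].
    rewrite lt_min => /andP[/ht kv vd].
    have kv0 : k (g v) != 0 by rewrite -cabs_gt0; apply: le_lt_trans kv; rewrite divr_ge0 ?cabs_ge0.
    have vd' : cabs (v - p) < d by have := cabsD (v - w) (w - p); rewrite addrA subrK; lra.
    have [_ fgv] := de v vd'; have := fk (g v); rewrite fgv fgw => E.
    by rewrite {1}E addrAC subrr add0r mulfK// addrC subrK.
  exists (k (g w))^-1; apply/deriv_atP; exists (fun v => (k (g v))^-1).
    by split => //; exact: cont_inv.
  by move=> v; rewrite subrr mul0r addr0.
have [z0|nz] := eqVneq (deriv f (g p)) 0; last by apply: nonzero => //; rewrite subrr cabs0.
have hd : holo_disk (deriv f) (g p) r.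
  move=> w wr; apply: (holo_deriv (r := r - cabs (w - g p))); first by rewrite subr_gt0.
  by move=> v hv; apply: hf; have := cabsD (v - w) (w - g p); rewrite addrA subrK; lra.
have [[t t0 ht]|[t t0 ht]] := zero_isolated r0 hd z0.
  exfalso; have [u u0 /andP[ut ur]] := lt_both t0 r0.
  have un : cabs (g p + u%:C - g p) = u by rewrite addrC addKr cabs_real gtr0_norm.
  set m := Num.min t r; have fc : f (g p + u%:C) = f (g p).
    apply: (@deriv0_const _ f (g p) m); last by rewrite un lt_min ut ur.
    by move=> w; rewrite lt_min => /andP[/ht wt wr]; rewrite -wt; exact/holo_deriv_at/hf.
  have := finj (g p + u%:C) (g p); rewrite un subrr cabs0 => /(_ ur r0 fc)/eqP.
  by rewrite -subr_eq0 -cabs_eq0 un gt_eqF.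
have [t' t'0 ht'] := cgp t t0.
set m := Num.min t' d; have m0 : 0 < m by rewrite lt_min t'0 d_gt0.
apply: (removable m0) => w; rewrite lt_min => /andP[wt wd]; first by case: (de w wd).
move=> wp; apply: nonzero => //; apply: ht; last exact: ht'.
apply/negP => /eqP E; move/negP: wp; apply; apply/eqP.
by case: (de w wd) => _ <-; rewrite E.
Qed.

End local.

(** * Injective functions omitting zero *)

Section logarithmic_derivative.
Variable R : realType.
Local Notation C := R[i].
Implicit Types (f u v : C -> C) (z w p : C) (r : R).

Lemma bounded_on_disk f p r : (forall z, cabs (z - p) <= r -> cont f z) ->
  exists M : R, forall z, cabs (z - p) <= r -> cabs (f z) <= M.
Proof.
move=> cf; have [r0|r0] := ltP r 0.
  by exists 0 => z hz; have := cabs_ge0 (z - p); lra.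
pose P a b c d := exists M : R, forall z, rect a b c d z -> cabs (z - p) <= r -> cabs (f z) <= M.
have [M hM] : P (Re p - r) (Re p + r) (Im p - r) (Im p + r); last first.
- exists M => z hz; apply: hM => //.
  have := cabs_Re (z - p); have := cabs_Im (z - p).
  have -> : Re (z - p) = Re z - Re p by case: (z) (p) => ? ? [].
  have -> : Im (z - p) = Im z - Im p by case: (z) (p) => ? ? [].
  by rewrite !ler_norml => /andP[? ?] /andP[? ?]; split; lra.
apply: rect_bisection; rewrite ?lerD2l; try lra.
- move=> x X y Y _ _ _ _ _ _ m n [M1 h1] [M2 h2] [M3 h3] [M4 h4].
  exists (Num.max (Num.max M1 M2) (Num.max M3 M4)) => z [/andP[z1 z2] /andP[z3 z4]] zr.
  rewrite !le_max; have [zm|zm] := leP (Re z) m; have [zn|zn] := leP (Im z) n.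
  + by rewrite h1//; split; rewrite ?z1 ?z3.
  + by rewrite h3 ?orbT//; split; rewrite ?z1 ?z4 ?(ltW zn) ?zm.
  + by rewrite h2 ?orbT//; split; rewrite ?z2 ?z3 ?(ltW zm) ?zn.
  + by rewrite h4 ?orbT//; split; rewrite ?z2 ?z4 ?(ltW zm) ?(ltW zn).
- move=> a b _ _; pose z0 := a +i* b.
  have near x X y Y (e : R) z : x <= a <= X -> y <= b <= Y -> X - x < e / 2 -> Y - y < e / 2 ->
      rect x X y Y z -> cabs (z - z0) < e.
    move=> xa yb h1 h2 hz; apply: le_lt_trans (cabs_rect (_ : rect x X y Y z0) hz) _; last lra.
    by split.
  have [hz0|hz0] := leP (cabs (z0 - p)) r.
    have [e e0 he] := cont_bounded (cf z0 hz0); exists (e / 2) => [|x X y Y _ xa _ _ yb _ h1 h2].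
      by rewrite divr_gt0.
    by exists (cabs (f z0) + 1) => z /(near _ _ _ _ _ _ xa yb h1 h2)/he/ltW.
  exists ((cabs (z0 - p) - r) / 2) => [|x X y Y _ xa _ _ yb _ h1 h2].
    by rewrite divr_gt0// subr_gt0.
  exists 0 => z /(near _ _ _ _ _ _ xa yb h1 h2) hz hp.
  by have := cabsD (z0 - z) (z - p); rewrite addrA subrK (cabsC z0 z); lra.
Qed.

Lemma cont_cabs f z : cont f z -> cont (fun w => (cabs (f w))%:C) z.
Proof.
move=> cf e e0; have [d d0 hd] := cf e e0; exists d => // w /hd; apply: le_lt_trans.
rewrite -rmorphB cabs_real ler_norml.
have := cabs_le_sub (f w) (f z); have := cabs_le_sub (f z) (f w).
by rewrite (cabsC (f z)); lra.
Qed.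

(** Otherwise [1 / (sup |f| - |f z|)] would be continuous and unbounded. *)
Lemma disk_max f p r : 0 <= r -> (forall z, cabs (z - p) <= r -> cont f z) ->
  exists2 z0, cabs (z0 - p) <= r & forall z, cabs (z - p) <= r -> cabs (f z) <= cabs (f z0).
Proof.
move=> r0 cf; have pr : cabs (p - p) <= r by rewrite subrr cabs0.
have [M hM] := bounded_on_disk cf.
pose A := [set x | exists2 z, cabs (z - p) <= r & x = cabs (f z)].
have hA : has_sup A.
  by split; [exists (cabs (f p)); exists p|exists M => _ [z hz ->]; exact: hM].
have ubA z : cabs (z - p) <= r -> cabs (f z) <= sup A.
  by move=> hz; apply: ub_le_sup; [case: hA|exists z].
apply: contrapT => no.
have lt z : cabs (z - p) <= r -> cabs (f z) < sup A.
  move=> hz; rewrite lt_neqAle ubA// andbT; apply/negP => /eqP E; apply: no.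
  by exists z => // w /ubA; rewrite E.
pose g z := ((sup A)%:C - (cabs (f z))%:C)^-1.
have gE z : cabs (z - p) <= r -> cabs (g z) = (sup A - cabs (f z))^-1.
  by move=> /lt hz; rewrite /g -rmorphB cabsV cabs_real gtr0_norm ?subr_gt0.
have [K hK] : exists K : R, forall z, cabs (z - p) <= r -> cabs (g z) <= K.
  apply: bounded_on_disk => z hz; apply: cont_inv.
    have -> : (fun w => (sup A)%:C - (cabs (f w))%:C) =
        (fun w => (sup A)%:C + (-1) * (cabs (f w))%:C).
      by apply/funext => w; rewrite mulN1r.
    apply: cont_add; first exact: cont_cst.
    by apply: cont_mul; [exact: cont_cst|apply: cont_cabs; exact: cf].
  rewrite -cabs_gt0 -rmorphB cabs_real normr_gt0 subr_eq0 gt_eqF//; exact: lt.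
have K0 : 0 < K.
  by apply: lt_le_trans (hK p pr); rewrite gE// invr_gt0 subr_gt0 lt.
have : sup A <= sup A - K^-1.
  apply: ge_sup => [|_ [z hz ->]]; first by case: hA.
  have := hK z hz; rewrite gE// => h.
  have := lt z hz; rewrite -subr_gt0 => d0.
  have : K^-1 <= sup A - cabs (f z) by rewrite -[leRHS]invrK lef_pV2 ?posrE ?invr_gt0.
  lra.
have : 0 < K^-1 by rewrite invr_gt0.
lra.
Qed.

(** Move from [z] in the direction [- f z / l]. *)
Lemma modulus_decreases f z l : deriv_at f z l -> l != 0 -> f z != 0 ->
  forall d : R, 0 < d -> exists2 w, cabs (w - z) < d & cabs (f w) < cabs (f z).
Proof.
move=> df l0 f0 d d0; have L0 : 0 < cabs l by rewrite cabs_gt0.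
have F0 : 0 < cabs (f z) by rewrite cabs_gt0.
have [e e0 he] := df (cabs l / 2) ltac:(lra).
pose k := cabs (f z) / cabs l; have k0 : 0 < k by rewrite divr_gt0.
have m0 : 0 < Num.min (Num.min d e) (k / 1) by rewrite !lt_min d0 e0 divr1.
have [x x0 /andP[]] := lt_both m0 m0; rewrite !lt_min divr1 => /andP[/andP[xd xe] xk] _.
pose t := x / k; have t0 : 0 < t by rewrite divr_gt0.
have t1 : t < 1 by rewrite ltr_pdivrMr ?mul1r.
pose w := z - t%:C * (f z / l).
have wz : w - z = - (t%:C * (f z / l)) by rewrite /w addrAC subrr add0r.
have wzx : cabs (w - z) = x.
  rewrite wz cabsN cabsM cabs_real cabsM cabsV gtr0_norm// /t -/k.
  by field; rewrite gt_eqF.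
exists w; first by rewrite wzx.
have := he w; rewrite wzx => /(_ xe).
have -> : f w - f z - (w - z) * l = f w - (1 - t)%:C * f z.
  by rewrite wz rmorphB rmorph1; field.
have h := cabs_le_sub (f w) ((1 - t)%:C * f z); move=> h2.
apply: (le_lt_trans h); apply: (le_lt_trans (lerD (lexx _) h2)).
rewrite cabsM cabs_real gtr0_norm ?subr_gt0//.
have -> : x = t * k by rewrite /t; field; rewrite gt_eqF.
have -> : cabs l / 2 * (t * k) = t * cabs (f z) / 2 by rewrite /k; field; rewrite gt_eqF.
have : 0 < t * cabs (f z) by rewrite mulr_gt0.
lra.
Qed.

Lemma curve_deriv_mul (v w : R -> C) t l m : curve_deriv v t l -> curve_deriv w t m ->
  curve_deriv (fun s => v s * w s) t (l * w t + v t * m).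
Proof.
move=> [vr vi] [wr wi]; split.
  have -> : (fun s => Re (v s * w s)) = (fun s => Re (v s) * Re (w s) - Im (v s) * Im (w s)).
    by apply/funext => s; case: (v s) (w s) => ? ? [].
  apply: is_derive_eq.
  by case: (v t) (w t) l m {vr vi wr wi} => ? ? [? ?] [? ?] [? ?] /=; rewrite /GRing.scale /=; ring.
have -> : (fun s => Im (v s * w s)) = (fun s => Re (v s) * Im (w s) + Im (v s) * Re (w s)).
  by apply/funext => s; case: (v s) (w s) => ? ? [].
apply: is_derive_eq.
by case: (v t) (w t) l m {vr vi wr wi} => ? ? [? ?] [? ?] [? ?] /=; rewrite /GRing.scale /=; ring.
Qed.

(** The period of the exponential survives a small perturbation: [v] returns
    close to [v 0] at [c = 2 i pi], and around [c] it is so close to the affine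
    map [v c * (1 + (z - c))] that the minimum of [|v - v 0|] on a small disk is
    attained inside, hence is 0 as [v'] has no zeros. *)
Lemma almost_exp v (e : C -> C) :
  (forall z, cabs z < 9 -> deriv_at v z (v z * (1 + e z))) ->
  (forall z, cabs z < 9 -> cabs (e z) <= 1 / 1000) ->
  (forall z, cabs z < 9 -> v z != 0) ->
  exists z, [/\ z != 0, cabs z < 9 & v z = v 0].
Proof.
move=> dv he v0; pose c : C := 0 +i* (2 * pi).
have pi2 := pi_ge2 R; have pi4 := pihalf_lt2 R.
have cE : cabs c = 2 * pi.
  by rewrite /cabs /c /= expr0n add0r sqrtr_sqr ger0_norm// mulr_ge0// pi_ge0.
pose E (t : R) : C := cos (2 * pi * t) -i* sin (2 * pi * t).
have dE t : curve_deriv E t (- c * E t).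
  have d2 : is_derive t (1 : R) (fun s => 2 * pi * s) (2 * pi).
    by apply: is_derive_eq; rewrite /GRing.scale /= mulr1.
  split; [have := is_derive1_comp (is_derive_cos (2 * pi * t)) d2|
          have := is_deriveN (is_derive1_comp (is_derive_sin (2 * pi * t)) d2)];
    by congr is_derive; rewrite /=; ring.
have nE t : cabs (E t) = 1.
  by rewrite /cabs /E /= sqrrN cos2Dsin2 sqrtr1.
(* v(t c) exp(- t c) is nearly constant *)
have step1 : cabs (v c - v 0) <= 16 / 1000 * cabs (v 0).
  pose w t := v (0 + t%:C * c) * E t.
  have tc t : 0 <= t <= 1 -> cabs (0 + t%:C * c) < 9.
    move=> /andP[t0 t1]; rewrite add0r cabsM cabs_real ger0_norm// cE.
    by apply: le_lt_trans (_ : _ <= 2 * pi) _; [rewrite ler_piMl; lra|lra].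
  have := @gronwall R w (fun t => e (0 + t%:C * c) * c * w t) (8 / 1000).
  have w0 : w 0 = v 0.
    by rewrite /w /E rmorph0 mul0r addr0 mulr0 cos0 sin0 oppr0 -[LHS]/(_ * 1) mulr1.
  have w1 : w 1 = v c.
    by rewrite /w /E rmorph1 mul1r add0r mulr1 mulr_natl cos2pi sin2pi oppr0 -[LHS]/(_ * 1) mulr1.
  have -> : 2 * (8 / 1000) = 16 / 1000 :> R by field.
  rewrite -w0 -w1; apply; rewrite ?lexx ?ler01//; first lra.
    move=> t /tc ht; have := curve_deriv_mul (curve_deriv_line (dv _ ht)) (dE t).
    by congr curve_deriv; rewrite /w; ring.
  move=> t /tc ht; rewrite cabsM ler_wpM2r ?cabs_ge0// cabsM cE.
  by have := he _ ht; have := cabs_ge0 (e (0 + t%:C * c)); nra.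
have disk z : cabs (z - c) <= 1 / 8 -> cabs z < 9.
  by move=> hz; have := cabs_le_sub z c; rewrite cE; lra.
have vc0 : 0 < cabs (v c) by rewrite cabs_gt0 v0// cE; lra.
have v00 : cabs (v 0) <= cabs (v c) * (102 / 100).
  by have := cabs_le_sub (v 0) (v c); rewrite (cabsC (v 0) (v c)); lra.
have step2 z : cabs (z - c) <= 1 / 8 -> cabs (v z - v c) <= 26 / 100 * cabs (v c).
  move=> hz; pose w t := v (c + t%:C * (z - c)).
  have tc t : 0 <= t <= 1 -> cabs (c + t%:C * (z - c)) < 9.
    move=> /andP[t0 t1]; apply: disk; rewrite addrAC subrr add0r cabsM cabs_real ger0_norm//.
    by apply: le_trans hz; rewrite ler_piMl// cabs_ge0.
  have := @gronwall R w (fun t => w t * (1 + e (c + t%:C * (z - c))) * (z - c)) (13 / 100).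
  have w0 : w 0 = v c by rewrite /w rmorph0 mul0r addr0.
  have w1 : w 1 = v z by rewrite /w rmorph1 mul1r addrC subrK.
  have -> : 2 * (13 / 100) = 26 / 100 :> R by field.
  rewrite -w0 -w1; apply; rewrite ?lexx ?ler01//; first lra.
    by move=> t /tc ht; apply: curve_deriv_line; exact: dv.
  move=> t /tc ht; rewrite mulrAC -mulrA mulrC cabsM ler_wpM2r ?cabs_ge0// mulrC cabsM.
  have h1 := cabsD 1 (e (c + t%:C * (z - c))); rewrite cabs1 in h1.
  have h2 := he _ ht; have h3 := cabs_ge0 (1 + e (c + t%:C * (z - c))).
  have h4 := cabs_ge0 (z - c).
  apply: (@le_trans _ _ ((1001 / 1000) * (1 / 8))); last lra.
  by rewrite ler_pM//; lra.
have step3 z : cabs (z - c) <= 1 / 8 ->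
    cabs (v z - v c - v c * (z - c)) <= 27 / 100 * cabs (v c) * cabs (z - c).
  move=> hz; pose g x := v x + (- v c) * x.
  have -> : v z - v c - v c * (z - c) = g z - g c by rewrite /g; ring.
  have tc t : 0 <= t <= 1 -> cabs (c + t%:C * (z - c) - c) <= 1 / 8.
    move=> /andP[t0 t1]; rewrite addrAC subrr add0r cabsM cabs_real ger0_norm//.
    by apply: le_trans hz; rewrite ler_piMl// cabs_ge0.
  apply: (mean_value_segment (l := fun t => v (c + t%:C * (z - c)) * (1 + e (c + t%:C * (z - c))) - v c)).
    move=> t /tc/disk ht; have := deriv_at_add (dv _ ht)
      (deriv_at_mul (deriv_at_cst (- v c) (c + t%:C * (z - c))) (deriv_at_id _)).
    by rewrite mul0r add0r mulr1.
  move=> t /tc ht; set x := c + t%:C * (z - c) in ht *.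
  have -> : v x * (1 + e x) - v c = (v x - v c) + (v x - v c) * e x + v c * e x by ring.
  have h1 := step2 x ht; have h2 := he x (disk x ht).
  have h3 := cabsD (v x - v c + (v x - v c) * e x) (v c * e x).
  have h4 := cabsD (v x - v c) ((v x - v c) * e x).
  rewrite !cabsM in h3 h4.
  have h5 : cabs (v x - v c) * cabs (e x) <= (26 / 100 * cabs (v c)) * (1 / 1000).
    by rewrite ler_pM ?cabs_ge0.
  have h6 : cabs (v c) * cabs (e x) <= cabs (v c) * (1 / 1000) by rewrite ler_wpM2l// ltW.
  lra.
apply: contrapT => no.
have ne z : cabs (z - c) <= 1 / 8 -> v z - v 0 != 0.
  move=> hz; rewrite subr_eq0; apply/negP => /eqP E1; apply: no; exists z; split => //.
    apply/negP => /eqP z0; move: hz; rewrite z0 sub0r cabsN cE; lra.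
  exact: disk.
have dvc z : cabs z < 9 -> deriv_at (fun z => v z - v 0) z (v z * (1 + e z)).
  by move=> /dv h; have := deriv_at_add h (deriv_at_cst (- v 0) z); rewrite addr0.
have [z hz zmax] : exists2 z, cabs (z - c) <= 1 / 8 & forall x, cabs (x - c) <= 1 / 8 ->
    cabs (v x - v 0)^-1 <= cabs (v z - v 0)^-1.
  apply: (@disk_max (fun x => (v x - v 0)^-1) c (1 / 8)); first lra.
  move=> x hx; apply: cont_inv; last exact: ne.
  exact: deriv_at_cont (dvc x (disk x hx)).
have zmin x : cabs (x - c) <= 1 / 8 -> cabs (v z - v 0) <= cabs (v x - v 0).
  move=> hx; have := zmax x hx; rewrite !cabsV lef_pV2// posrE cabs_gt0; exact: ne.
have zc := zmin c ltac:(by rewrite subrr cabs0; lra).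
have far : cabs (v z - v c) <= 4 / 100 * cabs (v c).
  have := cabsD (v z - v 0) (v 0 - v c); rewrite addrA subrK (cabsC (v 0) (v c)); lra.
have zint : cabs (z - c) < 1 / 8.
  have h1 := step3 z hz; have := cabs_le_sub (v c * (z - c)) (v z - v c).
  rewrite (cabsC (v z - v c)) in h1; rewrite cabsM => h2.
  have h3 : cabs (v c) * cabs (z - c) <= cabs (v c) * (4 / 100 + 27 / 100 * cabs (z - c)) by lra.
  rewrite ler_pM2l// in h3; lra.
have l0 : v z * (1 + e z) != 0.
  rewrite mulf_neq0 ?v0 ?disk// -cabs_gt0.
  have := cabs_le_sub 1 (- e z); rewrite cabs1 cabsN opprK; have := he z (disk z hz); lra.
have gap : 0 < 1 / 8 - cabs (z - c) by rewrite subr_gt0.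
have [w wz] := modulus_decreases (dvc z (disk z hz)) l0 (ne z hz) gap.
by rewrite ltNge zmin//; have := cabsD (w - z) (z - c); rewrite addrA subrK; lra.
Qed.

(** The factor 1200 * 1000 exceeds 128 * 9 * 1000, where 128 comes from Cauchy's
    estimate, and 9 and 1000 from [almost_exp]; the other factor 2 is the ratio
    of [r] to the radius of the disk on which the maximum is taken. *)
Definition log_bound : R := 2400 * 1000.

Lemma log_bound_gt0 : 0 < log_bound.
Proof. by rewrite /log_bound; lra. Qed.

(** Bloch's argument, applied to the logarithm of [u]. Let [q = u' / u] and let
    [z] maximize [|q z|] times the distance [a] to a circle around [p]. Then
    [|q| <= 2 |q z|] on the disk of radius [a / 2] around [z], so that by
    Cauchy's estimate [q] is nearly constant at the scale [1 / |q z|] if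
    [|q z| a] is large. At this scale [u] is almost an exponential, hence is not
    injective. *)
Lemma log_deriv_bound u p r : 0 < r -> holo_disk u p r ->
  (forall z, cabs (z - p) < r -> u z != 0) ->
  (forall z w, cabs (z - p) < r -> cabs (w - p) < r -> u z = u w -> z = w) ->
  cabs (deriv u p) * r <= log_bound * cabs (u p).
Proof.
move=> r0 hu u0 uinj.
have tri (x y q : C) : cabs (x - q) <= cabs (x - y) + cabs (y - q).
  by have := cabsD (x - y) (y - q); rewrite addrA subrK.
pose q (z : C) : C := deriv u z * (u z)^-1.
have hq z : cabs (z - p) < r -> holo q z.
  move=> hz; apply: holo_mul; last by apply: holo_inv; [exact: hu|exact: u0].
  apply: (holo_deriv (r := r - cabs (z - p))); first by rewrite subr_gt0.
  by move=> w hw; apply: hu; have := tri w z p; lra.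
have pr : cabs (p - p) < r by rewrite subrr cabs0.
rewrite leNgt; apply/negP => big.
have qp : log_bound < cabs (q p) * r.
  have up : 0 < cabs (u p) by rewrite cabs_gt0 u0.
  by rewrite /q cabsM cabsV mulrAC ltr_pdivlMr.
pose F (z : C) : C := q z * (r / 2 - cabs (z - p))%:C.
have r20 : 0 <= r / 2 by lra.
have [z hz zmax] : exists2 z, cabs (z - p) <= r / 2 &
    forall w, cabs (w - p) <= r / 2 -> cabs (F w) <= cabs (F z).
  apply: (disk_max r20) => z hz; apply: cont_mul; first by apply/holo_cont/hq; lra.
  have -> : (fun w => (r / 2 - cabs (w - p))%:C) =
      (fun w => (r / 2)%:C + (-1) * (cabs (w - p))%:C).
    by apply/funext => w; rewrite rmorphB mulN1r.
  apply: cont_add; first exact: cont_cst.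
  apply: cont_mul; first exact: cont_cst.
  by apply: (cont_cabs (f := fun w => w - p)); apply: cont_add; [exact: cont_id|exact: cont_cst].
have FE w : cabs (w - p) <= r / 2 -> cabs (F w) = cabs (q w) * (r / 2 - cabs (w - p)).
  by move=> hw; rewrite cabsM cabs_real ger0_norm// subr_ge0.
set a := r / 2 - cabs (z - p).
have az : 1200 * 1000 < cabs (q z) * a.
  rewrite -FE//; apply: lt_le_trans (zmax p _); last by rewrite subrr cabs0; lra.
  by rewrite FE subrr cabs0//; move: qp; rewrite /log_bound; lra.
have a0 : 0 < a.
  by rewrite lt0r subr_ge0 hz andbT; apply/negP => /eqP E; move: az; rewrite E mulr0; lra.
have qz0 : 0 < cabs (q z) by rewrite -(pmulr_lgt0 _ a0); lra.
have qz : q z != 0 by rewrite -cabs_gt0.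
have a20 : 0 < a / 2 by rewrite divr_gt0.
have inr w : cabs (w - z) < a / 2 -> cabs (w - p) < r.
  by move=> hw; have := tri w z p; rewrite /a in hw a0 *; lra.
have qM w : cabs (w - z) < a / 2 -> cabs (q w) <= 2 * cabs (q z).
  move=> hw; have wp : cabs (w - p) <= r / 2 - a / 2.
    by have := tri w z p; rewrite /a in hw *; lra.
  have := zmax w ltac:(lra); rewrite !FE//; last lra.
  rewrite -/a => h; rewrite -(ler_pM2r a20); apply: le_trans (_ : _ <= cabs (q z) * a) _; last lra.
  by apply: le_trans h; rewrite ler_wpM2l ?cabs_ge0//; lra.
have hqz : holo_disk q z (a / 2) by move=> w /inr; exact: hq.
have small (x : C) : cabs x < 9 -> cabs (x / q z) < 9 / cabs (q z).
  by move=> hx; rewrite cabsM cabsV ltr_pM2r// invr_gt0.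
(* Chosen so that 9 * N < 1200000 and 128 / N <= 1 / 1000. *)
have [N hN] : exists N : R, N = 133 * 1000 by eexists.
have N0 : 0 < N by lra.
have qa : 9 / cabs (q z) <= a / N.
  by rewrite ler_pdivrMr// mulrAC ler_pdivlMr//; lra.
have aN : a / N <= a / 100.
  by rewrite ler_wpM2l ?(ltW a0)// lef_pV2 ?posrE//; lra.
have near x : cabs x < 9 -> cabs (z + x / q z - z) < a / 2.
  by move=> /small hx; rewrite addrAC subrr add0r; lra.
have [x [x0 x9 xE]] : exists x, [/\ x != 0, cabs x < 9 & u (z + x / q z) = u (z + 0 / q z)].
  apply: (@almost_exp (fun x => u (z + x / q z)) (fun x => q (z + x / q z) / q z - 1)).
  - move=> x /near hx.
    have dx : deriv_at (fun x => z + x / q z) x (q z)^-1.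
      have := deriv_at_add (deriv_at_cst z x) (deriv_at_mul (deriv_at_id x) (deriv_at_cst (q z)^-1 x)).
      by rewrite mulr0 addr0 mul1r add0r.
    have := deriv_at_comp dx (holo_deriv_at (hu _ (inr _ hx))).
    have du : deriv u (z + x / q z) = q (z + x / q z) * u (z + x / q z).
      by rewrite /q mulfVK// u0//; exact: inr.
    by rewrite du; congr deriv_at; field.
  - move=> x hx; have h1 := near x hx; have h2 := small x hx.
    have h3 : cabs (z + x / q z - z) < a / 2 / 4 / 2.
      by rewrite addrAC subrr add0r; lra.
    have := cauchy_lipschitz a20 hqz qM h3; rewrite (_ : z + _ - z = x / q z); last by ring.
    move=> h4; have -> : q (z + x / q z) / q z - 1 = (q (z + x / q z) - q z) / q z.
      by field.
    rewrite cabsM cabsV ler_pdivrMr//; apply: (le_trans h4).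
    have -> : 32 * (2 * cabs (q z)) / (a / 2) * cabs (x / q z) =
        128 * cabs (q z) * (cabs (x / q z) / a) by field; rewrite gt_eqF.
    have : cabs (x / q z) / a <= N^-1.
      by rewrite ler_pdivrMr// (mulrC N^-1) ltW// (lt_le_trans h2).
    have N128 : 128 * N^-1 <= 1 / 1000 by rewrite ler_pdivrMr//; lra.
    move=> h5; apply: (@le_trans _ _ (128 * cabs (q z) * N^-1)).
      by rewrite ler_wpM2l// mulr_ge0// ltW.
    by rewrite mulrAC ler_wpM2r// ltW.
  - by move=> x /near/inr; exact: u0.
have c0 : cabs (0 : C) < 9 by rewrite cabs0.
have := uinj _ _ (inr _ (near x x9)) (inr _ (near 0 c0)) xE.
move/addrI/(mulIf (invr_neq0 qz)) => E; by rewrite E eqxx in x0.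
Qed.

(** In hyperbolic terms: the points [it] and [it + d] approach each other, and
    therefore so do the logarithms of their images. *)
Lemma ratio_bound u (d : C) t : cabs d = 1 -> Im d = 0 -> 2 * log_bound <= t ->
  (forall z, 0 < Im z -> holo u z) -> (forall z, 0 < Im z -> u z != 0) ->
  (forall z w, 0 < Im z -> 0 < Im w -> u z = u w -> z = w) ->
  cabs (u (0 +i* t + d) - u (0 +i* t)) <= 2 * log_bound / t * cabs (u (0 +i* t)).
Proof.
move=> d1 dI ht hu u0 uinj; have L0 := log_bound_gt0.
have t0 : 0 < t by lra.
pose p s : C := 0 +i* t + s%:C * d.
have pI s : Im (p s) = t by rewrite /p; case: (d) dI => x y /= ->; ring.
have near s z : cabs (z - p s) < t -> 0 < Im z.
  move=> h; have := cabs_Im (z - p s).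
  have -> : Im (z - p s) = Im z - t by rewrite -(pI s); case: (z) (p s) => ? ? [].
  by rewrite ler_norml => /andP[]; lra.
have lb s : cabs (deriv u (p s) * d) <= log_bound / t * cabs (u (p s)).
  rewrite cabsM d1 mulr1 -(ler_pM2r t0) [leRHS]mulrAC divfK ?gt_eqF//.
  apply: (log_deriv_bound t0).
  - by move=> z /near; exact: hu.
  - by move=> z /near; exact: u0.
  - by move=> z w /near hz /near; exact: uinj.
have := @gronwall R (fun s => u (p s)) (fun s => deriv u (p s) * d) (log_bound / t).
have -> : p 0 = 0 +i* t by rewrite /p rmorph0 mul0r addr0.
have p1 : p 1 = 0 +i* t + d by rewrite /p rmorph1 mul1r.
rewrite -p1 mulrA; apply; rewrite ?ler01 ?lexx//.
- rewrite divr_ge0 ?(ltW t0) ?(ltW L0)//= ler_pdivrMr//; lra.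
- move=> s _; apply: curve_deriv_line; apply: holo_deriv_at; apply: hu.
  by rewrite -/(p s) pI.
Qed.

End logarithmic_derivative.

(** * The coordinate 1 / (Z - 1) on the sphere punctured at 1 *)

Section chart.
Variable R : realType.
Local Notation C := R[i].
Local Notation S := (sphere R).
Implicit Types (z w x y : C) (Z W : S).

Lemma nbhs_disk z (U : set C) :
  nbhs z U <-> exists2 d : R, 0 < d & forall w, cabs (w - z) < d -> U w.
Proof.
split=> [/nbhs_ballP[e /= e0 h]|[d d0 h]].
  have [d d0 de] := (pos_complexP e).1 e0; exists d => // w wd; apply: h.
  by rewrite -ball_normE /= normr_cabs de ltcR cabsC.
apply/nbhs_ballP; exists d%:C => /=; first by rewrite ltcR.
by move=> w; rewrite -ball_normE /= normr_cabs ltcR cabsC; exact: h.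
Qed.

Lemma nbhs_pt z (U : set S) :
  nbhs (pt z) U <-> exists2 d : R, 0 < d & forall w, cabs (w - z) < d -> U (pt w).
Proof. exact: nbhs_disk. Qed.

Lemma compact_cabs_bounded (W : set C) : compact W ->
  exists B : R, forall z, W z -> cabs z <= B.
Proof.
move=> cW.
have cc : {within W, continuous (@cabs R)}.
  apply: continuous_subspaceT => z U /nbhs_ballP[e /= e0 hU].
  apply/nbhs_disk; exists e => // w hw; apply: hU; rewrite -ball_normE /= ltr_norml.
  have := cabs_le_sub w z; have := cabs_le_sub z w; rewrite (cabsC z w); lra.
have [B [_ hB]] := compact_bounded (continuous_compact cc cW).
exists (B + 1) => z Wz; apply: le_trans (ler_norm _) _.
by apply: (hB (B + 1)); [rewrite ltrDl|exists z].
Qed.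

Lemma compact_square (B : R) : compact [set z : C | `|Re z| <= B /\ `|Im z| <= B].
Proof.
have -> : [set z : C | `|Re z| <= B /\ `|Im z| <= B] =
    (fun q : R * R => q.1 +i* q.2 : C) @` (`[- B, B] `*` `[- B, B]).
  apply/seteqP; split=> [[x y] [/= hx hy]|_ [[x y] [/= hx hy] <-]].
    by exists (x, y) => //; rewrite /= !in_itv /= -!ler_norml.
  by move: hx hy; rewrite /= !in_itv /= -!ler_norml.
apply: continuous_compact; last by apply: compact_setX; exact: segment_compact.
apply: continuous_subspaceT => -[x y] U /nbhs_disk[d d0 h].
exists (ball x (d / 2), ball y (d / 2)) => /=.
  by split; apply: nbhsx_ballx; rewrite divr_gt0.
move=> [x' y'] [/= hx hy]; apply: h; apply: le_lt_trans (cabs_ReIm _) _.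
by rewrite /= [d in X in _ < X]splitr ltrD// distrC.
Qed.

Lemma closed_square (B : R) : closed [set z : C | `|Re z| <= B /\ `|Im z| <= B].
Proof.
rewrite -openC openE => z /= /not_andP h; apply/nbhs_disk.
have lo (u : R) : ~ (`|u| <= B) -> exists2 d : R, 0 < d & forall v, `|v - u| < d -> ~ (`|v| <= B).
  move=> /negP; rewrite -ltNge => hu; exists (`|u| - B); first by rewrite subr_gt0.
  by move=> t ht tB; have := ler_distD t u 0; rewrite !subr0 (distrC u); lra.
case: h => h; have [d d0 hd] := lo _ h; exists d => // w hw [re im].
- apply: (hd (Re w)) re; apply: le_lt_trans hw.
  by have := cabs_Re (w - z); case: (w) (z) => ? ? [].
- apply: (hd (Im w)) im; apply: le_lt_trans hw.
  by have := cabs_Im (w - z); case: (w) (z) => ? ? [].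
Qed.

(** The coordinate that sends [Z = 1] to infinity: in it, [J] is the affine map
    [x |-> J_shift - x] and [Cov] is the zero set of [cov_poly]. *)
Definition coord Z : C := if Z is Some z then (z - 1)^-1 else 0.
Definition coord_inv x : S := if x == 0 then infty R else pt (1 + x^-1).

Lemma coord_invK x : coord (coord_inv x) = x.
Proof.
rewrite /coord_inv; case: eqVneq => [->//|x0].
by rewrite /coord /= addrAC subrr add0r invrK.
Qed.

Lemma coordK Z : Z <> pt 1 -> coord_inv (coord Z) = Z.
Proof.
case: Z => [z|] Z1; rewrite /coord_inv /coord /=; last by rewrite eqxx.
have z1 : z - 1 != 0 by rewrite subr_eq0; apply/eqP => E; apply: Z1; rewrite E.
by rewrite invr_eq0 (negbTE z1) invrK addrC subrK.
Qed.

Lemma coord_inv_neq1 x : coord_inv x <> pt 1.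
Proof.
rewrite /coord_inv; case: eqVneq => // x0 [] /eqP.
by rewrite -subr_eq0 addrAC subrr add0r invr_eq0 (negbTE x0).
Qed.

(** At [x = 0], a compact set avoiding [infty] is bounded. *)
Lemma coord_inv_cont x (U : set S) : nbhs (coord_inv x) U ->
  exists2 d : R, 0 < d & forall y, cabs (y - x) < d -> U (coord_inv y).
Proof.
have [->|x0] := eqVneq x 0; last first.
  rewrite {1}/coord_inv (negbTE x0) => /nbhs_pt[e e0 he].
  have ci : cont (fun y => 1 + y^-1) x.
    apply: cont_add; first exact: cont_cst.
    by apply: cont_inv => //; exact: cont_id.
  have [d d0 hd] := ci e e0; have [b b0 hb] := cont_neq0 (@cont_id _ x) x0.
  exists (Num.min d b) => [|y]; first by rewrite lt_min d0 b0.
  rewrite lt_min => /andP[/hd/he yU /hb yx].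
  have y0 : y != 0 by rewrite -cabs_gt0; apply: le_lt_trans yx; rewrite divr_ge0 ?cabs_ge0.
  by rewrite /coord_inv (negbTE y0).
rewrite {1}/coord_inv eqxx => -[W [cW _] WU].
have [B hB] := compact_cabs_bounded cW.
have K0 : 0 < `|B| + 2 by have := normr_ge0 B; lra.
exists (`|B| + 2)^-1 => [|y]; first by rewrite invr_gt0.
rewrite subr0 /coord_inv; case: eqVneq => [_ _|y0 hy]; apply: WU; first by right.
left; exists (1 + y^-1) => // Wy; have := hB _ Wy.
have := cabs_le_sub y^-1 (1 + y^-1).
rewrite (_ : y^-1 - (1 + y^-1) = -1); last by ring.
rewrite cabsN cabs1 cabsV.
have : `|B| + 2 < (cabs y)^-1.
  by rewrite -[ltLHS]invrK ltf_pV2// posrE ?invr_gt0// cabs_gt0.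
have := ler_norm B; lra.
Qed.

Lemma coord_cont Z : Z <> pt 1 -> forall e : R, 0 < e ->
  nbhs Z [set W | W <> pt 1 /\ cabs (coord W - coord Z) < e].
Proof.
case: Z => [z|] Z1 e e0.
  have z1 : z - 1 != 0 by rewrite subr_eq0; apply/eqP => E; apply: Z1; rewrite E.
  have cz : cont (fun w => w - 1) z by apply: cont_add; [exact: cont_id|exact: cont_cst].
  have [b b0 hb] := cont_neq0 cz z1; have [d d0 hd] := cont_inv cz z1 e0.
  apply/nbhs_pt; exists (Num.min d b) => [|y]; first by rewrite lt_min d0 b0.
  rewrite lt_min => /andP[/hd yU /hb yx]; split => // -[y1].
  move: yx; rewrite y1 subrr cabs0; have := cabs_ge0 (z - 1); lra.
pose B := e^-1 + 2; have ei : 0 < e^-1 by rewrite invr_gt0.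
exists [set z : C | `|Re z| <= B /\ `|Im z| <= B].
  by split; [exact: compact_square|exact: closed_square].
have far z : ~ (`|Re z| <= B /\ `|Im z| <= B) -> B < cabs z.
  move=> h; rewrite ltNge; apply/negP => zB; apply: h.
  by split; apply: le_trans zB; [exact: cabs_Re|exact: cabs_Im].
move=> W [[z /= /far zB <-]|->]; last by split => //; rewrite subrr; move: e0; rewrite -{1}(cabs0 R).
have h := cabs_le_sub z 1; rewrite cabs1 in h.
have h1 : e^-1 < cabs (z - 1) by rewrite /B in zB; lra.
split; first by case=> z1; move: h1; rewrite z1 subrr cabs0; lra.
by rewrite /= subr0 cabsV -[ltRHS]invrK ltf_pV2// posrE// (lt_trans ei).
Qed.

Lemma derivable_holo (f : C -> C) z : derivable f z (1 : C) -> holo f z.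
Proof.
move=> /cvg_ex[l0 hl]; pose l : C := l0; exists l => e e0.
have hU : nbhs l [set x : C | cabs (x - l) < e] by apply/nbhs_disk; exists e.
have /nbhs_disk[d d0 hd] : nbhs (0 : C) [set h : C | h != 0 ->
  cabs (h^-1 * (f (h * 1 + z) - f z) - l) < e] := hl _ hU.
exists d => // w hw; have [->|wz] := eqVneq w z.
  by rewrite !subrr mul0r subr0 cabs0 mulr0.
have wz0 : w - z != 0 by rewrite subr_eq0.
have := hd (w - z); rewrite /= subr0 => /(_ hw wz0).
rewrite mulr1 subrK => /ltW h; rewrite -ler_pdivrMr ?cabs_gt0// -cabsV -cabsM.
have -> : (f w - f z - (w - z) * l) * (w - z)^-1 = (w - z)^-1 * (f w - f z) - l.
  by field.
exact: h.
Qed.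

End chart.

(** * The correspondence in the coordinate 1 / (Z - 1) *)

Section dynamics.
Variable R : realType.
Local Notation C := R[i].
Local Notation S := (sphere R).
Variables (a : C) (a1 : a != 1).
Implicit Types (z w x y : C) (Z W V : S).

(** The equation of [Cov] at [1 + 1/x] and [1 + 1/y], times [x^2 y^2]. *)
Definition cov_poly x y : C := 3 * x * y * (x + y) + x ^+ 2 + x * y + y ^+ 2.

Definition J_shift : C := 2 / (a - 1).

Let a10 : a - 1 != 0. Proof. by rewrite subr_eq0. Qed.

Lemma Cov_coord x y : Cov (coord_inv x) (coord_inv y) <-> cov_poly x y = 0.
Proof.
rewrite /coord_inv /Cov /cov_poly; case: eqVneq => [->|x0]; case: eqVneq => [->|y0] /=.
- by split=> // _; ring.
- split=> // /eqP; rewrite (_ : _ + _ = y ^+ 2); last by ring.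
  by rewrite expf_eq0 /= (negbTE y0).
- split=> // /eqP; rewrite (_ : _ + _ = x ^+ 2); last by ring.
  by rewrite expf_eq0 /= (negbTE x0).
- have -> : 3 * x * y * (x + y) + x ^+ 2 + x * y + y ^+ 2 = x ^+ 2 * y ^+ 2 *
    ((1 + x^-1) ^+ 2 + (1 + x^-1) * (1 + y^-1) + (1 + y^-1) ^+ 2 - 3).
    by field; rewrite x0 y0.
  split=> [->|/eqP]; first by rewrite subrr mulr0.
  have xy : x ^+ 2 * y ^+ 2 != 0 by rewrite mulf_neq0 ?expf_neq0.
  by rewrite mulf_eq0 (negbTE xy) /= subr_eq0 => /eqP.
Qed.

Lemma Cov_coord1 x : Cov (coord_inv x) (pt 1) -> 3 * x + 1 = 0.
Proof.
rewrite /coord_inv /Cov; case: eqVneq => // x0 /= h.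
have : x ^+ 2 * ((1 + x^-1) ^+ 2 + (1 + x^-1) * 1 + 1 ^+ 2 - 3) = 0 by rewrite h subrr mulr0.
by rewrite (_ : _ * _ = 3 * x + 1)//; field.
Qed.

Lemma J1 : J a (pt 1) = pt 1.
Proof.
rewrite /J /pt; have -> : 2 * 1 - (a + 1) = - (a - 1) by ring.
rewrite oppr_eq0 (negbTE a10); congr Some.
have -> : (a + 1) * 1 - 2 * a = - (a - 1) by ring.
by rewrite divff// oppr_eq0.
Qed.

Lemma J_coord x : J a (coord_inv x) = coord_inv (J_shift - x).
Proof.
rewrite /coord_inv /J_shift; case: eqVneq => [->|x0] /=.
  have k0 : 2 / (a - 1) - 0 != 0.
    by rewrite subr0 mulf_neq0 ?invr_eq0// pnatr_eq0.
  rewrite (negbTE k0) /pt; congr Some; field.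
  exact: a10.
have -> : 2 * (1 + x^-1) - (a + 1) = (a - 1) * (2 / (a - 1) - x) * x^-1.
  by field; rewrite x0 a10.
rewrite !mulf_eq0 (negbTE a10) /= invr_eq0 (negbTE x0) orbF.
case: eqVneq => // y0; rewrite /pt; congr Some; field.
have y0' : 2 - x * (a - 1) != 0.
  apply: contra_neq y0 => h; apply: (mulIf a10); rewrite mul0r mulrBl mulfVK//.
by rewrite ?x0 ?a10 ?y0'; rewrite // ?andbT; apply: contra_neq y0' => <-; ring.
Qed.

Lemma J_invol Z : J a (J a Z) = Z.
Proof.
have [->|Z1] := pselect (Z = pt 1); first by rewrite !J1.
by rewrite -(coordK Z1) !J_coord; congr coord_inv; ring.
Qed.

Lemma F_coord x y : F a (coord_inv x) (coord_inv y) <-> cov_poly x (J_shift - y) = 0.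
Proof.
split=> [[V cV E]|h].
  have VE : V = coord_inv (J_shift - y) by rewrite -J_coord E J_invol.
  by move: cV; rewrite VE => /Cov_coord.
exists (coord_inv (J_shift - y)); first exact/Cov_coord.
by rewrite J_coord; congr coord_inv; ring.
Qed.

(** Openness in terms of the real-valued modulus. *)
Definition is_open (A : set C) :=
  forall x, A x -> exists2 d : R, 0 < d & forall w, cabs (w - x) < d -> A w.

Section limit_set.
Variables (D : set S) (oD : open D) (D1 : ~ D (pt 1)).

Local Notation L n := (iter n (corr_preimage (F a)) (~` D)).

(** [Z = 1] is related to itself. *)
Lemma one_in_iter n : L n (pt 1).
Proof.
elim: n => [|n IH] //=; exists (pt 1) => //; exists (pt 1); last by rewrite J1.
by rewrite /Cov /=; ring.
Qed.

(** Continuity of the two roots of the quadratic equation [cov_poly x y = 0],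
    away from the zero [x = -1/3] of its leading coefficient; this is the only
    point other than [Z = 1] that [Cov] relates to [Z = 1]. *)
Lemma roots_near x : 3 * x + 1 != 0 -> exists y1 y2,
  [/\ cov_poly x y1 = 0, cov_poly x y2 = 0 &
    forall e : R, 0 < e -> exists2 d : R, 0 < d & forall x' y', cabs (x' - x) < d ->
      cov_poly x' y' = 0 -> cabs (y' - y1) < e \/ cabs (y' - y2) < e].
Proof.
move=> x1; pose m x : C := x ^+ 2 * (3 * x + 1)^-1.
pose s : C := sqrtc (x ^+ 2 - 4 * m x).
have s2 : s ^+ 2 = x ^+ 2 - 4 * m x by exact: sqr_sqrtc.
pose y1 := (- x + s) / 2; pose y2 := (- x - s) / 2.
have two0 : 2 != 0 :> C by rewrite pnatr_eq0.
have polyE z w : 3 * z + 1 != 0 -> cov_poly z w = (3 * z + 1) * (w ^+ 2 + z * w + m z).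
  by move=> z1; rewrite /cov_poly /m; field.
have fac w : w ^+ 2 + x * w + m x = (w - y1) * (w - y2).
  have -> : m x = (x ^+ 2 - s ^+ 2) / 4 by rewrite s2; field.
  by rewrite /y1 /y2; field.
exists y1, y2; split.
- by rewrite polyE// fac subrr mul0r mulr0.
- by rewrite polyE// fac subrr !mulr0.
move=> e e0.
have c3 z : cont (fun x => 3 * x + 1) z.
  apply: cont_add; last exact: cont_cst.
  by apply: cont_mul; [exact: cont_cst|exact: cont_id].
have cm : cont m x.
  apply: cont_mul; last exact: cont_inv.
  have -> : (fun x : C => x ^+ 2) = (fun x => x * x) by apply/funext => w; rewrite expr2.
  by apply: cont_mul; exact: cont_id.
have [d1 d10 h1] := cont_neq0 (c3 x) x1.
have [d2 d20 h2] := cont_bounded cm.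
pose B := cabs x + cabs (m x) + 3.
have B0 : 0 < B by have := cabs_ge0 x; have := cabs_ge0 (m x); rewrite /B; lra.
have e2 : 0 < e * e / 2 by rewrite divr_gt0// mulr_gt0.
have [d3 d30 h3] := cm _ e2.
exists (Num.min (Num.min d1 d2) (Num.min d3 (Num.min 1 (e * e / 2 / B)))) => [|x' y'].
  by rewrite !lt_min d10 d20 d30 ltr01 divr_gt0.
rewrite !lt_min => /andP[/andP[/h1 n1 /h2 n2] /and3P[/h3 n3 n4 n5]].
have x1' : 3 * x' + 1 != 0.
  by rewrite -cabs_gt0; apply: le_lt_trans n1; rewrite divr_ge0 ?cabs_ge0.
rewrite polyE// => /eqP; rewrite mulf_eq0 (negbTE x1') /= => /eqP E.
have X := cabs_le_sub x' x.
have yB : cabs y' <= B.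
  rewrite leNgt; apply/negP => yB.
  have y0 : 0 < cabs y' by apply: lt_trans yB.
  have E2 : y' ^+ 2 = - (x' * y' + m x') by apply/eqP; rewrite -subr_eq0 opprK addrA E.
  have := cabsD (x' * y') (m x'); rewrite -cabsN -E2 cabsX cabsM expr2 => h.
  have h5 : cabs x' * cabs y' <= (cabs x + 1) * cabs y' by rewrite ler_wpM2r ?cabs_ge0//; lra.
  have h6 : cabs (m x) + 1 <= (cabs (m x) + 1) * cabs y'.
    by rewrite ler_peMr//; have := cabs_ge0 (m x); have := cabs_ge0 x; rewrite /B in yB; lra.
  have h7 : cabs y' * cabs y' <= (cabs x + cabs (m x) + 2) * cabs y' by lra.
  rewrite ler_pM2r// in h7; have := lt_le_trans yB h7.
  by rewrite ltNge => /negP; apply; rewrite /B; lra.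
have P : cabs ((y' - y1) * (y' - y2)) < e * e.
  rewrite -fac; have -> : y' ^+ 2 + x * y' + m x = (x - x') * y' + (m x - m x').
    by rewrite -[LHS]subr0 -E; ring.
  apply: le_lt_trans (cabsD _ _) _; rewrite cabsM (cabsC x) (cabsC (m x)).
  have : cabs (x' - x) * cabs y' <= e * e / 2.
    apply: le_trans (_ : _ <= e * e / 2 / B * B) _; last by rewrite divfK ?gt_eqF.
    by apply: ler_pM; rewrite ?cabs_ge0// ltW.
  lra.
have [|g1] := ltP (cabs (y' - y1)) e; first by left.
have [|g2] := ltP (cabs (y' - y2)) e; first by right.
by move: P; rewrite cabsM ltNge ler_pM// ltW.
Qed.

(** The point [x = -1/3] lies in all preimages, for it is related to [Z = 1];
    elsewhere the continuity of the roots applies. *)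
Lemma iter_open n : is_open [set x | ~ L n (coord_inv x)].
Proof.
elim: n => [|n IH] x /=.
  move=> /contrapT Dx; have [|d d0 hd] := @coord_inv_cont R x D.
    by apply: open_nbhs_nbhs; split.
  by exists d => // w /hd Dw; exact: (fun h => h Dw).
move=> nx; have x1 : 3 * x + 1 != 0.
  apply/negP => /eqP x1; apply: nx; exists (pt 1); first exact: one_in_iter.
  exists (pt 1); last by rewrite J1.
  have x0 : x != 0 by apply/negP => /eqP x0; move: x1; rewrite x0 mulr0 add0r => /eqP; rewrite oner_eq0.
  rewrite /coord_inv (negbTE x0) /Cov /=; apply/eqP; rewrite -subr_eq0.
  have -> : (1 + x^-1) ^+ 2 + (1 + x^-1) * 1 + 1 ^+ 2 - 3 = x^-1 ^+ 2 * (3 * x + 1) by field.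
  by rewrite x1 mulr0.
have [y1 [y2 [r1 r2 near]]] := roots_near x1.
have no y : cov_poly x y = 0 -> ~ L n (coord_inv (J_shift - y)).
  move=> h Ly; apply: nx; exists (coord_inv (J_shift - y)) => //.
  by apply/F_coord; rewrite opprB addrCA subrr addr0.
have [d1 d10 h1] := IH _ (no y1 r1); have [d2 d20 h2] := IH _ (no y2 r2).
have e0 : 0 < Num.min d1 d2 by rewrite lt_min d10 d20.
have [d d0 hd] := near _ e0.
have c3 : cont (fun x => 3 * x + 1) x.
  apply: cont_add; last exact: cont_cst.
  by apply: cont_mul; [exact: cont_cst|exact: cont_id].
have [d3 d30 h3] := cont_neq0 c3 x1.
exists (Num.min d d3) => [|x']; first by rewrite lt_min d0 d30.
rewrite lt_min => /andP[xd /h3 n1] [W LW [V cV WV]].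
have V1 : V <> pt 1.
  move=> V1; move: cV; rewrite V1 => /Cov_coord1 E.
  by move: n1; rewrite E cabs0; have := cabs_ge0 (3 * x + 1); lra.
move: cV WV; rewrite -(coordK V1) J_coord => /Cov_coord cV WV; rewrite WV in LW.
have shift y : J_shift - coord V - (J_shift - y) = - (coord V - y) by ring.
have [] := hd x' (coord V) xd cV; rewrite lt_min => /andP[g1 g2].
- by apply: h1 LW; rewrite shift cabsN.
- by apply: h2 LW; rewrite shift cabsN.
Qed.

Lemma one_in_limit_set : limit_set a D (pt 1).
Proof. by left=> n _; exact: one_in_iter. Qed.

Lemma regular_set_open : is_open [set x | regular_set a D (coord_inv x)].
Proof.
have minus : is_open [set x | ~ limit_set_minus a D (coord_inv x)].
  move=> x /= h.
  have [n hn] : exists n, ~ L n (coord_inv x).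
    by apply: contrapT => no; apply: h => n _; apply: contrapT => nn; apply: no; exists n.
  have [d d0 hd] := iter_open hn; exists d => // w /hd nw h2; exact: nw (h2 n I).
have plusE Z : limit_set_plus a D Z <-> limit_set_minus a D (J a Z).
  split=> [[W hW <-]|h]; first by rewrite J_invol.
  by exists (J a Z) => //; exact: J_invol.
move=> x /not_orP[h1 h2].
have [d1 d10 hd1] := minus x h1.
have h2' : ~ limit_set_minus a D (coord_inv (J_shift - x)).
  by rewrite -J_coord; move=> h; apply: h2; apply/plusE.
have [d2 d20 hd2] := minus _ h2'.
exists (Num.min d1 d2) => [|w]; first by rewrite lt_min d10 d20.
rewrite lt_min => /andP[w1 w2] [/hd1|/plusE]; first exact.
rewrite J_coord; apply: hd2; rewrite (_ : _ - _ = - (w - x)); last by ring.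
by rewrite cabsN.
Qed.

End limit_set.
End dynamics.

(** * Landing *)

Section landing.
Variable R : realType.
Local Notation C := R[i].
Local Notation S := (sphere R).
Implicit Types (z w x y : C) (Z W : S).

(** Bolzano-Weierstrass along [t --> +oo], by bisection. *)
Lemma cluster_of_bounded (u : R -> C) (B : R) :
  (forall T : R, exists2 t, T < t & cabs (u t) <= B) ->
  exists x, forall d T : R, 0 < d -> exists2 t, T < t & cabs (u t - x) < d.
Proof.
move=> hB; apply: contrapT => no.
have B0 : 0 <= B by have [t _] := hB 0; apply: le_trans; exact: cabs_ge0.
pose P a b c d := exists T : R, forall t, T < t -> ~ rect a b c d (u t).
have [T hT] : P (- B) B (- B) B; last first.
- have [t /hT nt uB] := hB T; apply: nt; split; rewrite -ler_norml.
    by apply: le_trans uB; exact: cabs_Re.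
  by apply: le_trans uB; exact: cabs_Im.
apply: rect_bisection; try lra.
- move=> x X y Y _ _ _ _ _ _ m n [T1 h1] [T2 h2] [T3 h3] [T4 h4].
  exists (Num.max (Num.max T1 T2) (Num.max T3 T4)) => t.
  rewrite !gt_max => /andP[/andP[/h1 n1 /h2 n2] /andP[/h3 n3 /h4 n4]] [/andP[z1 z2] /andP[z3 z4]].
  have [zm|zm] := leP (Re (u t)) m; have [zn|zn] := leP (Im (u t)) n.
  + by apply: n1; split; rewrite ?z1 ?z3.
  + by apply: n3; split; rewrite ?z1 ?z4 ?(ltW zn) ?zm.
  + by apply: n2; split; rewrite ?z2 ?z3 ?(ltW zm) ?zn.
  + by apply: n4; split; rewrite ?z2 ?z4 ?(ltW zm) ?(ltW zn).
- move=> p q _ _; pose z0 := p +i* q.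
  have [d [T [d0 hd]]] : exists d T : R, 0 < d /\ forall t, T < t -> d <= cabs (u t - z0).
    apply: contrapT => nd; apply: no; exists z0 => d T d0; apply: contrapT => nt.
    apply: nd; exists d, T; split=> // t Tt; rewrite leNgt; apply/negP => h.
    by apply: nt; exists t.
  exists (d / 2) => [|x X y Y _ xa _ _ yb _ h1 h2]; first by rewrite divr_gt0.
  exists T => t /hd h3 hu; have := cabs_rect (_ : rect x X y Y z0) hu => /(_ _)h.
  by have := h (conj xa yb); lra.
Qed.

Lemma eq0_small (c : C) (K : R) : 0 <= K ->
  (forall e : R, 0 < e -> e <= 1 -> cabs c <= K * e) -> c = 0.
Proof.
move=> K0 h; apply/eqP; rewrite -cabs_eq0; apply/negPn/negP => ne.
have n0 : 0 < cabs c by rewrite lt0r ne cabs_ge0.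
have m0 : 0 < cabs c / (K + 1) by rewrite divr_gt0//; lra.
have [e e0 /andP[e1]] := lt_both (ltr01 : 0 < 1 :> R) m0.
have := h e e0 (ltW e1); rewrite ltr_pdivlMr; last lra.
lra.
Qed.

(** Nearby pairs of related points whose displacements [d] and [d * (1 + r)] from
    [x] have a ratio tending to 1 make [x] a double root of the equation
    [cov_poly x (k - x) = 0] of fixed points. In terms of [p = x * (k - x)] this
    equation is [p * (3 * k - 1) + k^2 = 0]; a double root annihilates
    [k - 2 * x], as [k <> 0] excludes [3 * k = 1]. *)
Lemma double_fixed_point (k x : C) : k != 0 ->
  (forall e : R, 0 < e -> exists d r : C, [/\ d != 0, cabs d < e, cabs r < e &
     cov_poly (x + d) (k - (x + d * (1 + r))) = 0]) ->
  k - x = x.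
Proof.
move=> k0 h; set y := k - x.
pose p d r : C := (x + d) * (y - d * (1 + r)).
pose b d r : C := (3 * k - 1) * (- x * r - d * (1 + r)) - r * (3 * p d r + 2 * k) + d * r ^+ 2.
pose c0 : C := x * y * (3 * k - 1) + k ^+ 2.
pose b0 : C := (3 * k - 1) * (y - x).
have E d r : cov_poly (x + d) (k - (x + d * (1 + r))) = c0 + d * (b0 + b d r).
  by rewrite /cov_poly /c0 /b0 /b /p /y; ring.
pose K : R := cabs (3 * k - 1) * (cabs x + 2) + (3 * ((cabs x + 1) * (cabs y + 2)) + 2 * cabs k) + 1.
have X0 := cabs_ge0 x; have Y0 := cabs_ge0 y; have Q0 := cabs_ge0 k.
have M0 := cabs_ge0 (3 * k - 1).
have real3 : cabs (3 : C) = 3.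
  by have := cabs_real (3 : R); rewrite rmorph_nat ger0_norm.
have real2 : cabs (2 : C) = 2.
  by have := cabs_real (2 : R); rewrite rmorph_nat ger0_norm.
have K0 : 0 <= K by rewrite /K !addr_ge0// ?mulr_ge0// ?addr_ge0.
have bK d r e : 0 < e -> e <= 1 -> cabs d < e -> cabs r < e -> cabs (b d r) <= K * e.
  move=> e0 e1 de re; have D0 := cabs_ge0 d; have R0 := cabs_ge0 r.
  have r2 : cabs (1 + r) <= 2 by have := cabsD 1 r; rewrite cabs1; lra.
  have pB : cabs (p d r) <= (cabs x + 1) * (cabs y + 2).
    rewrite /p cabsM; apply: ler_pM; rewrite ?cabs_ge0//.
      by apply: le_trans (cabsD _ _) _; lra.
    apply: le_trans (cabsD _ _) _; rewrite cabsN cabsM lerD2l.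
    by apply: le_trans (ler_pM _ _ (ltW de) r2) _; rewrite ?cabs_ge0//; lra.
  have t1 : cabs ((3 * k - 1) * (- x * r - d * (1 + r))) <= cabs (3 * k - 1) * ((cabs x + 2) * e).
    rewrite cabsM ler_wpM2l//; apply: le_trans (cabsD _ _) _; rewrite cabsN !cabsM cabsN mulrDl.
    rewrite lerD// ?ler_wpM2l ?(ltW re)// mulrC; apply: ler_pM; rewrite ?cabs_ge0//; exact: ltW.
  have t2 : cabs (r * (3 * p d r + 2 * k)) <= e * (3 * ((cabs x + 1) * (cabs y + 2)) + 2 * cabs k).
    rewrite cabsM ler_pM ?cabs_ge0 ?(ltW re)//; apply: le_trans (cabsD _ _) _.
    by rewrite (cabsM 3) (cabsM 2) real3 real2; lra.
  have t3 : cabs (d * r ^+ 2) <= e.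
    rewrite cabsM cabsX; apply: le_trans (_ : _ <= e * 1) _; last by rewrite mulr1.
    by apply: ler_pM; rewrite ?exprn_ge0 ?(ltW de)// exprn_ile1//; lra.
  apply: le_trans (cabsD _ _) _; apply: le_trans (lerD (cabsD _ _) t3) _; rewrite cabsN.
  by rewrite /K; lra.
have c00 : c0 = 0.
  apply: (@eq0_small _ (cabs b0 + K)) => [|e e0 e1]; first by rewrite addr_ge0 ?cabs_ge0.
  have [d [r [d0 de re]]] := h e e0; rewrite E => /eqP; rewrite addr_eq0 => /eqP ->.
  rewrite cabsN cabsM mulrC; apply: ler_pM; rewrite ?cabs_ge0 ?(ltW de)//.
  apply: le_trans (cabsD _ _) _; rewrite lerD2l; apply: le_trans (bK _ _ _ e0 e1 de re) _.
  by rewrite ler_piMr.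
have b00 : b0 = 0.
  apply: (@eq0_small _ K K0) => e e0 e1.
  have [d [r [d0 de re]]] := h e e0; rewrite E c00 add0r => /eqP.
  by rewrite mulf_eq0 (negbTE d0) /= addr_eq0 => /eqP ->; rewrite cabsN; exact: bK.
move/eqP: b00; rewrite mulf_eq0 => /orP[/eqP k3|]; last by rewrite subr_eq0 => /eqP.
by move: c00; rewrite /c0 k3 mulr0 add0r => /eqP; rewrite expf_eq0 /= (negbTE k0).
Qed.

Section germ.
Variables (a : C) (DCov DJ : set S).
Hypothesis a1 : a != 1.
Hypotheses (cover : DCov `|` DJ = ~` [set pt 1]).
Hypotheses (DJ_J : DJ `&` corr_image (graph_J a) DJ = set0).

Local Notation Om := (regular_set a DCov).

Lemma one_notin_DCov : ~ DCov (pt 1).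
Proof.
by move=> h; have : (DCov `|` DJ) (pt 1) by [left]; rewrite cover => /(_ erefl).
Qed.

(** [DJ] contains no fixed point of [J a]. *)
Lemma J_fixed_in_domain Z : J a Z = Z -> Z <> pt 1 -> DCov Z.
Proof.
move=> JZ Z1; have : (DCov `|` DJ) Z by rewrite cover.
case=> // ZJ; have : (DJ `&` corr_image (graph_J a) DJ) Z.
  by split => //; exists Z.
by rewrite DJ_J.
Qed.

Lemma J_fixed_regular Z : J a Z = Z -> Z <> pt 1 -> Om Z.
Proof.
move=> JZ Z1 [h|[W h JW]].
  exact: (h 0%N I) (J_fixed_in_domain JZ Z1).
have WZ : W = Z by rewrite -(J_invol a1 W) JW JZ.
by move: h; rewrite WZ => h; exact: (h 0%N I) (J_fixed_in_domain JZ Z1).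
Qed.

(** If [Psi (it)] does not tend to 1, the coordinates of these points have a
    cluster point [x], outside the regular set. Then [ratio_bound] applies to
    [coord (Psi z) - x] and makes [x] a double fixed point; so [x] is the fixed
    point of [J a] other than 1, which belongs to the regular set. *)
Lemma landing (Psi : C -> S) (d : C) : cabs d = 1 -> Im d = 0 ->
  (forall z, 0 < Im z -> Om (Psi z)) ->
  (forall z, 0 < Im z -> holo (fun w => coord (Psi w)) z) ->
  (forall z w, 0 < Im z -> 0 < Im w -> Psi z = Psi w -> z = w) ->
  (forall z, 0 < Im z -> F a (Psi z) (Psi (z + d))) ->
  (forall x, Om (coord_inv x) -> exists e T : R, 0 < e /\
     forall t, T < t -> e <= cabs (coord (Psi (0 +i* t)) - x)) ->
  forall V, nbhs (pt 1) V -> exists T : R, forall t, T < t -> V (Psi (0 +i* t)).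
Proof.
move=> d1 dI PsiO Psih Psii PsiF esc V /nbhs_pt[r r0 hr]; apply: contrapT => no.
have ne1 z : 0 < Im z -> Psi z <> pt 1.
  by move=> /PsiO hz E; apply: hz; rewrite E; exact: one_in_limit_set one_notin_DCov.
have often T : exists2 t, T < t & cabs (coord (Psi (0 +i* t))) <= r^-1.
  apply: contrapT => nt; apply: no; exists (Num.max T 0) => t; rewrite gt_max => /andP[Tt t0].
  have big : r^-1 < cabs (coord (Psi (0 +i* t))).
    by rewrite ltNge; apply/negP => h; apply: nt; exists t.
  have u0 : 0 < cabs (coord (Psi (0 +i* t))) by apply: lt_trans big; rewrite invr_gt0.
  rewrite -(coordK (ne1 (0 +i* t) t0)) /coord_inv -cabs_eq0 gt_eqF//; apply: hr.
  by rewrite addrAC subrr add0r cabsV -[ltRHS]invrK ltf_pV2// posrE// invr_gt0.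
have [x hx] := cluster_of_bounded often.
have nOm : ~ Om (coord_inv x).
  move=> /esc[e [T [e0 he]]]; have [t Tt xe] := hx e T e0.
  by have := he t Tt; rewrite leNgt xe.
pose u z := coord (Psi z) + (- x).
have hu z : 0 < Im z -> holo u z.
  by move=> /Psih h; apply: holo_add => //; exact: holo_cst.
have u0 z : 0 < Im z -> u z != 0.
  move=> z0; rewrite subr_eq0; apply/negP => /eqP E; apply: nOm.
  by rewrite -E coordK; [exact: PsiO|exact: ne1].
have ui z w : 0 < Im z -> 0 < Im w -> u z = u w -> z = w.
  move=> z0 w0 /addIr E; apply: Psii => //.
  by rewrite -(coordK (ne1 _ z0)) E coordK//; exact: ne1.
have k0 : J_shift a != 0 by rewrite /J_shift mulf_neq0 ?invr_eq0 ?subr_eq0// pnatr_eq0.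
(* x + u z and x + u (z + d) are the coordinates of related points *)
have fix2 : J_shift a - x = x.
  apply: double_fixed_point => // e e0.
  have L0 := log_bound_gt0 R.
  (* so large that 2 * log_bound / t < e *)
  have [t Tt xe] := hx e (2 * log_bound R * (1 + e^-1)) e0.
  have ei : 0 < e^-1 by rewrite invr_gt0.
  have tL : 2 * log_bound R < t by apply: le_lt_trans Tt; rewrite ler_peMr//; lra.
  have t0 : 0 < t by lra.
  have b := ratio_bound d1 dI (ltW tL) hu u0 ui.
  set z : C := 0 +i* t in b xe *.
  have z0 : 0 < Im z by [].
  have z'0 : 0 < Im (z + d) by move: dI; case: (d) => dx dy /= ->; rewrite addr0.
  exists (u z), ((u (z + d) - u z) / u z); split => //; first exact: u0.
  - rewrite cabsM cabsV ltr_pdivrMr ?cabs_gt0 ?u0//; apply: le_lt_trans b _.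
    rewrite ltr_pM2r ?cabs_gt0 ?u0// ltr_pdivrMr//.
    have : e * (2 * log_bound R * (1 + e^-1)) < e * t by rewrite ltr_pM2l.
    have : e * (2 * log_bound R * (1 + e^-1)) = 2 * log_bound R * e + 2 * log_bound R.
      by field; rewrite gt_eqF.
    have : 0 < log_bound R * e by rewrite mulr_gt0.
    lra.
  - have -> : x + u z = coord (Psi z) by rewrite /u; ring.
    have -> : x + u z * (1 + (u (z + d) - u z) / u z) = coord (Psi (z + d)).
      have -> : u z * (1 + (u (z + d) - u z) / u z) = u (z + d) by field; exact: u0.
      by rewrite /u; ring.
    by apply/(F_coord a1); rewrite !coordK//; [exact: PsiF|exact: ne1|exact: ne1].
apply: nOm; apply: J_fixed_regular; last exact: coord_inv_neq1.
by rewrite J_coord// fix2.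
Qed.

End germ.
End landing.

(** * The Boettcher map *)

Section boettcher.
Variable R : realType.
Local Notation C := R[i].
Local Notation S := (sphere R).
Implicit Types (z w x y : C) (Z W : S).

Lemma holo_coord (phi : S -> C) x : holomorphic_at phi (coord_inv x) ->
  holo (fun w => phi (coord_inv w)) x.
Proof.
rewrite /coord_inv; case: eqVneq => [->|x0] /derivable_holo hphi.
  pose m w : C := w * (1 + w)^-1.
  have m0 : m 0 = 0 by rewrite /m mul0r.
  have c1 : holo (fun w : C => 1 + w) 0 by apply: holo_add; [exact: holo_cst|exact: holo_id].
  have n1 : 1 + 0 != 0 :> C by rewrite addr0 oner_eq0.
  have [d d0 hd] := cont_neq0 (holo_cont c1) n1.
  apply: (holo_local (f := fun w => (phi \o @chart_infty R) (m w)) d0).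
    move=> w /hd h1; have w1 : 1 + w != 0.
      by rewrite -cabs_gt0; apply: le_lt_trans h1; rewrite divr_ge0 ?cabs_ge0.
    rewrite /chart_infty /m /= mulf_eq0 invr_eq0 (negbTE w1) orbF.
    by case: eqVneq => // w0; congr (phi (pt _)); field; rewrite w0 w1.
  apply: holo_comp; last by rewrite m0.
  apply: holo_mul; first exact: holo_id.
  by apply: holo_inv => //; rewrite addr0 oner_eq0.
have [d d0 hd] := cont_neq0 (@cont_id _ x) x0.
apply: (holo_local (f := fun w => (phi \o @pt R) (1 + w^-1)) d0).
  move=> w /hd h1; have w0 : w != 0.
    by rewrite -cabs_gt0; apply: le_lt_trans h1; rewrite divr_ge0 ?cabs_ge0.
  by rewrite (negbTE w0).
apply: (holo_comp (f := fun w => 1 + w^-1)) => //.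
by apply: holo_add; [exact: holo_cst|apply: holo_inv => //; exact: holo_id].
Qed.

Lemma neg_inv_i (t : R) : t != 0 -> - (0 +i* t)^-1 = 0 +i* t^-1 :> C.
Proof.
move=> t0; apply/eqP; rewrite eq_complex /=; apply/andP; split; apply/eqP.
  by rewrite mul0r oppr0.
by rewrite expr0n add0r opprK; field.
Qed.

Section inverse.
Variables (Om : set S) (phi : S -> C) (psi : C -> S).
Hypothesis Om1 : ~ Om (pt 1).
Hypothesis Om_open : is_open [set x | Om (coord_inv x)].
Hypothesis conf : conformal_homeomorphism Om (@upper_half_plane R) phi psi.

Let H z := 0 < Im z.

Let psiO z : H z -> Om (psi z).
Proof. by case: conf => -[_ [h _] _ _] _; exact: h. Qed.

Let phiK Z : Om Z -> psi (phi Z) = Z.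
Proof. by case: conf => -[_ _ h _] _; exact: h. Qed.

Let psiK z : H z -> phi (psi z) = z.
Proof. by case: conf => -[_ _ _ h] _; exact: h. Qed.

Let psi1 z : H z -> psi z <> pt 1.
Proof. by move=> /psiO h E; apply: Om1; rewrite -E. Qed.

Lemma half_plane_open z : H z -> exists2 d : R, 0 < d & forall w, cabs (w - z) < d -> H w.
Proof.
move=> z0; exists (Im z) => // w hw; have := le_lt_trans (cabs_Im _) hw.
have -> : Im (w - z) = Im w - Im z by case: (w) (z) => ? ? [].
rewrite ltr_norml /H => /andP[]; lra.
Qed.

Lemma psi_cont z : H z -> cont (fun w => coord (psi w)) z.
Proof.
move=> z0 e e0; case: conf => -[_ [_ cpsi] _ _] _.
have cz : nbhs z [set w | upper_half_plane w ->
    psi w <> pt 1 /\ cabs (coord (psi w) - coord (psi z)) < e].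
  have := (subspace_continuousP _ psi).1 cpsi z z0.
  by move=> /(_ _ (coord_cont (psi1 z0) e0)).
have [d d0 hd] := (nbhs_disk z _).1 cz; have [d' d'0 hd'] := half_plane_open z0.
exists (Num.min d d') => [|w]; first by rewrite lt_min d0 d'0.
by rewrite lt_min => /andP[/hd h /hd' w0]; case: (h w0).
Qed.

Lemma phi_holo x : Om (coord_inv x) -> holo (fun w => phi (coord_inv w)) x.
Proof. by move=> hx; apply: holo_coord; case: conf => _; exact. Qed.

Lemma psi_holo z : H z -> holo (fun w => coord (psi w)) z.
Proof.
move=> z0; have hz : Om (coord_inv (coord (psi z))).
  by rewrite coordK; [exact: psiO|exact: psi1].
have [r r0 hr] := Om_open hz; have [e e0 he] := half_plane_open z0.
apply: (holo_inverse (f := fun x => phi (coord_inv x)) r0 _ _ e0).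
- by move=> w /hr; exact: phi_holo.
- move=> x y /hr hx /hr hy E; rewrite -(coord_invK x) -(coord_invK y); congr coord.
  by rewrite -(phiK hx) -(phiK hy) E.
- move=> w /he w0; split; first exact: psi_cont.
  by rewrite coordK; [exact: psiK|exact: psi1].
Qed.

Lemma psi_inj z w : H z -> H w -> psi z = psi w -> z = w.
Proof. by move=> z0 w0 E; rewrite -(psiK z0) E psiK. Qed.

Lemma psi_escape x (e : R) : 0 < e -> Om (coord_inv x) ->
  exists2 d : R, 0 < d & forall z, H z -> cabs (coord (psi z) - x) < d ->
    cabs (z - phi (coord_inv x)) < e.
Proof.
move=> e0 hx; have [d d0 hd] := holo_cont (phi_holo hx) e0.
exists d => // z z0 /hd; rewrite coordK; last exact: psi1.
by rewrite psiK.
Qed.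

End inverse.
End boettcher.

Theorem proposition1 (R : realType) (a : R[i])
    (a_in : connectedness_locus a)
    (DCov DJ : set (sphere R)) (hD : klein_pair a DCov DJ)
    (phi : sphere R -> R[i]) (psi : R[i] -> sphere R)
    (hphi : boettcher_map a (regular_set a DCov) phi psi) :
  (psi (0 +i* t) @[t --> +oo%R] --> pt (1 : R[i])) /\
  (psi (0 +i* t) @[t --> (0 : R)^'+] --> pt (1 : R[i])).
Proof.
have a1 : a != 1 by case: a_in => -[].
have [[openD _ _ _ _] [_ _ _ DJ_J _] cover _ _] := hD.
have [conf [fa [fa' [fb [fb' [homa homb Fab phia phib]]]]]] := hphi.
have Om1 : ~ regular_set a DCov (pt 1).
  by move=> h; apply: h; exact: (one_in_limit_set a1 (one_notin_DCov cover)).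
have Om_open := regular_set_open a1 openD (one_notin_DCov cover).
have psiO (z : R[i]) : 0 < Im z -> regular_set a DCov (psi z).
  by case: conf => -[_ [h _] _ _] _; exact: h.
have phiO Z : regular_set a DCov Z -> 0 < Im (phi Z).
  by case: conf => -[[h _] _ _ _] _; exact: h.
have phiK Z : regular_set a DCov Z -> psi (phi Z) = Z.
  by case: conf => -[_ _ h _] _; exact: h.
have psiK (z : R[i]) : 0 < Im z -> phi (psi z) = z.
  by case: conf => -[_ _ _ h] _; exact: h.
have Fa (z : R[i]) : 0 < Im z -> F a (psi z) (psi (alpha z)).
  move=> z0; have O := psiO z z0.
  have Oa : regular_set a DCov (fa (psi z)).
    by case: homa => -[h _] _ _ _; exact: h.
  by rewrite -{2}(psiK z z0) -phia// phiK//; apply/Fab => //; left.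
have Fb (z : R[i]) : 0 < Im z -> F a (psi z) (psi (beta z)).
  move=> z0; have O := psiO z z0.
  have Ob : regular_set a DCov (fb (psi z)).
    by case: homb => -[h _] _ _ _; exact: h.
  by rewrite -{2}(psiK z z0) -phib// phiK//; apply/Fab => //; right.
have land := landing a1 cover DJ_J.
split.
  move=> V hV; have [|||||||T hT] := land psi 1 _ _ _ _ _ _ _ V hV.
  - exact: cabs1.
  - by [].
  - exact: psiO.
  - by move=> z; exact: (psi_holo Om1 Om_open conf).
  - by move=> z w; exact: (psi_inj conf).
  - by move=> z /Fa.
  - move=> x hx; have [d d0 hd] := psi_escape Om1 conf ltr01 hx.
    exists d, (Num.max 0 (cabs (phi (coord_inv x)) + 1)); split => // t.
    rewrite gt_max => /andP[t0 tT]; rewrite leNgt; apply/negP => /(hd (0 +i* t) t0).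
    move=> h; have := cabs_le_sub (0 +i* t) (phi (coord_inv x)).
    have : t <= cabs (0 +i* t) by apply: le_trans (cabs_Im _); exact: ler_norm.
    move=> h1 h2; have : t < t by lra.
    by rewrite ltxx.
  - by exists T; split; [exact: num_real|exact: hT].
(* z |-> -1/z exchanges 0 and infinity and conjugates beta to z |-> z - 1 *)
pose Psi (z : R[i]) := psi (- z^-1).
have inv_im (z : R[i]) : 0 < Im z -> 0 < Im (- z^-1).
  case: z => x y /= y0; rewrite opprK divr_gt0//.
  by rewrite ltr_wpDl ?sqr_ge0// exprn_gt0.
have im0 (z : R[i]) : 0 < Im z -> z != 0.
  by move=> z0; apply/negP => /eqP E; move: z0; rewrite E ltxx.
move=> V hV; have [|||||||T hT] := land Psi (-1) _ _ _ _ _ _ _ V hV.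
- by rewrite cabsN cabs1.
- by rewrite /= oppr0.
- by move=> z /inv_im; exact: psiO.
- move=> z z0; apply: (holo_comp (f := fun z => - z^-1) (g := fun w => coord (psi w))).
    apply: (holo_local (f := fun z => -1 * z^-1) ltr01) => [w _|]; first by rewrite mulN1r.
    apply: holo_mul; first exact: holo_cst.
    by apply: holo_inv; [exact: holo_id|exact: im0].
  by apply: (psi_holo Om1 Om_open conf); exact: inv_im.
- move=> z w z0 w0 E; apply: invr_inj; apply: oppr_inj.
  exact: (psi_inj conf (inv_im z z0) (inv_im w w0) E).
- move=> z z0; have := Fb _ (inv_im _ z0); rewrite /Psi.
  have z1 : z + -1 != 0 by apply: im0; move: z0; case: (z) => x y /=; rewrite oppr0 addr0.
  congr (F a _ (psi _)); rewrite /beta; have zn := im0 _ z0.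
  have z2 : 1 - z != 0 by rewrite -oppr_eq0 opprB.
  by field; rewrite zn z1.
- move=> x hx; set w := phi (coord_inv x); have w0 : 0 < Im w by exact: phiO.
  have e0 : 0 < Im w / 2 by rewrite divr_gt0.
  have [d d0 hd] := psi_escape Om1 conf e0 hx.
  exists d, (2 / Im w); split => // t tT; rewrite leNgt; apply/negP.
  have t0 : 0 < t by apply: lt_trans tT; rewrite divr_gt0.
  rewrite /Psi neg_inv_i ?gt_eqF// => /(hd (0 +i* t^-1) ltac:(by rewrite /= invr_gt0)) h.
  have := le_lt_trans (cabs_Im _) h.
  have -> : Im ((0 +i* t^-1) - w) = t^-1 - Im w by case: (w).
  have ti : t^-1 < Im w / 2.
    by rewrite -(invf_div 2 (Im w)) ltf_pV2 ?posrE ?divr_gt0.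
  rewrite ltr_norml => /andP[] h1 h2; have : Im w < Im w by lra.
  by rewrite ltxx.
have T0 : 0 < Num.max 1 T by rewrite lt_max ltr01.
exists (Num.max 1 T)^-1; first by rewrite /= invr_gt0.
move=> s /=; rewrite sub0r normrN => hs s0; rewrite gtr0_norm// in hs.
have := hT s^-1; rewrite /Psi.
rewrite neg_inv_i ?invr_eq0 ?gt_eqF// invrK.
apply; have : Num.max 1 T < s^-1 by rewrite -[ltLHS]invrK ltf_pV2// posrE invr_gt0.
by rewrite gt_max => /andP[].
Qed.
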